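(* Let $0<\beta<1$, $R\ge 1$, and let $u$ be a solution of $$-\Delta u+V(x)u=0\quad\text{in } B_R\subset\mathbb{R}^n .$$ Assume $\|V\|_{C^{0,\beta}(B_R)}\le M$ for some large constant $M\geq 1$. Let $0<r_1<r_2<2r_2<r_3<\frac R2$. Then there exists a constant $C=C(n,\beta)>0$ (depending only on $n$ and $\beta$) such that $$\|u\|_{L^2(B_{r_2})}\le \exp\Big\{C\,M^{\frac{2}{\beta+3}}\,R^{\frac{4+2\beta}{\beta+3}}\Big\}\,\|u\|_{L^2(B_{r_1})}^{\theta}\,\|u\|_{L^2(B_{r_3})}^{1-\theta},$$ where $$0<\theta=\frac{\log \frac{r_3}{2r_2}}{\log\frac{r_3}{r_1}}<1 .$$
   Context: $B_r\subset\mathbb{R}^n$ is the open Euclidean ball of radius $r$ centered at the origin. For $0<\beta<1$, $[V]_{C^{0,\beta}(B_R)}=\sup_{x\ne y\in B_R}\frac{|V(x)-V(y)|}{|x-y|^\beta}$ and $\|V\|_{C^{0,\beta}(B_R)}=\max\{\|V\|_{L^\infty(B_R)},[V]_{C^{0,\beta}(B_R)}\}$. The potential $V$ is allowed to be complex-valued (and then $u$ as well). Solutions are classical solutions, equivalently (by elliptic regularity) weak solutions. The constant $C$ does not depend on $u$, $V$, $M$, $R$, $r_1,r_2,r_3$. *)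

(* Defs.v *)
From HB Require Import structures.
From mathcomp Require Import all_boot all_order all_algebra.
From mathcomp Require Import all_classical all_reals all_analysis.
From mathcomp Require Import complex.

Set Implicit Arguments.
Unset Strict Implicit.
Unset Printing Implicit Defensive.
Import Order.TTheory GRing.Theory Num.Theory.
Import numFieldNormedType.Exports.

Local Open Scope classical_set_scope.
Local Open Scope ring_scope.
Local Open Scope complex_scope.

(* The SigmaFiniteMeasure instance of m1 \x m2 is shadowed in the library by   *)
(* the one for subprobability measures, hence this restatement.               *)
Lemma sigma_finite_product d1 d2 (T1 : measurableType d1)
    (T2 : measurableType d2) (R : realType)
    (m1 : {sigma_finite_measure set T1 -> \bar R})
    (m2 : {sigma_finite_measure set T2 -> \bar R}) :
  sigma_finite setT (m1 \x m2)%E.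
Proof.
have /sigma_finiteP[F [TF ndF Foo]] := sigma_finiteT m1.
have /sigma_finiteP[G [TG ndG Goo]] := sigma_finiteT m2.
exists (fun n => F n `*` G n).
  rewrite -setXTT TF TG predeqE => -[x y]; split.
    move=> [/= [n _ Fnx] [k _ Gky]]; exists (maxn n k) => //; split.
    - by move: x Fnx; exact/subsetPset/ndF/leq_maxl.
    - by move: y Gky; exact/subsetPset/ndG/leq_maxr.
  by move=> [n _ []/= ? ?]; split; exists n.
move=> k; have [? ?] := Foo k; have [? ?] := Goo k.
split; first exact: measurableX.
by rewrite product_measure1E// lte_mul_pinfty// ge0_fin_numE.
Qed.

(* The library has Lebesgue measure on R and binary products only. Lebesgue   *)
(* measure on R^n is built here as the n-fold product of lebesgue_measure,    *)
(* on n.-tuple R with the library's product (hence Borel) sigma-algebra.      *)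
Section lebesgue_measure_tuple.
Context (R : realType).
Let RR : measurableType _ := measurableTypeR R.

Definition tuple_cons n (p : RR * n.-tuple RR) : n.+1.-tuple RR :=
  [the n.+1.-tuple RR of p.1 :: p.2].

Lemma measurable_tuple_cons n : measurable_fun setT (@tuple_cons n).
Proof. exact: measurable_cons. Qed.

Section step.
Context (n : nat) (mu : {sigma_finite_measure set (n.-tuple RR) -> \bar R}).

Definition lebesgue_tuple_step : set (n.+1.-tuple RR) -> \bar R :=
  pushforward (@lebesgue_measure R \x mu)%E (@tuple_cons n).

Let mcons A : measurable A -> measurable (@tuple_cons n @^-1` A).
Proof.
by move=> mA; rewrite -[X in measurable X]setTI; exact: measurable_tuple_cons.
Qed.

Let step0 : lebesgue_tuple_step set0 = 0%E.
Proof. by rewrite /lebesgue_tuple_step /pushforward preimage_set0 measure0. Qed.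

Let step_ge0 A : (0 <= lebesgue_tuple_step A)%E.
Proof. by rewrite /lebesgue_tuple_step /pushforward measure_ge0. Qed.

Let step_sigma_additive : semi_sigma_additive lebesgue_tuple_step.
Proof.
move=> F mF tF mUF; rewrite /lebesgue_tuple_step /pushforward preimage_bigcup.
apply: measure_semi_sigma_additive.
- by move=> k; exact: mcons.
- apply/trivIsetP => /= i j _ _ ij; rewrite -preimage_setI.
  by move/trivIsetP : tF => /(_ _ _ _ _ ij) ->//; rewrite preimage_set0.
- by rewrite -preimage_bigcup; exact: mcons.
Qed.

HB.instance Definition _ := isMeasure.Build _ _ _ lebesgue_tuple_step
  step0 step_ge0 step_sigma_additive.

Let uncons (t : n.+1.-tuple RR) : RR * n.-tuple RR :=
  (thead t, [tuple of behead t]).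

Let consK : cancel (@tuple_cons n) uncons.
Proof. by move=> [x t]; congr pair; apply/val_inj. Qed.

Let muncons : measurable_fun setT uncons.
Proof.
by apply: measurable_fun_pair; [exact: measurable_tnth
                               |exact: measurable_behead].
Qed.

Let step_sigma_finite : sigma_finite setT lebesgue_tuple_step.
Proof.
have [F TF Foo] := sigma_finite_product (@lebesgue_measure R) mu.
exists (fun k => uncons @^-1` F k).
  by rewrite -preimage_bigcup -TF preimage_setT.
move=> k; have [mF Fk] := Foo k; split.
  by rewrite -[X in measurable X]setTI; exact: muncons.
rewrite /lebesgue_tuple_step /pushforward.
suff -> : @tuple_cons n @^-1` (uncons @^-1` F k) = F k by [].
by apply/funext => p; rewrite /preimage /= consK.
Qed.

HB.instance Definition _ := Measure_isSigmaFinite.Build _ _ _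
  lebesgue_tuple_step step_sigma_finite.

End step.

Fixpoint lebesgue_tuple n : {sigma_finite_measure set (n.-tuple RR) -> \bar R} :=
  match n with
  | 0 => [the {sigma_finite_measure set (0.-tuple RR) -> \bar R}
          of @dirac _ (0.-tuple RR) [tuple] R]
  | n'.+1 => [the {sigma_finite_measure set (n'.+1.-tuple RR) -> \bar R}
              of lebesgue_tuple_step (lebesgue_tuple n')]
  end.

End lebesgue_measure_tuple.

Lemma lebesgue_tuple_box (R : realType) n (A : 'I_n -> set (measurableTypeR R)) :
  (forall i, measurable (A i)) ->
  lebesgue_tuple R n [set t | forall i, A i (tnth t i)] =
    (\prod_(i < n) lebesgue_measure (A i))%E.
Proof.
elim: n A => [|n IH] A mA.
  rewrite big_ord0 /= /dirac indicE mem_set// => -[]//.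
rewrite big_ord_recl -(IH (fun i => A (lift ord0 i)))//.
rewrite -product_measure1E//=; last first.
  rewrite (_ : [set t | _] =
    \bigcap_(i in [set: 'I_n]) ((fun t => tnth t i) @^-1` A (lift ord0 i))).
    apply: fin_bigcap_measurable => // i _.
    rewrite -[X in measurable X]setTI; exact: measurable_tnth.
  by apply/seteqP; split => t /= h i => [_|]; apply: h.
rewrite /lebesgue_tuple_step /pushforward; congr product_measure1.
apply/seteqP; split => -[x t] /= h.
  split; first exact: h ord0.
  by move=> i; have := h (lift ord0 i); rewrite /tuple_cons tnthS.
move=> i; case: (unliftP ord0 i) => [j|] ->; last exact: h.1.
by rewrite /tuple_cons tnthS; exact: h.2.
Qed.

Section three_ball_setting.
Context (R : realType) (n : nat).
Implicit Types (x y : 'rV[R]_n) (U : set 'rV[R]_n) (f : 'rV[R]_n -> R)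
  (u V : 'rV[R]_n -> R[i]).

(* The library norm `|x| on 'rV[R]_n is the sup norm. *)
Definition enorm x : R := Num.sqrt (\sum_(i < n) x ord0 i ^+ 2).

Definition eball (r : R) : set 'rV[R]_n := [set x | enorm x < r].

Definition partial (i : 'I_n) f : 'rV[R]_n -> R := 'D_(delta_mx ord0 i) f.

Definition C1_on U f : Prop := forall x, U x ->
  {for x, continuous f} /\
  forall i, derivable f x (delta_mx ord0 i) /\ {for x, continuous (partial i f)}.

Definition C2_on U f : Prop := C1_on U f /\ forall i, C1_on U (partial i f).

Definition laplacian f x : R := \sum_(i < n) partial i (partial i f) x.

Definition re_part u : 'rV[R]_n -> R := fun x => complex.Re (u x).
Definition im_part u : 'rV[R]_n -> R := fun x => complex.Im (u x).

Definition claplacian u x : R[i] :=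
  laplacian (re_part u) x +i* laplacian (im_part u) x.

Definition classical_solution U V u : Prop :=
  [/\ C2_on U (re_part u), C2_on U (im_part u) &
      forall x, U x -> - claplacian u x + V x * u x = 0].

Definition cabs (z : R[i]) : R := ComplexField.Normc.normc z.

Definition Lp_norm_on (p : \bar R) U u : \bar R :=
  let g (t : n.-tuple (measurableTypeR R)) : \bar R :=
    ((EFin \o cabs \o u) \_ U) (\row_i tnth t i) in
  'N[lebesgue_tuple R n]_p[g].

Definition holder_seminorm (b : R) U V : \bar R :=
  ereal_sup [set z | exists x y, [/\ U x, U y, x != y &
    z = (cabs (V x - V y) / enorm (x - y) `^ b)%:E]].

Definition holder_norm (b : R) U V : \bar R :=
  Order.max (Lp_norm_on +oo%E U V) (holder_seminorm b U V).

End three_ball_setting.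
Arguments eball {R} n r.

(* Main.v *)
Require Import Defs.
From mathcomp Require Import all_boot all_order all_algebra.
From mathcomp Require Import all_classical all_reals all_analysis.
From mathcomp Require Import measurable_realfun ess_sup_inf complex ring lra.

(** The inequality says that the logarithm of the mass of u in a ball is, up to
    the size of the exponent, a convex function of the logarithm of the radius.
    It is proved by the monotonicity of a frequency.

    Weighted masses. Let <f>_k denote the integral of f against the weight
    (s - |x|^2)_+^k, let E be the Euler field x.grad, and put H = <|u|^2>_m,
    B = <Re(conj u E u)>_m and b = B / H, with a parameter m. The weight
    vanishes on the sphere and is homogeneous, so integrations by parts produce
    no boundary term and s H' = (m + n/2 + b) H (normsq_scaling). If b is
    nondecreasing up to an error of size m s / R^2, then log H is convex in
    log s up to an error of size m (log_three_point). At the points r1^2,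
    (2 r2)^2, r3^2 the interpolation exponent is exactly theta. On the ball of
    radius r2 the weight with s = (2 r2)^2 is at least (3 r2^2)^m, and
    3/4 replaces 1 in the comparison with the L^2 norms, which again costs a
    factor exp(O(m)) (mass_le_wint0, log_combine).

    Monotonicity. Split V = A + i Z + W, where A and Z are mollifications of the
    real and imaginary parts at a scale eps, and W is small (mollify). The
    energy I = <|grad u|^2 + A |u|^2>_(m+1) is 2 (m + 1) B up to a term in W.
    The Rellich identity (energy_scaling) gives a formula for
    s (I / H)' in which, with Y = E u - b u, the leading term is
    2 (m + 1) <|Y|^2>_m / H (frequency_expand). Subtracting b u is what makes
    the bound independent of the frequency: W meets only Y, so it costs
    |W|^2 / m. The term in Z is not small. Completing the square in
    |Y - i rho Z u / (2 m)|^2 reverses its sign (pointwise_square); on the other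
    hand integrating the divergence of Z Im(conj u grad u) computes it
    (twist_ibp), and the two contributions of |Z|^2 cancel up to 1 / m^2. What
    remains is a term in grad Z, which is harmless even for large b because
    the weighted mass then concentrates near the sphere (mass_concentration,
    gradient_cross_ge). Altogether s (I / H)' >= - 5 m^2 s / R^2
    (frequency_inequality) as soon as M R^2 <= m^2, |grad Z| R^3 <= m^2 and
    |W|^2 R^4 <= m^3, up to constants.

    Balance. A Hoelder bound M gives |W| ~ M eps^beta and
    |grad| ~ M eps^(beta - 1). With eps = R / (2 sqrt al) both conditions become
    M R^(2 + beta) <= al^((3 + beta) / 2), which is the exponent of the theorem.

    A priori H might vanish; then u vanishes on larger balls too
    (log_three_point_zero), so a positive mass in the middle ball forces
    a positive mass in the inner one. *)

Set Implicit Arguments.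
Unset Strict Implicit.
Unset Printing Implicit Defensive.
Import Order.TTheory GRing.Theory Num.Theory.
Import numFieldNormedType.Exports.
Local Open Scope classical_set_scope.
Local Open Scope ring_scope.

(** * Integration over row vectors and the divergence theorem *)

Section row_integral.
Context (K : realType).
Let RR : measurableType _ := measurableTypeR K.

Definition rowt n (t : n.-tuple RR) : 'rV[K]_n := \row_i tnth t i.

Lemma mx_norm_coord n (x : 'rV[K]_n) i : `|x ord0 i| <= `|x|.
Proof.
by rewrite [leRHS]/Num.norm/= mx_normrE; apply: (le_bigmax _ _ (ord0, i)).
Qed.

Lemma mx_norm_le n (x : 'rV[K]_n) c : 0 <= c ->
  (forall i, `|x ord0 i| <= c) -> `|x| <= c.
Proof.
move=> c0 h; rewrite [leLHS]/Num.norm/= mx_normrE; apply/bigmax_leP; split => //.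
by move=> [j i] _ /=; rewrite (ord1 j).
Qed.

(** An open set of rows is a countable union of cubes with rational centres,
    and cubes are products of intervals. *)
Lemma measurable_rowt_open n (U : set 'rV[K]_n) : open U ->
  measurable ((@rowt n) @^-1` U).
Proof.
move=> oU.
pose I := ({ffun 'I_n -> rat} * nat)%type.
pose bx (p : I) : set (n.-tuple RR) :=
  [set t | forall i, `|tnth t i - ratr (p.1 i)| < p.2.+1%:R^-1].
have mbx p : measurable (bx p).
  rewrite (_ : bx p = \bigcap_(i in [set: 'I_n]) ((fun t => tnth t i) @^-1`
      (`](ratr (p.1 i) - p.2.+1%:R^-1), (ratr (p.1 i) + p.2.+1%:R^-1)[%classic : set RR))).
    apply: fin_bigcap_measurable => // i _.
    rewrite -[X in measurable X]setTI; apply: measurable_tnth => //.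
  apply/seteqP; split => t /= h i.
    by move=> _ /=; rewrite in_itv/= -ltr_distl.
  by have := h i Logic.I; rewrite /= in_itv/= -ltr_distl.
rewrite (_ : _ @^-1` _ = \bigcup_(p in [set: I])
   (if asbool (bx p `<=` @rowt n @^-1` U) then bx p else set0)).
  apply: countable_bigcupT_measurable => [|p]; first exact: countableP.
  by case: ifP => _; [exact: mbx | exact: measurable0].
apply/seteqP; split => t; last first.
  by case=> p _; case: ifP => // /asboolP; apply.
move=> Ut; have /nbhs_ballP[e /= e0 eU] := oU _ Ut.
have [k ke] : exists k : nat, k.+1%:R^-1 < e / 2.
  have e20 : 0 < e / 2 by rewrite divr_gt0.
  exists (Num.truncn (e / 2)^-1).
  rewrite invf_plt ?posrE ?ltr0Sn//.
  by apply: truncnS_gt.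
have k0 : (0 : K) < k.+1%:R^-1 by rewrite invr_gt0 ltr0Sn.
have hq i : exists q : rat, `|tnth t i - ratr q| < k.+1%:R^-1.
  have [q] := @rat_in_itvoo K (tnth t i - k.+1%:R^-1) (tnth t i + k.+1%:R^-1)
    (ltac:(by rewrite ltrD2l gtrN)).
  rewrite in_itv/= => /andP[h1 h2]; exists q.
  by rewrite ltr_distlC; apply/andP.
pose c := [ffun i => sval (cid (hq i))].
exists (c, k) => //=.
have bt : bx (c, k) t by move=> i /=; rewrite ffunE; case: cid.
rewrite asboolT// => s bs; apply: eU.
rewrite mx_norm_ball /ball_/=.
apply: (@le_lt_trans _ _ (k.+1%:R^-1 + k.+1%:R^-1)).
  2: by rewrite [e]splitr ltrD.
apply: mx_norm_le => [|i]; first by rewrite addr_ge0// ltW.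
rewrite !mxE (le_trans (ler_distD (ratr (c i)) _ _))// lerD//.
  exact: ltW (bt i).
by rewrite distrC; exact: ltW (bs i).
Qed.

Lemma measurable_rowt n (f : 'rV[K]_n -> K) : continuous f ->
  measurable_fun [set: n.-tuple RR] (f \o @rowt n : _ -> RR).
Proof.
move=> /continuousP cf; apply: (measurability _ (RGenOpens.measurableE K)) => //.
move=> _ [_ [a [b ->] <-]]; rewrite setTI comp_preimage.
by apply: measurable_rowt_open; apply: cf; exact: interval_open.
Qed.

Definition slice_at n (t : n.-tuple RR) (i : 'I_n) (x : K) : n.-tuple RR :=
  [tuple if j == i then x else tnth t j | j < n].

(** Boundedness and a support in a cube are inherited by every slice, whereas
    integrability is inherited only by almost every slice. *)
Definition bdd_box n (F : n.-tuple RR -> K) (c L : K) :=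
  (forall t, `|F t| <= c) /\
  (forall t, F t != 0 -> forall i, `|tnth t i| <= L).

Let leb := @lebesgue_measure K.

Lemma box_fin n (L : K) : 0 <= L ->
  measurable [set t : n.-tuple RR | forall i, tnth t i \in `[-L, L]] /\
  (lebesgue_tuple K n [set t | forall i, tnth t i \in `[-L, L]%R] < +oo)%E.
Proof.
move=> L0; split.
  rewrite (_ : [set t | _] = \bigcap_(i in [set: 'I_n]) ((fun t => tnth t i) @^-1`
      (`[-L, L]%classic : set RR))).
    apply: fin_bigcap_measurable => // i _.
    rewrite -[X in measurable X]setTI; apply: measurable_tnth => //.
  by apply/seteqP; split => t /= h i => [_|]; apply: h.
rewrite (@lebesgue_tuple_box K n (fun=> `[-L, L]%classic))//.
rewrite (eq_bigr (fun=> (L + L)%:E)).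
  by rewrite prodEFin ltry.
move=> i _; rewrite lebesgue_measure_itv/= lte_fin.
case: ifPn => [_|]; first by rewrite -EFinD opprK.
rewrite -leNgt => LL; have -> : L = 0 by lra.
by rewrite addr0.
Qed.

Lemma bdd_box_integrable n (F : n.-tuple RR -> K) c L :
  measurable_fun setT (F : _ -> RR) -> bdd_box F c L ->
  (lebesgue_tuple K n).-integrable setT (EFin \o F).
Proof.
move=> mF [Fc FL].
pose L' := Num.max 0 L.
have L'0 : 0 <= L' by rewrite /L' le_max lexx.
pose B := [set t : n.-tuple RR | forall i, tnth t i \in `[-L', L']].
have [mB Boo] := @box_fin n L' L'0.
have -> : F = F \_ B.
  apply/funext => t; rewrite patchE; case: ifPn => //.
  apply: contraNeq => /FL Ft; rewrite inE => i.
  rewrite in_itv/= -ler_norml /L' le_max; apply/orP; right; exact: Ft.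
rewrite -restrict_EFin.
apply/integrable_restrict => //; rewrite setTI.
apply: measurable_bounded_integrable => //; first exact: measurable_funTS.
by exists c; split; [exact: num_real | move=> x cx t _ /=; apply: le_trans (Fc t) (ltW cx)].
Qed.

Lemma slice_at_cons0 n (t : n.-tuple RR) y x :
  slice_at (tuple_cons (y, t)) ord0 x = tuple_cons (x, t).
Proof.
apply/eq_from_tnth => j; rewrite tnth_mktuple.
by case: (unliftP ord0 j) => [k|] -> //=; rewrite !tnthS.
Qed.

Lemma slice_at_consS n (t : n.-tuple RR) y x (i : 'I_n) :
  slice_at (tuple_cons (y, t)) (lift ord0 i) x = tuple_cons (y, slice_at t i x).
Proof.
apply/eq_from_tnth => j; rewrite tnth_mktuple.
case: (unliftP ord0 j) => [k|] -> //=.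
by rewrite !tnthS tnth_mktuple (inj_eq lift_inj).
Qed.

(** Fubini peels off the first coordinate: it is integrated first when it is
    the coordinate i itself, and last, after the induction hypothesis, otherwise. *)
Lemma integral_slices0 n (i : 'I_n) (F : n.-tuple RR -> K) c L :
  measurable_fun setT (F : _ -> RR) -> bdd_box F c L ->
  (forall t, \int[leb]_x (F (slice_at t i x))%:E = 0)%E ->
  (\int[lebesgue_tuple K n]_t (F t)%:E = 0)%E.
Proof.
elim: n i F => [[]//|n IH] i F mF bF F0.
have mC := @measurable_tuple_cons K n.
have mFC : measurable_fun setT ((F \o @tuple_cons K n) : _ -> RR).
  exact: (measurableT_comp mF mC).
have iF := bdd_box_integrable mF bF.
have iFC : (leb \x lebesgue_tuple K n)%E.-integrable setT
    ((EFin \o F) \o @tuple_cons K n).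
  apply/integrableP; split.
    by apply/measurable_EFinP.
  move/integrableP : iF => [_].
  rewrite [lebesgue_tuple K n.+1]/= ge0_integral_pushforward//.
  apply: (measurableT_comp (f:=abse) (g:= EFin \o F)).
    exact: abse_measurable.
  exact/measurable_EFinP.
rewrite /= integral_pushforward//; last first.
  by apply/measurable_EFinP.
rewrite preimage_setT.
have FLE : bdd_box F c L := bF.
case: (unliftP ord0 i) F0 => [j|] -> F0.
- rewrite -integral12_prod_meas1// /fubini_F.
  apply: integral0_eq => x _ /=; apply: (IH j (fun t => F (tuple_cons (x, t)))).
  + apply: measurableT_comp; first exact: mF.
    by apply: measurableT_comp => //; apply: measurable_fun_pair.
  + case: bF => Fc FL; split => t; first exact: Fc.
    move=> /FL Ft k; have := Ft (lift ord0 k); by rewrite tnthS.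
  + by move=> t; have := F0 (tuple_cons (x, t)); under eq_integral do rewrite slice_at_consS.
- rewrite -integral21_prod_meas1// /fubini_G.
  apply: integral0_eq => t _ /=.
  by have := F0 (tuple_cons (0, t)); under eq_integral do rewrite slice_at_cons0.
Qed.


Definition Int n (f : 'rV[K]_n -> K) : K :=
  \int[lebesgue_tuple K n]_t (f (rowt t)).

(** A class closed under sums and bounded measurable factors in which
    integrability is automatic. *)
Definition tame n (f : 'rV[K]_n -> K) : Prop :=
  measurable_fun setT (f \o @rowt n : _ -> RR) /\
  exists c L, (forall x, `|f x| <= c) /\ (forall x, f x != 0 -> `|x| <= L).

Lemma tame_bdd_box n (f : 'rV[K]_n -> K) : tame f ->
  exists c L, bdd_box (f \o @rowt n) c L.
Proof.
move=> [_ [c [L [fc fL]]]]; exists c, L; split=> t; first exact: fc.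
by move=> /fL h i; have := mx_norm_coord (rowt t) i; rewrite mxE => /le_trans; apply.
Qed.

Lemma tame_integrable n (f : 'rV[K]_n -> K) : tame f ->
  (lebesgue_tuple K n).-integrable setT (EFin \o (f \o @rowt n)).
Proof.
by move=> tf; have [c [L h]] := tame_bdd_box tf; apply: bdd_box_integrable tf.1 h.
Qed.

Lemma tame_cont n (f : 'rV[K]_n -> K) L : continuous f ->
  (forall x, f x != 0 -> `|x| <= L) -> tame f.
Proof.
move=> cf fL; split; first exact: measurable_rowt.
pose B := [set x : 'rV[K]_n | `|x| <= L].
have cont_ball : compact B.
  apply: bounded_closed_compact.
    by exists L; split; [exact: num_real | move=> y Ly x /= /le_trans; apply; exact: ltW].
  apply: (@closed_comp _ _ (fun x : 'rV[K]_n => `|x|) [set y | y <= L]).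
    by move=> x _; exact: norm_continuous.
  exact: closed_le.
have /compact_bounded[c [_ hc]] : compact (f @` B).
  by apply: continuous_compact => //; exact: continuous_subspaceT.
exists (Num.max 0 (c + 1)), L; split=> // x.
have [->|/fL Bx] := eqVneq (f x) 0; first by rewrite normr0 le_max lexx.
by rewrite le_max; apply/orP; right; apply: (hc (c + 1)); [rewrite ltrDl | exists x].
Qed.

Lemma tame0 n : tame (fun _ : 'rV[K]_n => 0).
Proof.
split; first exact: measurable_cst.
by exists 0, 0; split=> x; rewrite ?normr0// eqxx.
Qed.

Lemma tameD n (f g : 'rV[K]_n -> K) : tame f -> tame g ->
  tame (fun x => f x + g x).
Proof.
move=> [mf [c [L [fc fL]]]] [mg [c' [L' [gc gL]]]]; split.
  exact: (measurable_funD mf mg).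
exists (c + c'), (Num.max L L'); split=> x.
  by apply: (le_trans (ler_normD _ _)); rewrite lerD.
have [->|/fL xL] := eqVneq (f x) 0; last by move=> _; rewrite le_max xL.
by rewrite add0r => /gL xL; rewrite le_max xL orbT.
Qed.

Lemma tameM n (f g : 'rV[K]_n -> K) :
  measurable_fun setT (g \o @rowt n : _ -> RR) ->
  (exists c, forall x, `|g x| <= c) -> tame f -> tame (fun x => g x * f x).
Proof.
move=> mg [c' gc] [mf [c [L [fc fL]]]]; split.
  exact: (measurable_funM mg mf).
exists (c' * c), L; split=> x.
  by rewrite normrM; apply: ler_pM.
by rewrite mulf_eq0 negb_or => /andP[_ /fL].
Qed.

Lemma tameZ n a (f : 'rV[K]_n -> K) : tame f -> tame (fun x => a * f x).
Proof. by apply: tameM; [exact: measurable_cst | exists `|a|]. Qed.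

Lemma tame_sum n (I : Type) (r : seq I) (f : I -> 'rV[K]_n -> K) :
  (forall i, tame (f i)) -> tame (fun x => \sum_(i <- r) f i x).
Proof.
move=> tf; elim: r => [|i r IH].
  by under eq_fun do rewrite big_nil; exact: tame0.
by under eq_fun do rewrite big_cons; exact: tameD.
Qed.

Lemma IntD n (f g : 'rV[K]_n -> K) : tame f -> tame g ->
  Int (fun x => f x + g x) = Int f + Int g.
Proof. by move=> tf tg; rewrite /Int RintegralD//; exact: tame_integrable. Qed.

Lemma IntZ n a (f : 'rV[K]_n -> K) : tame f ->
  Int (fun x => a * f x) = a * Int f.
Proof. by move=> tf; rewrite /Int RintegralZl//; exact: tame_integrable. Qed.

Lemma Int0 n : Int (fun _ : 'rV[K]_n => 0) = 0.
Proof. by rewrite /Int Rintegral_cst// mul0r. Qed.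

Lemma Int_sum n (I : Type) (r : seq I) (f : I -> 'rV[K]_n -> K) :
  (forall i, tame (f i)) ->
  Int (fun x => \sum_(i <- r) f i x) = \sum_(i <- r) Int (f i).
Proof.
move=> tf; elim: r => [|i r IH].
  by under eq_fun do rewrite big_nil; rewrite big_nil Int0.
under eq_fun do rewrite big_cons.
by rewrite IntD ?IH ?big_cons//; exact: tame_sum.
Qed.

Lemma le_Int n (f g : 'rV[K]_n -> K) : tame f -> tame g ->
  (forall x, f x <= g x) -> Int f <= Int g.
Proof.
move=> tf tg fg; rewrite /Int le_Rintegral//; exact: tame_integrable.
Qed.

Lemma rowt_slice n (t : n.-tuple RR) i x :
  rowt (slice_at t i x) = (x - tnth t i) *: delta_mx ord0 i + rowt t.
Proof.
apply/rowP => j; rewrite !mxE tnth_mktuple eqxx/=.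
have [->|] := eqVneq j i; first by rewrite mulr1 subrK.
by rewrite mulr0 add0r.
Qed.

Lemma is_derive_line (V : normedModType K) (F : V -> K) (v x : V) (a y dF : K) :
  is_derive ((y - a) *: v + x) v F dF ->
  is_derive y 1 (fun y => F ((y - a) *: v + x)) dF.
Proof.
move=> [dF1 dF2].
have E : (fun h : K => h^-1 *: (F (h *: v + ((y - a) *: v + x)) - F ((y - a) *: v + x)))
  = (fun h : K => h^-1 *: (F ((h *: 1 + y - a) *: v + x) - F ((y - a) *: v + x))).
  apply/funext => h; congr (_ *: (F _ - _)).
  by rewrite [h *: 1]mulr1 addrA -scalerDl [h + (y - a)]addrA.
split; first by rewrite /derivable/= -E.
by rewrite -dF2 /derive/= -E.
Qed.

Lemma integral_compact_derive (f g : K -> K) (L : K) :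
  (forall x : K, is_derive x (1 : K) f (g x)) -> continuous g ->
  (forall x, f x != 0 -> `|x| <= L) -> (forall x, g x != 0 -> `|x| <= L) ->
  (\int[leb]_x (g x)%:E = 0)%E.
Proof.
move=> df cg fL gL.
pose B := Num.max 0 L + 1.
have B0 : 0 < B by rewrite ltr_wpDl// le_max lexx.
have LB : L < B.
  by apply: (@le_lt_trans _ _ (Num.max 0 L)); rewrite ?ltrDl// le_max lexx orbT.
have f0 x : B <= `|x| -> f x = 0.
  by apply: contraTeq => /fL /le_lt_trans /(_ LB); rewrite ltNge.
have dff x : derivable f x 1 by have [] := df x.
have cf : continuous f.
  by move=> x; apply: differentiable_continuous; apply/derivable1_diffP.
have -> : (fun x => (g x)%:E) = (EFin \o g) \_ `[-B, B].
  apply/funext => x; rewrite patchE; case: ifPn => //.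
  rewrite mem_setE in_itv/= -ler_norml -ltNge => Bx /=; congr EFin.
  by apply: contraTeq Bx => /gL /le_lt_trans /(_ LB); rewrite -leNgt => /ltW.
rewrite -integral_mkcond (@continuous_FTC2 _ g f)//.
- by rewrite !f0 ?subee// ?normrN ger0_norm// ltW.
- by rewrite gtrN.
- exact: continuous_subspaceT.
- split; first by move=> x _.
  + by apply: cvg_at_right_filter; exact: cf.
  + by apply: cvg_at_left_filter; exact: cf.
- by move=> x _; rewrite derive1E; have [] := df x.
Qed.

(** The divergence theorem for a compactly supported field: on each line in
    direction i the integrand is the derivative of a compactly supported function. *)
Theorem Int_partial0 n (F G : 'rV[K]_n -> K) (i : 'I_n) L :
  (forall x, is_derive x (delta_mx ord0 i : 'rV[K]_n) F (G x)) -> continuous G ->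
  (forall x, F x != 0 -> `|x| <= L) -> (forall x, G x != 0 -> `|x| <= L) ->
  Int G = 0.
Proof.
move=> dF cG FL GL.
have tG := tame_cont cG GL.
have [c [L' bG]] := tame_bdd_box tG.
rewrite /Int /Rintegral (integral_slices0 (i := i) tG.1 bG)// => t /=.
under eq_integral do rewrite rowt_slice.
pose line x := (x - tnth t i) *: delta_mx ord0 i + rowt t.
have lineL x : `|line x| <= L -> `|x| <= L.
  have := mx_norm_coord (line x) i.
  by rewrite !mxE !eqxx mulr1 subrK; exact: le_trans.
apply: (@integral_compact_derive (F \o line) (G \o line) L).
- by move=> x; exact: is_derive_line.
- move=> x; apply: continuous_comp; last exact: cG.
  apply: cvgD; last exact: cvg_cst.
  apply: cvgZr_tmp; apply: cvgB; [exact: cvg_id|exact: cvg_cst].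
- by move=> x /FL /lineL.
- by move=> x /GL /lineL.
Qed.

End row_integral.

(** * Calculus of directional derivatives *)

Section derive_lemmas.
Context (K : realType) (V : normedModType K).
Implicit Types (f g : V -> K) (x v : V).

Lemma is_deriveP f x v (d : K) :
  is_derive x v f d <-> h^-1 *: (f (h *: v + x) - f x) @[h --> (0:K)^'] --> d.
Proof.
split; first by move=> [df <-].
move=> h; split; first by apply/cvg_ex; exists d.
exact: cvg_lim h.
Qed.

Lemma line_cvg x v : (fun h : K => h *: v + x) @ (0 : K)^' --> x.
Proof.
apply: cvg_trans (cvg_app _ (@nbhs_dnbhs _ 0)) _.
have : (fun h : K => h *: v + x) @ (0:K) --> (0 : K) *: v + x.
  by apply: cvgD; [apply: cvgZr_tmp; exact: cvg_id|exact: cvg_cst].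
by rewrite scale0r add0r.
Qed.

Lemma near_is_derive f g x v d : (\forall y \near x, f y = g y) ->
  is_derive x v f d -> is_derive x v g d.
Proof.
move=> fg /is_deriveP df; apply/is_deriveP; apply: cvg_trans df.
apply: near_eq_cvg; near=> h; rewrite (nbhs_singleton fg); congr (_ *: (_ - _)).
by near: h; exact: (@line_cvg x v _ fg).
Unshelve. all: by end_near. Qed.

Lemma isd_cst (c : K) x v : is_derive x v (fun=> c) 0.
Proof. exact: is_derive_cst. Qed.

Lemma isdD f g x v a b : is_derive x v f a -> is_derive x v g b ->
  is_derive x v (fun y => f y + g y) (a + b).
Proof. by move=> h1 h2; exact: is_deriveD. Qed.

Lemma isdM f g x v a b : is_derive x v f a -> is_derive x v g b ->
  is_derive x v (fun y => f y * g y) (a * g x + f x * b).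
Proof.
move=> h1 h2; apply: (is_derive_eq (is_deriveM h1 h2)).
by rewrite addrC [g x *: a]mulrC.
Qed.

Lemma isdZ c f x v a : is_derive x v f a ->
  is_derive x v (fun y => c * f y) (c * a).
Proof. by move=> h; have := isdM (isd_cst c x v) h; rewrite mul0r add0r. Qed.

Lemma isdN f x v a : is_derive x v f a -> is_derive x v (fun y => - f y) (- a).
Proof. by move=> h; exact: is_deriveN. Qed.

Lemma isdB f g x v a b : is_derive x v f a -> is_derive x v g b ->
  is_derive x v (fun y => f y - g y) (a - b).
Proof. by move=> h1 h2; apply: isdD => //; exact: isdN. Qed.

Lemma isd_sum (I : Type) (r : seq I) (f : I -> V -> K) x v (a : I -> K) :
  (forall i, is_derive x v (f i) (a i)) ->
  is_derive x v (fun y => \sum_(i <- r) f i y) (\sum_(i <- r) a i).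
Proof.
move=> h; elim: r => [|i r IH].
  by under eq_fun do rewrite big_nil; rewrite big_nil; exact: isd_cst.
by under eq_fun do rewrite big_cons; rewrite big_cons; exact: isdD.
Qed.

Lemma isdX2 f x v a : is_derive x v f a ->
  is_derive x v (fun y => f y ^+ 2) (2 * (f x * a)).
Proof.
move=> h; under eq_fun do rewrite expr2.
by apply: (is_derive_eq (isdM h h)); ring.
Qed.

End derive_lemmas.

Section germs.
Context (K : realType) (V : normedModType K).

(** Partial derivatives need not come from a differential, so the chain rule
    is obtained from the one-variable rule on a line. *)
Lemma isd_comp1 (F : K -> K) (f : V -> K) x v (a b : K) : is_derive x v f a ->
  is_derive (f x) (1:K) F b -> is_derive x v (fun y => F (f y)) (b * a).
Proof.
move=> hf hF.
have h1 : is_derive (0:K) (1:K) (fun h => f (h *: v + x)) a.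
  have : is_derive ((0 - 0 : K) *: v + x) v f a by rewrite subrr scale0r add0r.
  by move/is_derive_line; under eq_fun do rewrite subr0.
have : is_derive (0:K) (1:K) (F \o (fun h => f (h *: v + x))) (b * a).
  by apply: is_derive1_comp; rewrite ?scale0r ?add0r.
move/is_deriveP => /= h; apply/is_deriveP; move: h; under eq_fun do rewrite addr0 scale0r add0r.
by under eq_fun do rewrite [_ *: 1]mulr1.
Qed.


Lemma near0_cont (f : V -> K) x : (\forall y \near x, f y = 0) ->
  {for x, continuous f}.
Proof.
move=> f0; rewrite /prop_for/= /continuous_at (nbhs_singleton f0).
have h : (fun _ : V => (0:K)) @ x --> (0:K) by exact: cvg_cst.
by apply: cvg_trans h; apply: near_eq_cvg; apply: filterS f0 => y ->.
Qed.

Lemma near0_isd (f : V -> K) x v : (\forall y \near x, f y = 0) ->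
  is_derive x v f 0.
Proof.
move=> f0; apply: near_is_derive (isd_cst 0 x v).
by apply: filterS f0 => y ->.
Qed.

Lemma contM (f g : V -> K) x : {for x, continuous f} -> {for x, continuous g} ->
  {for x, continuous (fun y => f y * g y)}.
Proof. by move=> cf cg; apply: cvgM. Qed.

Lemma contD (f g : V -> K) x : {for x, continuous f} -> {for x, continuous g} ->
  {for x, continuous (fun y => f y + g y)}.
Proof. by move=> cf cg; apply: cvgD. Qed.

Lemma contN (f : V -> K) x : {for x, continuous f} ->
  {for x, continuous (fun y => - f y)}.
Proof. by move=> cf; apply: cvgN. Qed.

Lemma contB (f g : V -> K) x : {for x, continuous f} -> {for x, continuous g} ->
  {for x, continuous (fun y => f y - g y)}.
Proof. by move=> cf cg; apply: cvgB. Qed.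

Lemma cont_cst (c : K) (x : V) : {for x, continuous (fun _ : V => c)}.
Proof. exact: cvg_cst. Qed.

Lemma contX (f : V -> K) x k : {for x, continuous f} ->
  {for x, continuous (fun y => f y ^+ k)}.
Proof.
move=> cf; elim: k => [|k IH].
  rewrite /prop_for/= /continuous_at; under eq_fun do rewrite expr0.
  by rewrite expr0; exact: cvg_cst.
rewrite /prop_for/= /continuous_at; under eq_fun do rewrite exprS.
by rewrite exprS; exact: contM.
Qed.

Lemma cont_sum (I : Type) (r : seq I) (f : I -> V -> K) x :
  (forall i, {for x, continuous (f i)}) ->
  {for x, continuous (fun y => \sum_(i <- r) f i y)}.
Proof.
move=> h; elim: r => [|i r IH].
  rewrite /prop_for/= /continuous_at; under eq_fun do rewrite big_nil.
  by rewrite big_nil; exact: cvg_cst.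
rewrite /prop_for/= /continuous_at; under eq_fun do rewrite big_cons.
by rewrite big_cons; exact: contD.
Qed.

Lemma cont_max0 (f : V -> K) x : {for x, continuous f} ->
  {for x, continuous (fun y => Num.max 0 (f y))}.
Proof.
move=> cf; rewrite /prop_for/= /continuous_at.
have -> : (fun y => Num.max 0 (f y)) = (fun y => (f y + `|f y|) / 2).
  apply/funext => y; case: leP => h; rewrite ?(ger0_norm h) ?(ltr0_norm h); lra.
have -> : Num.max 0 (f x) = (f x + `|f x|) / 2.
  case: leP => h; rewrite ?(ger0_norm h) ?(ltr0_norm h); lra.
apply: (contM (f := fun y => f y + `|f y|)); last exact: cont_cst.
apply: contD => //; exact: (cvg_norm cf).
Qed.

End germs.

(** A Lipschitz estimate at one point, the form in which continuity of
    parameter integrals is obtained. *)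
Lemma lip_cont (K : realType) (V : normedModType K) (f : V -> K) (C : K) (x : V) :
  (\forall c \near x, `|f c - f x| <= `|c - x| * C) -> {for x, continuous f}.
Proof.
move=> hf; apply/cvgrPdist_le => e e0.
have C1 : 0 < `|C| + 1 by rewrite ltr_wpDl.
near=> c; rewrite distrC.
apply: (@le_trans _ _ (`|c - x| * C)); first by near: c.
apply: (@le_trans _ _ (`|c - x| * (`|C| + 1))).
  by rewrite ler_wpM2l// (le_trans (ler_norm _))// lerDl.
rewrite -ler_pdivlMr//.
near: c; apply/nbhs_ballP; exists (e / (`|C| + 1)) => /=; first by rewrite divr_gt0.
by move=> c; rewrite -ball_normE/= distrC => /ltW.
Unshelve. all: by end_near. Qed.

Lemma contV (K : realType) (V : normedModType K) (f : V -> K) (x : V) : f x != 0 ->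
  {for x, continuous f} -> {for x, continuous (fun y => (f y)^-1)}.
Proof. by move=> f0 cf; apply: cvgV. Qed.

Lemma cont_epsP (K : realType) (V : normedModType K) (f : V -> K) (x : V) :
  (forall e, 0 < e -> \forall y \near x, `|f y - f x| <= e) -> {for x, continuous f}.
Proof.
move=> h; apply/cvgrPdist_le => e e0.
by apply: filterS (h e e0) => y; rewrite distrC.
Qed.

Lemma norm_cont (K : realType) (V : normedModType K) (f : V -> K) (x : V) :
  {for x, continuous f} -> (fun y => `|f y|) @ x --> `|f x|.
Proof. by move=> cf; apply: cvg_norm. Qed.

Section pos_power.
Context (K : realType).

Lemma isd_id (y : K) : is_derive y (1:K) (fun z : K => z) 1.
Proof. exact: is_derive_id. Qed.

Lemma isd_exp k (y : K) :
  is_derive y (1:K) (fun z : K => z ^+ k.+1) (k.+1%:R * y ^+ k).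
Proof.
elim: k => [|k IH].
  by apply: (is_derive_eq (isd_id y)); rewrite expr0 mulr1.
have -> : (fun z : K => z ^+ k.+2) = (fun z => z * z ^+ k.+1).
  by apply/funext => z; rewrite exprS.
apply: (is_derive_eq (isdM (isd_id y) IH)).
by rewrite [in RHS]mulrS !exprS; ring.
Qed.

(** At 0 the difference quotient is the next lower power of the positive part,
    which tends to 0. *)
Lemma pos_power_derive k (y : K) :
  is_derive y (1:K) (fun z : K => Num.max 0 z ^+ k.+2)
    (k.+2%:R * Num.max 0 y ^+ k.+1).
Proof.
have [y0|y0|<-] := ltrgtP 0 y.
- apply: near_is_derive (isd_exp k.+1 y).
  near=> z; rewrite max_r//; apply: ltW; near: z; exact: lt_nbhsr.
- rewrite exprS mul0r mulr0.
  apply: near0_isd; near=> z.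
  rewrite max_l ?exprS ?mul0r//; apply: ltW; near: z; exact: lt_nbhsl.
- rewrite exprS mul0r mulr0; apply/is_deriveP.
  have E : (fun z : K => Num.max 0 z ^+ k.+1) @ (0:K)^' --> (0:K).
    apply: cvg_trans (cvg_app _ (@nbhs_dnbhs _ (0:K))) _.
    have := @contX K K (fun z => Num.max 0 z) 0 k.+1 (cont_max0 (@cvg_id _ _)).
    by rewrite /prop_for/= /continuous_at maxxx exprS mul0r.
  apply: cvg_trans E; apply: near_eq_cvg; near=> h.
  have h0 : h != 0 by near: h; exact: nbhs_dnbhs_neq.
  rewrite maxxx [_ *: 1]mulr1 addr0 [in 0 ^+ _]exprS mul0r subr0.
  case: leP => hh; first by rewrite [in RHS]exprS [RHS]mulKf.
  by rewrite !exprS !mul0r scaler0.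
Unshelve. all: by end_near. Qed.
End pos_power.

(** * Weighted integrals over a ball *)

Section ball_functional.
Context (K : realType) (n : nat).
Implicit Types (x y c : 'rV[K]_n) (f g : 'rV[K]_n -> K) (s : K).

Definition sqnorm x : K := \sum_(i < n) x ord0 i ^+ 2.
Definition evec (i : 'I_n) : 'rV[K]_n := delta_mx ord0 i.
(** The powers of exponent at least 2 of this weight are continuously
    differentiable across the sphere, which removes all boundary terms. *)
Definition rho c s x : K := Num.max 0 (s - sqnorm (x - c)).

Lemma sqnorm_ge0 x : 0 <= sqnorm x.
Proof. by apply: sumr_ge0 => i _; exact: sqr_ge0. Qed.

Lemma coord_le x (r : K) i : 0 <= r -> sqnorm x <= r ^+ 2 -> `|x ord0 i| <= r.
Proof.
move=> r0 xr; rewrite -ler_sqr ?nnegrE// real_normK ?num_real//.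
apply: le_trans xr; rewrite /sqnorm (bigD1 i)//= lerDl.
by apply: sumr_ge0 => j _; exact: sqr_ge0.
Qed.

Lemma coord_isd x i j : is_derive x (evec i) (fun y => y ord0 j) (i == j)%:R.
Proof.
apply/is_deriveP; have h : (fun _ : K => (i == j)%:R : K) @ (0:K)^' --> ((i == j)%:R : K).
  exact: cvg_cst.
apply: cvg_trans h; apply: near_eq_cvg; near=> h.
have h0 : h != 0 by near: h; exact: nbhs_dnbhs_neq.
rewrite !mxE eqxx/= addrK [RHS]mulrA mulVf// mul1r; congr (_%:R).
by rewrite eq_sym.
Unshelve. all: by end_near. Qed.

Lemma coordB_isd x c i j :
  is_derive x (evec i) (fun y => (y - c) ord0 j) (i == j)%:R.
Proof.
rewrite (_ : (fun y => _) = fun y : 'rV[K]_n => y ord0 j - c ord0 j); last first.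
  by apply/funext => y; rewrite !mxE.
by apply: (is_derive_eq (isdB (coord_isd x i j) (isd_cst (c ord0 j) x _))); rewrite subr0.
Qed.

Lemma coord_cont x j : {for x, continuous (fun y : 'rV[K]_n => y ord0 j)}.
Proof. exact: coord_continuous. Qed.

Lemma coordB_cont x c j : {for x, continuous (fun y : 'rV[K]_n => (y - c) ord0 j)}.
Proof.
have h := contB (@coord_cont x j) (@cont_cst K _ (c ord0 j) x).
move: h; rewrite /prop_for/continuous_at/=.
by rewrite (_ : (fun y => (y - c) _ _) = fun y : 'rV[K]_n => y ord0 j - c ord0 j)
   ?mxE//; apply/funext => y; rewrite !mxE.
Qed.

Lemma sqnormB_isd x c i :
  is_derive x (evec i) (fun y => sqnorm (y - c)) (2 * (x - c) ord0 i).
Proof.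
have := isd_sum (index_enum 'I_n) (fun j => isdX2 (coordB_isd x c i j)).
move/is_derive_eq; apply.
rewrite (bigD1 i)//= eqxx mulr1 big1 ?addr0// => j /negbTE.
by rewrite eq_sym => ->; rewrite !mulr0.
Qed.

Lemma sqnormB_cont x c : {for x, continuous (fun y => sqnorm (y - c))}.
Proof.
apply: (@cont_sum K _ _ (index_enum 'I_n) (fun j y => (y - c) ord0 j ^+ 2)) => j.
by apply: contX; exact: coordB_cont.
Qed.

Lemma rho_ge0 c s x : 0 <= rho c s x.
Proof. by rewrite le_max lexx. Qed.

Lemma rho_cont c s x : {for x, continuous (rho c s)}.
Proof.
by apply: cont_max0; apply: contB; [exact: cont_cst | exact: sqnormB_cont].
Qed.

Lemma rho_in c s x : sqnorm (x - c) <= s -> rho c s x = s - sqnorm (x - c).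
Proof. by move=> h; rewrite /rho max_r// subr_ge0. Qed.

Lemma rho_out c s x : s <= sqnorm (x - c) -> rho c s x = 0.
Proof. by move=> h; rewrite /rho max_l// subr_le0. Qed.

Lemma rho_isd c s x i k : is_derive x (evec i) (fun y => rho c s y ^+ k.+2)
  (- (2 * k.+2%:R) * ((x - c) ord0 i * rho c s x ^+ k.+1)).
Proof.
have h1 : is_derive x (evec i) (fun y => s - sqnorm (y - c)) (0 - 2 * (x - c) ord0 i).
  exact: (isdB (isd_cst s x _) (sqnormB_isd x c i)).
have := isd_comp1 h1 (pos_power_derive k (s - sqnorm (x - c))).
move/is_derive_eq; apply; rewrite -/(rho c s x); ring.
Qed.

Lemma rho_near_out c s x : s < sqnorm (x - c) -> \forall y \near x, rho c s y = 0.
Proof.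
move=> sx; have h : (fun y => sqnorm (y - c)) @ x --> sqnorm (x - c) := @sqnormB_cont x c.
near=> y; apply: rho_out; apply: ltW; near: y; exact: (h _ (lt_nbhsr sx)).
Unshelve. all: by end_near. Qed.

Lemma box_of_sqnorm c s x : sqnorm (x - c) <= s -> `|x| <= `|c| + Num.sqrt s.
Proof.
move=> h; rewrite -[x](subrK c) addrC (le_trans (ler_normD _ _))// lerD2l.
apply: mx_norm_le => [|i]; first exact: sqrtr_ge0.
apply: coord_le; first exact: sqrtr_ge0.
by rewrite sqr_sqrtr// (le_trans _ h)// sqnorm_ge0.
Qed.

Definition cont_cball c s f := forall x, sqnorm (x - c) <= s -> {for x, continuous f}.

Lemma rhoM_cont c s f k : cont_cball c s f ->
  continuous (fun x => f x * rho c s x ^+ k.+1).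
Proof.
move=> cf x; have [h|h] := leP (sqnorm (x - c)) s.
  apply: (contM (f := f) (g := fun x => rho c s x ^+ k.+1)); first exact: cf.
  by apply: contX; exact: rho_cont.
apply: (near0_cont (f := fun x => f x * rho c s x ^+ k.+1)); apply: filterS (rho_near_out h) => y ->.
by rewrite expr0n mulr0.
Qed.

Lemma rhoM_supp c s f k x : f x * rho c s x ^+ k.+1 != 0 ->
  `|x| <= `|c| + Num.sqrt s.
Proof.
move=> h; apply: box_of_sqnorm; apply: contraNT h; rewrite -ltNge => /ltW /rho_out ->.
by rewrite expr0n mulr0.
Qed.

Lemma rhoM_tame c s f k : cont_cball c s f ->
  tame (fun x => f x * rho c s x ^+ k.+1).
Proof.
by move=> cf; apply: (tame_cont (rhoM_cont (k:=k) cf)); exact: rhoM_supp.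
Qed.

(** The exponent k + 1 makes the integrand continuous on the whole space when
    f is continuous on the closed ball, whatever f is outside. *)
Definition wint c k s f : K := Int (fun x => f x * rho c s x ^+ k.+1).

Lemma wintD c k s f g : cont_cball c s f -> cont_cball c s g ->
  wint c k s (fun x => f x + g x) = wint c k s f + wint c k s g.
Proof.
move=> cf cg; rewrite /wint -IntD; [|exact: rhoM_tame..].
by congr Int; apply/funext => x; rewrite mulrDl.
Qed.

Lemma wintZ c k s a f : cont_cball c s f ->
  wint c k s (fun x => a * f x) = a * wint c k s f.
Proof.
move=> cf; rewrite /wint -IntZ; last exact: rhoM_tame.
by congr Int; apply/funext => x; rewrite mulrA.
Qed.

Lemma wint_sum c k s (I : Type) (r : seq I) (f : I -> 'rV[K]_n -> K) :
  (forall i, cont_cball c s (f i)) ->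
  wint c k s (fun x => \sum_(i <- r) f i x) = \sum_(i <- r) wint c k s (f i).
Proof.
move=> cf; rewrite /wint -Int_sum; last by move=> i; exact: rhoM_tame.
by congr Int; apply/funext => x; rewrite mulr_suml.
Qed.

Lemma eq_wint c k s f g : (forall x, sqnorm (x - c) < s -> f x = g x) ->
  wint c k s f = wint c k s g.
Proof.
move=> fg; congr Int; apply/funext => x.
have [/fg ->//|h] := ltP (sqnorm (x - c)) s.
by rewrite rho_out// !expr0n !mulr0.
Qed.

Lemma le_wint c k s f g : cont_cball c s f -> cont_cball c s g ->
  (forall x, sqnorm (x - c) < s -> f x <= g x) -> wint c k s f <= wint c k s g.
Proof.
move=> cf cg fg; apply: le_Int; [exact: rhoM_tame..|] => x.
have [h|h] := ltP (sqnorm (x - c)) s.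
  by rewrite ler_wpM2r ?fg// exprn_ge0// rho_ge0.
by rewrite rho_out// !expr0n !mulr0.
Qed.

Lemma wint_fun0 c k s : wint c k s (fun=> 0) = 0.
Proof.
rewrite /wint (_ : (fun x => _) = fun=> 0) ?Int0//.
by apply/funext => x; rewrite mul0r.
Qed.

Lemma wint_ge0 c k s f : cont_cball c s f ->
  (forall x, sqnorm (x - c) < s -> 0 <= f x) -> 0 <= wint c k s f.
Proof.
move=> cf f0; rewrite -(wint_fun0 c k s); apply: le_wint => // x _; exact: cont_cst.
Qed.

Lemma wint_rho c k s f :
  wint c k.+1 s f = wint c k s (fun x => f x * (s - sqnorm (x - c))).
Proof.
congr Int; apply/funext => x.
have [h|h] := ltP (sqnorm (x - c)) s; last by rewrite rho_out// !expr0n !mulr0.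
by rewrite exprS mulrA {1}rho_in// ltW.
Qed.

(** The derivative of rho^(k+2) along the i-th direction is
    - 2 (k+2) (x - c)_i rho^(k+1); this is the divergence theorem for f rho^(k+2). *)
Lemma wint_ibp c k s f (f' : 'rV[K]_n -> K) i :
  (forall x, sqnorm (x - c) <= s -> is_derive x (evec i) f (f' x)) ->
  cont_cball c s f -> cont_cball c s f' ->
  wint c k.+1 s f' = 2 * k.+2%:R * wint c k s (fun x => (x - c) ord0 i * f x).
Proof.
move=> df cf cf'.
have cxf : cont_cball c s (fun x => (x - c) ord0 i * f x).
  by move=> x xs; apply: contM; [exact: coordB_cont|exact: cf].
rewrite -wintZ//; apply/eqP; rewrite -subr_eq0; apply/eqP.
rewrite -[- wint c k s _]mulN1r /wint -IntZ; last apply: rhoM_tame.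
  2: by move=> x xs; apply: contM; [exact: cont_cst|exact: cxf].
rewrite -IntD; last 2 first.
- exact: rhoM_tame.
- by apply: tameZ; apply: rhoM_tame => x xs; apply: contM; [exact: cont_cst|exact: cxf].
pose G x := f' x * rho c s x ^+ k.+2
   + -1 * (2 * k.+2%:R * ((x - c) ord0 i * f x) * rho c s x ^+ k.+1).
apply: (@Int_partial0 K n (fun x => f x * rho c s x ^+ k.+2) G i (`|c| + Num.sqrt s)).
- move=> x; have [h|h] := leP (sqnorm (x - c)) s.
    apply: (is_derive_eq (isdM (df x h) (rho_isd c s x i k))).
    by rewrite /G; ring.
  have h0 : rho c s x = 0 by rewrite rho_out// ltW.
  rewrite /G h0 !expr0n !mulr0 addr0.
  apply: near0_isd; apply: filterS (rho_near_out h) => y ->.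
  by rewrite expr0n mulr0.
- move=> x; apply: (contD (f := fun x => f' x * rho c s x ^+ k.+2)
      (g := fun x => -1 * (2 * k.+2%:R * ((x - c) ord0 i * f x) * rho c s x ^+ k.+1))).
    exact: (rhoM_cont (k:=k.+1) cf').
  apply: contM; first exact: cont_cst.
  apply: (@rhoM_cont c s (fun x => 2 * k.+2%:R * ((x - c) ord0 i * f x)) k).
  by move=> y ys; apply: contM; [exact: cont_cst|exact: cxf].
- by move=> x; exact: rhoM_supp.
- move=> x; rewrite /G => h; apply: box_of_sqnorm; apply: contraNT h.
  rewrite -ltNge => /ltW /rho_out ->.
  by rewrite !expr0n !mulr0 addr0.
Qed.

Lemma cont_cball_le c s s' f : s <= s' -> cont_cball c s' f -> cont_cball c s f.
Proof. by move=> ss h x xs; apply: h; exact: le_trans ss. Qed.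

Lemma rho_le c s s' x : s <= s' -> rho c s x <= rho c s' x.
Proof. by move=> ss; rewrite /rho ge_max rho_ge0/= le_max lerD2r ss orbT. Qed.

(** Differentiation under the integral; the weight of the larger ball
    dominates. *)
Lemma wint_derive c k s S f : s < S -> cont_cball c S f ->
  is_derive s (1:K) (fun s => wint c k.+1 s f) (k.+2%:R * wint c k s f).
Proof.
move=> sS cf.
pose F (s : K) (t : n.-tuple (measurableTypeR K)) : K :=
  f (rowt t) * rho c s (rowt t) ^+ k.+2.
have cfl s' : s' <= S -> cont_cball c s' f by move=> h; exact: cont_cball_le cf.
have dF (s' : K) t : is_derive s' (1:K) (F^~ t)
    (k.+2%:R * (f (rowt t) * rho c s' (rowt t) ^+ k.+1)).
  have h1 : is_derive s' (1:K) (fun y : K => y - sqnorm (rowt t - c)) (1 - 0).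
    exact: (isdB (isd_id s') (isd_cst (sqnorm (rowt t - c)) s' _)).
  apply: (is_derive_eq (isdZ (f (rowt t)) (isd_comp1 h1 (pos_power_derive k _)))).
  by rewrite /= -/(rho c s' (rowt t)); ring.
pose G t : K := k.+2%:R * `|f (rowt t) * rho c S (rowt t) ^+ k.+1|.
have iG : (lebesgue_tuple K n).-integrable setT (EFin \o G).
  have t1 : tame (fun x => f x * rho c S x ^+ k.+1) by exact: rhoM_tame.
  have := integrableZl measurableT k.+2%:R (integrable_norm (tame_integrable t1)).
  exact.
have iF s' : `]s - 1, S[%classic s' -> (lebesgue_tuple K n).-integrable setT (EFin \o F s').
  rewrite /= in_itv/= => /andP[_ /ltW s'S].
  exact: (tame_integrable (rhoM_tame k.+1 (cfl s' s'S))).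
have Is : `]s - 1, S[%classic s by rewrite /= in_itv/= sS gtrBl ltr01.
have dF1 (s' : K) (y : n.-tuple (measurableTypeR K)) : `]s - 1, S[%classic s' -> setT y -> derivable (F^~ y) s' 1.
  by move=> _ _; have [] := dF s' y.
have G0 (y : n.-tuple (measurableTypeR K)) : 0 <= G y by rewrite mulr_ge0.
have Gub (s' : K) (y : n.-tuple (measurableTypeR K)) : `]s - 1, S[%classic s' -> setT y -> `|partial1of2 F s' y| <= G y.
  rewrite /= in_itv/= => /andP[_ /ltW s'S] _.
  have [_ E] := dF s' y; rewrite /partial1of2 derive1E E normrM ger0_norm//.
  rewrite ler_wpM2l// !normrM ler_wpM2l// !ger0_norm ?exprn_ge0 ?rho_ge0//.
  by rewrite lerXn2r ?nnegrE ?rho_ge0// rho_le.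
have D := @derivable_under_integral K _ _ (lebesgue_tuple K n) F setT measurableT
  s (s - 1) S Is iF dF1 G G0 iG Gub.
have E := @differentiation_under_integral K _ _ (lebesgue_tuple K n) F setT measurableT
  s (s - 1) S Is iF dF1 G G0 iG Gub.
split; first exact: D.
rewrite -derive1E [LHS]E -wintZ; last exact: cfl (ltW _).
congr (Rintegral _ _ _); apply/funext => t; have [_ h] := dF s t.
by rewrite /partial1of2 derive1E h mulrA.
Qed.

End ball_functional.

(** * The weight centred at the origin *)

Section centered.
Context (K : realType) (n : nat) (R2 : K).
Implicit Types (x : 'rV[K]_n) (f g : 'rV[K]_n -> K) (s : K).

Definition cont_ball f := forall x, sqnorm x < R2 -> {for x, continuous f}.
Definition partial_ball (i : 'I_n) f f' :=
  forall x, sqnorm x < R2 -> is_derive x (evec K i) f (f' x).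
Definition wint0 k s f : K := wint 0 k s f.

Lemma cont_ball_closed s f : s < R2 -> cont_ball f -> cont_cball 0 s f.
Proof. by move=> sR cf x; rewrite subr0 => xs; apply: cf; exact: le_lt_trans sR. Qed.

Lemma cont_ballD f g : cont_ball f -> cont_ball g -> cont_ball (fun x => f x + g x).
Proof. by move=> cf cg x xR; apply: contD; [exact: cf|exact: cg]. Qed.
Lemma cont_ballM f g : cont_ball f -> cont_ball g -> cont_ball (fun x => f x * g x).
Proof. by move=> cf cg x xR; apply: contM; [exact: cf|exact: cg]. Qed.
Lemma cont_ballN f : cont_ball f -> cont_ball (fun x => - f x).
Proof. by move=> cf x xR; apply: contN; exact: cf. Qed.
Lemma cont_ballX f k : cont_ball f -> cont_ball (fun x => f x ^+ k).
Proof. by move=> cf x xR; apply: contX; exact: cf. Qed.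
Lemma cont_ball_cst (a : K) : cont_ball (fun=> a).
Proof. by move=> x _; exact: cont_cst. Qed.
Lemma cont_ball_coord i : cont_ball (fun x => x ord0 i).
Proof. by move=> x _; exact: coord_cont. Qed.
Lemma cont_ball_sum (I : Type) (r : seq I) (f : I -> 'rV[K]_n -> K) :
  (forall i, cont_ball (f i)) -> cont_ball (fun x => \sum_(i <- r) f i x).
Proof. by move=> cf x xR; apply: cont_sum => i; exact: cf. Qed.
Lemma cont_ball_sqnorm : cont_ball (@sqnorm K n).
Proof.
by move=> x _; have := @sqnormB_cont K n x 0;
   rewrite (_ : (fun y => sqnorm (y - 0)) = @sqnorm K n)//;
   apply/funext => y; rewrite subr0.
Qed.

Context (s : K) (sR : s < R2).
Local Notation cc := (cont_ball_closed sR).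

Lemma wint0D k f g : cont_ball f -> cont_ball g ->
  wint0 k s (fun x => f x + g x) = wint0 k s f + wint0 k s g.
Proof. by move=> cf cg; apply: wintD; exact: cc. Qed.

Lemma wint0Z k a f : cont_ball f -> wint0 k s (fun x => a * f x) = a * wint0 k s f.
Proof. by move=> cf; apply: wintZ; exact: cc. Qed.

Lemma wint0N k f : cont_ball f -> wint0 k s (fun x => - f x) = - wint0 k s f.
Proof.
by move=> cf; rewrite -mulN1r -wint0Z//; congr wint0; apply/funext => x; rewrite mulN1r.
Qed.

Lemma wint0B k f g : cont_ball f -> cont_ball g ->
  wint0 k s (fun x => f x - g x) = wint0 k s f - wint0 k s g.
Proof. by move=> cf cg; rewrite wint0D ?wint0N//; exact: cont_ballN. Qed.

Lemma wint0_sum k (I : Type) (r : seq I) (f : I -> 'rV[K]_n -> K) :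
  (forall i, cont_ball (f i)) ->
  wint0 k s (fun x => \sum_(i <- r) f i x) = \sum_(i <- r) wint0 k s (f i).
Proof. by move=> cf; apply: wint_sum => i; exact: cc. Qed.

Lemma eq_wint0 k f g : (forall x, sqnorm x < s -> f x = g x) -> wint0 k s f = wint0 k s g.
Proof. by move=> fg; apply: eq_wint => x; rewrite subr0; exact: fg. Qed.

Lemma le_wint0 k f g : cont_ball f -> cont_ball g -> (forall x, sqnorm x < s -> f x <= g x) ->
  wint0 k s f <= wint0 k s g.
Proof.
by move=> cf cg fg; apply: le_wint; [exact: cc..|move=> x; rewrite subr0; exact: fg].
Qed.

Lemma wint0_ge0 k f : cont_ball f -> (forall x, sqnorm x < s -> 0 <= f x) -> 0 <= wint0 k s f.
Proof. by move=> cf f0; apply: wint_ge0; [exact: cc|move=> x; rewrite subr0; exact: f0]. Qed.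

Lemma wint0_rho k f : wint0 k.+1 s f = wint0 k s (fun x => f x * (s - sqnorm x)).
Proof. by rewrite /wint0 wint_rho; congr wint; apply/funext => x; rewrite subr0. Qed.

Lemma wint0_ibp k f f' i : partial_ball i f f' -> cont_ball f -> cont_ball f' ->
  wint0 k.+1 s f' = 2 * k.+2%:R * wint0 k s (fun x => x ord0 i * f x).
Proof.
move=> df cf cf'.
have h x : sqnorm (x - 0) <= s -> is_derive x (evec K i) f (f' x).
  by rewrite subr0 => xs; apply: df; exact: le_lt_trans sR.
rewrite /wint0 (wint_ibp k h (cc cf) (cc cf')).
by congr (_ * wint _ _ _ _); apply/funext => x; rewrite subr0.
Qed.

Lemma wint0_derive k f : cont_ball f ->
  is_derive s (1:K) (fun s => wint0 k.+1 s f) (k.+2%:R * wint0 k s f).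
Proof.
move=> cf; apply: (@wint_derive _ _ _ _ _ ((s + R2) / 2)).
  by rewrite midf_lt.
by move=> x; rewrite subr0 => h; apply: cf; apply: le_lt_trans h _; rewrite midf_lt.
Qed.

(** Write s = rho + |x|^2 under the integral, and integrate
    |x|^2 f = sum of x_i (x_i f) by parts. The left side is s times the
    s-derivative of the integral of f with the next weight. *)
Lemma wint0_scaling k f (f' : 'I_n -> 'rV[K]_n -> K) :
  (forall i, partial_ball i f (f' i)) -> cont_ball f -> (forall i, cont_ball (f' i)) ->
  s * (k.+2%:R * wint0 k s f) = (k.+2%:R + n%:R / 2) * wint0 k.+1 s f
     + 2^-1 * wint0 k.+1 s (fun x => \sum_i x ord0 i * f' i x).
Proof.
move=> df cf cf'.
have e1 : s * wint0 k s f = wint0 k.+1 s f + wint0 k s (fun x => sqnorm x * f x).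
  rewrite wint0_rho -wint0Z// -wint0D.
  - by apply: eq_wint0 => x _; ring.
  - by apply: cont_ballM => //; apply: cont_ballD; [exact: cont_ball_cst|apply: cont_ballN; exact: cont_ball_sqnorm].
  - by apply: cont_ballM => //; exact: cont_ball_sqnorm.
have e2 : 2 * k.+2%:R * wint0 k s (fun x => sqnorm x * f x) =
    n%:R * wint0 k.+1 s f + wint0 k.+1 s (fun x => \sum_i x ord0 i * f' i x).
  have cx i : cont_ball (fun x => x ord0 i * f x) by apply: cont_ballM => //; exact: cont_ball_coord.
  have cx' i : cont_ball (fun x => x ord0 i * f' i x) by apply: cont_ballM => //; exact: cont_ball_coord.
  have -> : wint0 k s (fun x => sqnorm x * f x) =
      \sum_i wint0 k s (fun x => x ord0 i * (x ord0 i * f x)).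
    rewrite -wint0_sum; last by move=> i; apply: cont_ballM => //; exact: cont_ball_coord.
    apply: eq_wint0 => x _; rewrite /sqnorm mulr_suml; apply: eq_bigr => i _.
    by rewrite expr2 mulrA.
  rewrite mulr_sumr wint0_sum//.
  have -> : n%:R * wint0 k.+1 s f = \sum_(i < n) wint0 k.+1 s f.
    by rewrite sumr_const card_ord mulr_natl.
  rewrite -big_split/=; apply: eq_bigr => i _.
  rewrite -(@wint0_ibp k _ (fun x => f x + x ord0 i * f' i x)).
  - by rewrite wint0D.
  - move=> x xR; have h : is_derive x (evec K i) (fun y => y ord0 i) 1.
      by apply: (is_derive_eq (coord_isd x i i)); rewrite eqxx.
    by apply: (is_derive_eq (isdM h (df i x xR))); rewrite mul1r.
  - exact: cx.
  - exact: cont_ballD.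
have k0 : (k.+2%:R : K) != 0 by rewrite pnatr_eq0.
rewrite mulrCA e1 mulrDr [_ * wint0 k s (fun x => sqnorm x * f x)](_ : _ = 2^-1 *
  (2 * k.+2%:R * wint0 k s (fun x => sqnorm x * f x))); last by field.
by rewrite e2; field.
Qed.

End centered.

(** * Energy and Rellich identities *)

Ltac solve_cont_ball := lazymatch goal with
  | |- cont_ball ?R (fun x => @?f x + @?g x) => refine (@cont_ballD _ _ R f g _ _); solve_cont_ball
  | |- cont_ball ?R (fun x => @?f x * @?g x) => refine (@cont_ballM _ _ R f g _ _); solve_cont_ball
  | |- cont_ball ?R (fun x => - @?f x) => refine (@cont_ballN _ _ R f _); solve_cont_ball
  | |- cont_ball ?R (fun x => @?f x ^+ ?k) => refine (@cont_ballX _ _ R f k _); solve_cont_ball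
  | |- cont_ball ?R (fun x => \sum_(i <- ?r) @?f i x) =>
      refine (@cont_ball_sum _ _ R _ r f _) => ?; solve_cont_ball
  | |- cont_ball ?R (fun x => fun_of_matrix x ord0 ?i) => exact: cont_ball_coord
  | |- cont_ball ?R (fun x => sqnorm x) => exact: cont_ball_sqnorm
  | |- cont_ball ?R (fun _ => ?c) => exact: cont_ball_cst
  | |- cont_ball ?R (fun x => ?f x) => change (cont_ball R f); solve_cont_ball
  | |- cont_ball ?R ?f => match goal with
      | H : cont_ball R f |- _ => exact H
      | H : forall i, cont_ball R (?d i) |- cont_ball R (?d ?i) => exact (H i)
      | H : forall i j, cont_ball R (?d i j) |- cont_ball R (?d ?i ?j) => exact (H i j)
      end
  end.

Section rellich.
Context (K : realType) (n : nat) (R2 s : K) (sR : s < R2) (k : nat).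
Context (v : 'rV[K]_n -> K) (d : 'I_n -> 'rV[K]_n -> K)
  (h : 'I_n -> 'I_n -> 'rV[K]_n -> K).
Hypothesis vd : forall i, partial_ball R2 i v (d i).
Hypothesis dh : forall i j, partial_ball R2 i (d j) (h i j).
Hypothesis (cv : cont_ball R2 v) (cd : forall i, cont_ball R2 (d i))
  (ch : forall i j, cont_ball R2 (h i j)).

Definition euler (x : 'rV[K]_n) : K := \sum_i x ord0 i * d i x.

Lemma cont_ball_euler : cont_ball R2 euler. Proof. rewrite /euler; solve_cont_ball. Qed.

Lemma euler_isd i : partial_ball R2 i euler (fun x => d i x + \sum_l x ord0 l * h i l x).
Proof.
move=> x xR; have := isd_sum (index_enum 'I_n)
  (fun l => isdM (coord_isd x i l) (dh i l xR)).
move/is_derive_eq; apply; rewrite big_split/=; congr (_ + _).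
rewrite (bigD1 i)//= eqxx mul1r big1 ?addr0// => l /negbTE.
by rewrite eq_sym => ->; rewrite mul0r.
Qed.

(** The divergence theorem for the field E v grad v; h i j stands for the i-th
    derivative of d j. *)
Lemma rellich : 2 * k.+2%:R * wint0 k s (fun x => euler x ^+ 2) =
  wint0 k.+1 s (fun x => (\sum_i h i i x) * euler x + \sum_i d i x ^+ 2 +
     \sum_i \sum_l x ord0 l * (d i x * h i l x)).
Proof.
have ce := cont_ball_euler.
pose F i x := d i x * euler x.
pose G i x := h i i x * euler x + d i x * (d i x + \sum_l x ord0 l * h i l x).
have FG i : partial_ball R2 i (F i) (G i).
  by move=> x xR; exact: (isdM (dh i i xR) (euler_isd i xR)).
have cF i : cont_ball R2 (F i) by rewrite /F; solve_cont_ball.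
have cG i : cont_ball R2 (G i) by rewrite /G; solve_cont_ball.
have -> : wint0 k s (fun x => euler x ^+ 2) = \sum_i wint0 k s (fun x => x ord0 i * F i x).
  rewrite -(wint0_sum sR); last by move=> i; solve_cont_ball.
  apply: eq_wint0 => x _; rewrite expr2 {1}/euler mulr_suml.
  by apply: eq_bigr => i _; rewrite mulrA.
rewrite mulr_sumr (eq_bigr (fun i => wint0 k.+1 s (G i))); last first.
  by move=> i _; rewrite -(wint0_ibp sR k (FG i)).
rewrite -(wint0_sum sR)//; apply: eq_wint0 => x _; rewrite mulr_suml -!big_split/=.
apply: eq_bigr => i _; rewrite /G mulrDr -expr2 addrA; congr (_ + _).
by rewrite mulr_sumr; apply: eq_bigr => l _; rewrite mulrCA.
Qed.

End rellich.

Section solution_identities.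
Context (K : realType) (n : nat) (R2 s : K) (sR : s < R2) (k : nat).
Context (u1 u2 V1 V2 A Z : 'rV[K]_n -> K) (d1 d2 a z : 'I_n -> 'rV[K]_n -> K)
  (h1 h2 : 'I_n -> 'I_n -> 'rV[K]_n -> K).
Hypothesis ud1 : forall i, partial_ball R2 i u1 (d1 i).
Hypothesis ud2 : forall i, partial_ball R2 i u2 (d2 i).
Hypothesis dh1 : forall i j, partial_ball R2 i (d1 j) (h1 i j).
Hypothesis dh2 : forall i j, partial_ball R2 i (d2 j) (h2 i j).
Hypothesis Aa : forall i, partial_ball R2 i A (a i).
Hypothesis Zz : forall i, partial_ball R2 i Z (z i).
Hypothesis sym1 : forall i j x, sqnorm x < R2 -> h1 i j x = h1 j i x.
Hypothesis sym2 : forall i j x, sqnorm x < R2 -> h2 i j x = h2 j i x.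
Hypothesis (cu1 : cont_ball R2 u1) (cu2 : cont_ball R2 u2) (cd1 : forall i, cont_ball R2 (d1 i))
  (cd2 : forall i, cont_ball R2 (d2 i)) (ch1 : forall i j, cont_ball R2 (h1 i j))
  (ch2 : forall i j, cont_ball R2 (h2 i j)) (cA : cont_ball R2 A) (cZ : cont_ball R2 Z)
  (ca : forall i, cont_ball R2 (a i)) (cz : forall i, cont_ball R2 (z i))
  (cV1 : cont_ball R2 V1) (cV2 : cont_ball R2 V2).
Hypothesis lap1 : forall x, sqnorm x < R2 ->
  \sum_i h1 i i x = V1 x * u1 x - V2 x * u2 x.
Hypothesis lap2 : forall x, sqnorm x < R2 ->
  \sum_i h2 i i x = V2 x * u1 x + V1 x * u2 x.

Definition normsq x : K := u1 x ^+ 2 + u2 x ^+ 2.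
Definition gradsq x : K := \sum_i (d1 i x ^+ 2 + d2 i x ^+ 2).
Local Notation E1 := (euler d1).
Local Notation E2 := (euler d2).
(** The real part of conj u E u, for u = u1 + i u2. *)
Definition radial x : K := u1 x * E1 x + u2 x * E2 x.
(** The imaginary part of conj u E u. *)
Definition twist x : K := u1 x * E2 x - u2 x * E1 x.
Let nu := normsq. Let g2 := gradsq. Let uE := radial. Let Kc := twist.

Let cE1 : cont_ball R2 E1. Proof. exact: cont_ball_euler. Qed.
Let cE2 : cont_ball R2 E2. Proof. exact: cont_ball_euler. Qed.
Lemma cont_ball_normsq : cont_ball R2 nu. Proof. rewrite /nu /normsq; solve_cont_ball. Qed.
Lemma cont_ball_gradsq : cont_ball R2 g2. Proof. rewrite /g2 /gradsq; solve_cont_ball. Qed.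
Lemma cont_ball_radial : cont_ball R2 uE. Proof. rewrite /uE /radial; solve_cont_ball. Qed.
Lemma cont_ball_twist : cont_ball R2 Kc. Proof. rewrite /Kc /twist; solve_cont_ball. Qed.
Let cnu := cont_ball_normsq. Let cg2 := cont_ball_gradsq. Let cuE := cont_ball_radial. Let cKc := cont_ball_twist.

Lemma normsq_isd i :
  partial_ball R2 i nu (fun x => 2 * (u1 x * d1 i x + u2 x * d2 i x)).
Proof.
move=> x xR; apply: (is_derive_eq (isdD (isdX2 (ud1 i xR)) (isdX2 (ud2 i xR)))).
by rewrite mulrDr.
Qed.

Lemma normsq_scaling : s * (k.+2%:R * wint0 k s nu) =
  (k.+2%:R + n%:R / 2) * wint0 k.+1 s nu + wint0 k.+1 s uE.
Proof.
rewrite (wint0_scaling sR k normsq_isd)//; last by move=> i; solve_cont_ball.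
congr (_ + _); rewrite -(wint0Z sR); last by solve_cont_ball.
apply: eq_wint0 => x _; rewrite /uE /radial /euler !mulr_sumr -big_split/=.
by apply: eq_bigr => i _; field.
Qed.

(** The divergence theorem for the field Re (conj u grad u). *)
Lemma energy : 2 * k.+2%:R * wint0 k s uE = wint0 k.+1 s (fun x => g2 x + V1 x * nu x).
Proof.
pose F i x := u1 x * d1 i x + u2 x * d2 i x.
pose G i x := (d1 i x * d1 i x + u1 x * h1 i i x) + (d2 i x * d2 i x + u2 x * h2 i i x).
have FG i : partial_ball R2 i (F i) (G i).
  by move=> x xR; exact: (isdD (isdM (ud1 i xR) (dh1 i i xR)) (isdM (ud2 i xR) (dh2 i i xR))).
have cF i : cont_ball R2 (F i) by rewrite /F; solve_cont_ball.
have cG i : cont_ball R2 (G i) by rewrite /G; solve_cont_ball.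
have -> : wint0 k s uE = \sum_i wint0 k s (fun x => x ord0 i * F i x).
  rewrite -(wint0_sum sR); last by move=> i; solve_cont_ball.
  apply: eq_wint0 => x _; rewrite /uE /radial /euler !mulr_sumr -big_split/=.
  by apply: eq_bigr => i _; rewrite /F; ring.
rewrite mulr_sumr (eq_bigr (fun i => wint0 k.+1 s (G i))); last first.
  by move=> i _; rewrite -(wint0_ibp sR k (FG i)).
rewrite -(wint0_sum sR)//; apply: eq_wint0 => x xs.
have xR : sqnorm x < R2 by exact: lt_trans sR.
have -> : V1 x * nu x = u1 x * (\sum_i h1 i i x) + u2 x * (\sum_i h2 i i x).
  by rewrite lap1// lap2// /nu /normsq; ring.
rewrite /g2 /gradsq !mulr_sumr -!big_split/=; apply: eq_bigr => i _.
by rewrite /G; ring.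
Qed.

(** The divergence theorem for Z Im (conj u grad u), where
    Im (conj u Laplacian u) = V2 |u|^2 by the equation. *)
Lemma twist_ibp : 2 * k.+2%:R * wint0 k s (fun x => Z x * Kc x) =
  wint0 k.+1 s (fun x => \sum_i z i x * (u1 x * d2 i x - u2 x * d1 i x)
                      + Z x * V2 x * nu x).
Proof.
pose w i x := u1 x * d2 i x - u2 x * d1 i x.
pose w' i x := (d1 i x * d2 i x + u1 x * h2 i i x) - (d2 i x * d1 i x + u2 x * h1 i i x).
pose F i x := Z x * w i x.
pose G i x := z i x * w i x + Z x * w' i x.
have ww i : partial_ball R2 i (w i) (w' i).
  by move=> x xR; exact: (isdB (isdM (ud1 i xR) (dh2 i i xR)) (isdM (ud2 i xR) (dh1 i i xR))).
have FG i : partial_ball R2 i (F i) (G i) by move=> x xR; exact: (isdM (Zz i xR) (ww i x xR)).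
have cw i : cont_ball R2 (w i) by rewrite /w; solve_cont_ball.
have cF i : cont_ball R2 (F i) by rewrite /F; solve_cont_ball.
have cG i : cont_ball R2 (G i) by rewrite /G /w'; solve_cont_ball.
have -> : wint0 k s (fun x => Z x * Kc x) = \sum_i wint0 k s (fun x => x ord0 i * F i x).
  rewrite -(wint0_sum sR); last by move=> i; solve_cont_ball.
  apply: eq_wint0 => x _; rewrite /Kc /twist /euler !mulr_sumr -sumrB mulr_sumr.
  by apply: eq_bigr => i _; rewrite /F /w; ring.
rewrite mulr_sumr (eq_bigr (fun i => wint0 k.+1 s (G i))); last first.
  by move=> i _; rewrite -(wint0_ibp sR k (FG i)).
rewrite -(wint0_sum sR)//; apply: eq_wint0 => x xs.
have xR : sqnorm x < R2 by exact: lt_trans sR.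
have -> : Z x * V2 x * nu x =
    Z x * (u1 x * (\sum_i h2 i i x) - u2 x * (\sum_i h1 i i x)).
  by rewrite lap1// lap2// /nu /normsq; ring.
rewrite !mulr_sumr -sumrB mulr_sumr -big_split/=; apply: eq_bigr => i _.
by rewrite /G /w' /w; ring.
Qed.

(** Scaling the energy density produces third-order products of derivatives
    which the Rellich identity removes; this uses that the second derivatives
    h1, h2 are symmetric. The terms V1 (u, E u) of the equation and A (u, E u)
    of the scaling combine into the difference V1 - A. *)
Lemma energy_scaling :
  s * (k.+2%:R * wint0 k s (fun x => g2 x + A x * nu x)) =
  (k.+1%:R + n%:R / 2) * wint0 k.+1 s (fun x => g2 x + A x * nu x)
  + 2 * k.+2%:R * wint0 k s (fun x => E1 x ^+ 2 + E2 x ^+ 2)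
  + wint0 k.+1 s (fun x => (A x + 2^-1 * (\sum_i x ord0 i * a i x)) * nu x)
  - wint0 k.+1 s (fun x => (V1 x - A x) * uE x + V2 x * Kc x).
Proof.
pose f' l x := \sum_i (2 * (d1 i x * h1 l i x) + 2 * (d2 i x * h2 l i x)) +
  (a l x * nu x + A x * (2 * (u1 x * d1 l x + u2 x * d2 l x))).
have ff' l : partial_ball R2 l (fun x => g2 x + A x * nu x) (f' l).
  move=> x xR; apply: isdD; last exact: (isdM (Aa l xR) (normsq_isd l xR)).
  apply: isd_sum => i.
  exact: (isdD (isdX2 (dh1 l i xR)) (isdX2 (dh2 l i xR))).
have cf' l : cont_ball R2 (f' l) by rewrite /f'; solve_cont_ball.
have cf : cont_ball R2 (fun x => g2 x + A x * nu x) by solve_cont_ball.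
rewrite (wint0_scaling sR k ff')//.
have -> : 2 * k.+2%:R * wint0 k s (fun x => E1 x ^+ 2 + E2 x ^+ 2) =
   wint0 k.+1 s (fun x => (\sum_i h1 i i x) * E1 x + \sum_i d1 i x ^+ 2 +
     \sum_i \sum_l x ord0 l * (d1 i x * h1 i l x)) +
   wint0 k.+1 s (fun x => (\sum_i h2 i i x) * E2 x + \sum_i d2 i x ^+ 2 +
     \sum_i \sum_l x ord0 l * (d2 i x * h2 i l x)).
  rewrite -(rellich sR k dh1 cd1 ch1) -(rellich sR k dh2 cd2 ch2).
  by rewrite (wint0D sR); [ring|solve_cont_ball|solve_cont_ball].
have -> : (k.+2%:R + n%:R / 2 : K) = (k.+1%:R + n%:R / 2) + 1.
  by rewrite -[k.+2]addn1 natrD; ring.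
rewrite [in LHS]mulrDl mul1r -!addrA; congr (_ + _).
rewrite -(wint0Z sR) -?(wint0N sR) -?(wint0D sR); [|by rewrite /euler; solve_cont_ball..].
apply: eq_wint0 => x xs; have xR : sqnorm x < R2 by exact: lt_trans sR.
rewrite lap1// lap2//.
have -> : \sum_i x ord0 i * f' i x =
   2 * (\sum_i \sum_l x ord0 l * (d1 i x * h1 i l x))
   + 2 * (\sum_i \sum_l x ord0 l * (d2 i x * h2 i l x))
   + (\sum_i x ord0 i * a i x) * nu x + 2 * A x * uE x.
  rewrite (exchange_big_dep xpredT)//= [X in _ + 2 * X](exchange_big_dep xpredT)//=.
  have -> : uE x = \sum_l x ord0 l * (u1 x * d1 l x + u2 x * d2 l x).
    rewrite /uE /radial /euler !mulr_sumr -big_split/=.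
    by apply: eq_bigr => l _; ring.
  rewrite !mulr_sumr mulr_suml -!big_split/=.
  apply: eq_bigr => l _; rewrite /f' mulrDr !mulr_sumr -addrA; congr (_ + _); last ring.
  rewrite -big_split/=; apply: eq_bigr => i _.
  by rewrite (sym1 i l xR) (sym2 i l xR); ring.
have -> : g2 x = \sum_i d1 i x ^+ 2 + \sum_i d2 i x ^+ 2.
  by rewrite -big_split.
by rewrite /uE /Kc /radial /twist /nu /normsq; field.
Qed.

End solution_identities.

(** * The frequency inequality *)

(** With Y = e - b u and c |Y|^2 at hand, the square of
    Y - i (r / c) Z u changes the sign of the term in Z at the price
    r^2 Z^2 |u|^2 / c, and W is absorbed by the same square. *)
Lemma pointwise_square (K : realType) (c b r e1 e2 u1 u2 W1 W2 Z d nu Kc : K) :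
  0 < c -> W1 ^+ 2 + W2 ^+ 2 <= d ->
  nu = u1 ^+ 2 + u2 ^+ 2 -> Kc = u1 * e2 - u2 * e1 ->
  r * (Z * Kc) - r ^+ 2 * (Z * (Z + W2) * nu) / c - r ^+ 2 * (d * nu) / (4 * c)
  <= c * ((e1 - b * u1) ^+ 2 + (e2 - b * u2) ^+ 2)
     - r * (W1 * (u1 * e1 + u2 * e2 - b * nu) + (Z + W2) * Kc).
Proof.
move=> c0 Wd nuE KcE.
pose p1 := (e1 - b * u1) + r * Z * u2 / c - r * (W1 * u1 - W2 * u2) / (2 * c).
pose p2 := (e2 - b * u2) - r * Z * u1 / c - r * (W1 * u2 + W2 * u1) / (2 * c).
rewrite -subr_ge0.
have -> : c * ((e1 - b * u1) ^+ 2 + (e2 - b * u2) ^+ 2)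
     - r * (W1 * (u1 * e1 + u2 * e2 - b * nu) + (Z + W2) * Kc) -
  (r * (Z * Kc) - r ^+ 2 * (Z * (Z + W2) * nu) / c - r ^+ 2 * (d * nu) / (4 * c))
  = c * (p1 ^+ 2 + p2 ^+ 2) + r ^+ 2 * nu * (d - (W1 ^+ 2 + W2 ^+ 2)) / (4 * c).
  rewrite /p1 /p2 nuE KcE; field; by rewrite gt_eqF.
have nu0 : 0 <= nu by rewrite nuE addr_ge0 ?sqr_ge0.
apply: addr_ge0; first by rewrite mulr_ge0 ?(ltW c0)// addr_ge0 ?sqr_ge0.
apply: divr_ge0; last by rewrite mulr_ge0// ltW.
by rewrite mulr_ge0 ?subr_ge0// mulr_ge0// sqr_ge0.
Qed.

(** Young's inequality; the weight lam is matched to the frequency later. *)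
Lemma pointwise_cross (K : realType) (lam L z u1 u2 d1 d2 : K) :
  0 < lam -> `|z| <= L ->
  - (L / 2 * (lam * (u1 ^+ 2 + u2 ^+ 2) + (d1 ^+ 2 + d2 ^+ 2) / lam))
  <= z * (u1 * d2 - u2 * d1).
Proof.
move=> l0 zL; set w := u1 * d2 - u2 * d1.
pose S := lam * (u1 ^+ 2 + u2 ^+ 2) + (d1 ^+ 2 + d2 ^+ 2) / lam.
have Sw : 2 * w <= S.
  rewrite -subr_ge0 (_ : S - _ = lam * ((u1 - d2 / lam) ^+ 2 + (u2 + d1 / lam) ^+ 2)).
    by rewrite mulr_ge0 ?(ltW l0)// addr_ge0 ?sqr_ge0.
  by rewrite /S /w; field; rewrite gt_eqF.
have Sw' : - S <= 2 * w.
  rewrite -subr_ge0 (_ : _ - _ = lam * ((u1 + d2 / lam) ^+ 2 + (u2 - d1 / lam) ^+ 2)).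
    by rewrite mulr_ge0 ?(ltW l0)// addr_ge0 ?sqr_ge0.
  by rewrite /S /w; field; rewrite gt_eqF.
rewrite -/S lerNl.
have wS : `|2 * w| <= S by rewrite ler_norml Sw' Sw.
apply: (le_trans (ler_norm _)); rewrite normrN normrM.
have -> : L / 2 * S = L * (S / 2) by ring.
apply: ler_pM => //.
by rewrite ler_pdivlMr// mulrC -[X in X * _](@ger0_norm K 2)// -normrM.
Qed.

Section frequency.
Context (K : realType) (n : nat) (R s : K) (k : nat).
Let R2 := R ^+ 2.
Hypothesis (n0 : (0 < n)%N) (R0 : 0 < R) (s0 : 0 < s) (sR : s < R2).
Context (u1 u2 V1 V2 A Z : 'rV[K]_n -> K) (d1 d2 a z : 'I_n -> 'rV[K]_n -> K)
  (h1 h2 : 'I_n -> 'I_n -> 'rV[K]_n -> K).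
Hypothesis ud1 : forall i, partial_ball R2 i u1 (d1 i).
Hypothesis ud2 : forall i, partial_ball R2 i u2 (d2 i).
Hypothesis dh1 : forall i j, partial_ball R2 i (d1 j) (h1 i j).
Hypothesis dh2 : forall i j, partial_ball R2 i (d2 j) (h2 i j).
Hypothesis Aa : forall i, partial_ball R2 i A (a i).
Hypothesis Zz : forall i, partial_ball R2 i Z (z i).
Hypothesis sym1 : forall i j x, sqnorm x < R2 -> h1 i j x = h1 j i x.
Hypothesis sym2 : forall i j x, sqnorm x < R2 -> h2 i j x = h2 j i x.
Hypothesis (cu1 : cont_ball R2 u1) (cu2 : cont_ball R2 u2) (cd1 : forall i, cont_ball R2 (d1 i))
  (cd2 : forall i, cont_ball R2 (d2 i)) (ch1 : forall i j, cont_ball R2 (h1 i j))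
  (ch2 : forall i j, cont_ball R2 (h2 i j)) (cA : cont_ball R2 A) (cZ : cont_ball R2 Z)
  (ca : forall i, cont_ball R2 (a i)) (cz : forall i, cont_ball R2 (z i))
  (cV1 : cont_ball R2 V1) (cV2 : cont_ball R2 V2).
Hypothesis lap1 : forall x, sqnorm x < R2 ->
  \sum_i h1 i i x = V1 x * u1 x - V2 x * u2 x.
Hypothesis lap2 : forall x, sqnorm x < R2 ->
  \sum_i h2 i i x = V2 x * u1 x + V1 x * u2 x.
Context (M L dd : K).
Hypothesis (M0 : 0 <= M) (L0 : 0 <= L) (dd0 : 0 <= dd).
Hypothesis A_le : forall x, sqnorm x < R2 -> `|A x| <= M.
Hypothesis Z_le : forall x, sqnorm x < R2 -> `|Z x| <= M.
Hypothesis V1_le : forall x, sqnorm x < R2 -> `|V1 x| <= M.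
Hypothesis V2_le : forall x, sqnorm x < R2 -> `|V2 x| <= M.
Hypothesis W_le : forall x, sqnorm x < R2 ->
  (V1 x - A x) ^+ 2 + (V2 x - Z x) ^+ 2 <= dd.
Hypothesis a_le : forall i x, sqnorm x < R2 -> `|a i x| <= L.
Hypothesis z_le : forall i x, sqnorm x < R2 -> `|z i x| <= L.
Let m : K := k.+2%:R.
Hypothesis mM : M * R ^+ 2 <= m ^+ 2.
Hypothesis mL : n%:R * L * R ^+ 3 <= m ^+ 2.
Hypothesis md : dd * R ^+ 4 <= m ^+ 3.

Local Notation nu := (normsq u1 u2).
Local Notation g2 := (gradsq d1 d2).
Local Notation uE := (radial u1 u2 d1 d2).
Local Notation Kc := (twist u1 u2 d1 d2).
Local Notation E1 := (euler d1).
Local Notation E2 := (euler d2).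

Let cE1 : cont_ball R2 E1. Proof. exact: cont_ball_euler. Qed.
Let cE2 : cont_ball R2 E2. Proof. exact: cont_ball_euler. Qed.
Let cnu : cont_ball R2 nu. Proof. exact: cont_ball_normsq. Qed.
Let cg2 : cont_ball R2 g2. Proof. exact: cont_ball_gradsq. Qed.
Let cuE : cont_ball R2 uE. Proof. exact: cont_ball_radial. Qed.
Let cKc : cont_ball R2 Kc. Proof. exact: cont_ball_twist. Qed.
Let nu0 x : 0 <= nu x. Proof. by rewrite addr_ge0 ?sqr_ge0. Qed.
Let g20 x : 0 <= g2 x. Proof. by apply: sumr_ge0 => i _; rewrite addr_ge0 ?sqr_ge0. Qed.
Let m2 : 2 <= m. Proof. by rewrite /m ler_nat. Qed.
Let nK1 : (1 : K) <= n%:R. Proof. by rewrite ler1n. Qed.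

Let H := wint0 k.+1 s nu.
Let B := wint0 k.+1 s uE.
Let F := wint0 k.+2 s g2.
Let J1 := wint0 k.+2 s nu.
Hypothesis H0 : 0 < H.
Let b := B / H.
Let Yq x : K := (E1 x - b * u1 x) ^+ 2 + (E2 x - b * u2 x) ^+ 2.
Let DY := wint0 k.+1 s Yq.
Let cYq : cont_ball R2 Yq. Proof. rewrite /Yq; solve_cont_ball. Qed.
Let bH : b * H = B. Proof. by rewrite /b divfK// gt_eqF. Qed.
Let DY0 : 0 <= DY.
Proof. by apply: (wint0_ge0 sR) => // x _; rewrite addr_ge0 ?sqr_ge0. Qed.
Let inB (x : 'rV[K]_n) : sqnorm x < s -> sqnorm x < R2. Proof. by move=> /lt_trans; apply. Qed.
Let mk3 : (k.+3%:R : K) = m + 1. Proof. by rewrite /m -[k.+3]addn1 natrD. Qed.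
Let mk4 : (k.+4%:R : K) = m + 2. Proof. by rewrite /m -[k.+4]addn2 natrD. Qed.

Lemma normsq_succ_le : J1 <= s * H.
Proof.
rewrite /J1 wint0_rho -(wint0Z sR)//; apply: (le_wint0 sR); [solve_cont_ball..|] => x xs.
by rewrite mulrC ler_wpM2r// gerBl sqnorm_ge0.
Qed.

Lemma normsq_succ_ge0 : 0 <= J1. Proof. by apply: (wint0_ge0 sR). Qed.

Lemma gradsq_int_ge0 : 0 <= F. Proof. by apply: (wint0_ge0 sR). Qed.

Lemma gradsq_int_le : F <= (2 * (m + 1) * b + M * s) * H.
Proof.
have := energy sR k.+1 ud1 ud2 dh1 dh2 cu1 cu2 cd1 cd2 ch1 ch2 lap1 lap2.
rewrite -/B mk3 (wint0D sR) ?/F//; last by solve_cont_ball.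
move=> e; have -> : (2 * (m + 1) * b + M * s) * H = 2 * (m + 1) * B + M * (s * H).
  by rewrite -bH; ring.
rewrite e -addrA lerDl.
have : - M * J1 <= wint0 k.+2 s (fun x => V1 x * nu x).
  rewrite /J1 -(wint0Z sR)//; apply: (le_wint0 sR); [solve_cont_ball..|] => x /inB xR.
  by rewrite ler_wpM2r// lerNl (le_trans (ler_norm _))// normrN V1_le.
have : M * J1 <= M * (s * H) by rewrite ler_wpM2l// normsq_succ_le.
rewrite mulNr mulrA; lra.
Qed.

(** The integral of |grad u|^2 is nonnegative and is controlled by the
    frequency. *)
Lemma frequency_ge : - (m / 2) <= b.
Proof.
have := le_trans gradsq_int_ge0 gradsq_int_le; rewrite pmulr_lge0// => h.
have Ms : M * s <= m ^+ 2 by apply: le_trans mM; rewrite ler_wpM2l// ltW.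
have : 0 <= 2 * (m + 1) * (b + m / 2).
  have -> : 2 * (m + 1) * (b + m / 2) = 2 * (m + 1) * b + (m ^+ 2 + m) by field.
  by apply: le_trans h _; rewrite lerD2l (le_trans Ms)// lerDl (le_trans _ m2).
rewrite pmulr_rge0; last by have := m2; lra.
by move=> h'; rewrite -subr_ge0; move: h'; rewrite opprK.
Qed.

(** A large frequency b pushes the mass to the sphere: one more power of rho
    multiplies the mass by about s m / (b + m). It follows from scaling with the
    next weight, where E u is replaced by b u + Y. *)
Lemma mass_concentration : (b + m) * J1 <= s * ((2 * m + 1) * H + DY / (2 * m)).
Proof.
have := normsq_scaling sR k.+1 ud1 ud2 cu1 cu2 cd1 cd2.
rewrite mk3 -/H -/J1 => e.
have : wint0 k.+2 s uE >= b * J1 - s * (m / 2 * H + DY / (2 * m)).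
  have c1 : cont_ball R2 (fun x => b * nu x) by solve_cont_ball.
  have c2 : cont_ball R2 (fun x => m / 2 * nu x + (2 * m)^-1 * Yq x) by solve_cont_ball.
  rewrite /J1 -(wint0Z sR)// [DY / _]mulrC -!(wint0Z sR)// -(wint0D sR); [|solve_cont_ball..].
  rewrite -(wint0Z sR)// ![wint0 k.+2 _ _]wint0_rho -(wint0B sR); [|by solve_cont_ball..].
  apply: (le_wint0 sR); [by solve_cont_ball..|] => x xs.
  have r0 : 0 <= s - sqnorm x by rewrite subr_ge0 ltW.
  have rs : s - sqnorm x <= s by rewrite gerBl sqnorm_ge0.
  have -> : uE x = b * nu x + (u1 x * (E1 x - b * u1 x) + u2 x * (E2 x - b * u2 x)).
    by rewrite /radial /normsq; ring.
  rewrite [(b * nu x + _) * _]mulrDl lerD2l.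
  set Y := u1 x * _ + _.
  have hY : - Y <= m / 2 * nu x + (2 * m)^-1 * Yq x.
    rewrite -subr_ge0 (_ : _ - _ = m / 2 *
      ((u1 x + (E1 x - b * u1 x) / m) ^+ 2 + (u2 x + (E2 x - b * u2 x) / m) ^+ 2)).
      by rewrite mulr_ge0 ?addr_ge0 ?sqr_ge0//; have := m2; lra.
    by rewrite /Y /Yq /normsq; field; rewrite gt_eqF//; have := m2; lra.
  have hg : 0 <= m / 2 * nu x + (2 * m)^-1 * Yq x.
    rewrite addr_ge0// mulr_ge0//; first by have := m2; lra.
      by rewrite invr_ge0; have := m2; lra.
    by rewrite addr_ge0 ?sqr_ge0.
  rewrite lerNl -mulNr mulrC.
  apply: (@le_trans _ _ ((s - sqnorm x) * (m / 2 * nu x + (2 * m)^-1 * Yq x))).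
    by rewrite ler_wpM2l.
  by rewrite ler_wpM2r.
move=> hE.
have hJ := normsq_succ_ge0.
have hn : 0 <= (1 + n%:R / 2) * J1 by rewrite mulr_ge0//; have := nK1; lra.
have e' : (m + 1 + n%:R / 2) * J1 = m * J1 + (1 + n%:R / 2) * J1 by ring.
move: e; rewrite e' => e.
have : (b + m) * J1 <= s * ((m + 1) * H) + s * (m / 2 * H + DY / (2 * m)).
  rewrite mulrDl; move: e hE hn; move: ((1 + n%:R / 2) * J1) (s * ((m + 1) * H))
    (s * (m / 2 * H + DY / (2 * m))) (b * J1) (m * J1) (wint0 k.+2 s uE) => * .
  lra.
move/le_trans; apply; rewrite -mulrDr ler_wpM2l ?(ltW s0)// addrA lerD2r -mulrDl.
by rewrite ler_wpM2r ?(ltW H0)//; have := m2; lra.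
Qed.

Let G := wint0 k.+3 s (fun x => \sum_i z i x * (u1 x * d2 i x - u2 x * d1 i x)).
Let ss : s <= R ^+ 2. Proof. exact: ltW. Qed.

Lemma wint0_succ_le j (f : 'rV[K]_n -> K) : cont_ball R2 f -> (forall x, 0 <= f x) -> wint0 j.+1 s f <= s * wint0 j s f.
Proof.
move=> cf f0; rewrite wint0_rho -(wint0Z sR)//; apply: (le_wint0 sR); [solve_cont_ball..|] => x xs.
by rewrite mulrC ler_wpM2r// gerBl sqnorm_ge0.
Qed.

(** For lam = (b + m) / R the two halves of Young's inequality balance: the
    mass is bounded by its concentration and the energy by the frequency, and b
    disappears from the sum. *)
Lemma gradient_cross_ge : - (L * s * R / 2 * ((n%:R + 2) * (2 * m + 1) * H + n%:R * DY / (2 * m))) <= G.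
Proof.
have hm := m2; have hn := nK1; have hb := frequency_ge.
have bm : 0 < b + m by lra.
(* positive because b >= - m / 2 *)
pose lam := (b + m) / R.
have l0 : 0 < lam by rewrite divr_gt0.
have hG1 : - (L / 2) * (n%:R * lam * wint0 k.+3 s nu + lam^-1 * wint0 k.+3 s g2) <= G.
  rewrite -!(wint0Z sR)// -(wint0D sR); [|by solve_cont_ball..].
  rewrite -(wint0Z sR); last by solve_cont_ball.
  apply: (le_wint0 sR); [by solve_cont_ball..|] => x /inB xR.
  rewrite mulNr [X in X <= _](_ : _ =
     \sum_(i < n) - (L / 2 * (lam * (u1 x ^+ 2 + u2 x ^+ 2) + (d1 i x ^+ 2 + d2 i x ^+ 2) / lam))).
    by apply: ler_sum => i _; apply: pointwise_cross => //; exact: z_le.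
  rewrite sumrN -mulr_sumr big_split/= sumr_const card_ord -mulr_suml.
  by rewrite -[_ *+ n]mulr_natl /normsq /gradsq; ring.
apply: le_trans hG1; rewrite mulNr lerN2.
have -> : L * s * R / 2 * ((n%:R + 2) * (2 * m + 1) * H + n%:R * DY / (2 * m))
  = L / 2 * (s * (n%:R * (R * ((2 * m + 1) * H + DY / (2 * m))) + R * (4 * m + 2) * H)).
  by field; rewrite gt_eqF//; lra.
rewrite ler_wpM2l ?divr_ge0//.
have hJ2 : wint0 k.+3 s nu <= s * J1 by exact: wint0_succ_le.
have hF2 : wint0 k.+3 s g2 <= s * F by exact: wint0_succ_le.
have a1 : lam * J1 <= R * ((2 * m + 1) * H + DY / (2 * m)).
  have E0 : 0 <= (2 * m + 1) * H + DY / (2 * m).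
    by rewrite addr_ge0 ?mulr_ge0 ?invr_ge0 ?(ltW H0)//; lra.
  rewrite /lam mulrAC ler_pdivrMr//; apply: le_trans mass_concentration _.
  by rewrite mulrAC ler_wpM2r// -expr2.
have a2 : lam^-1 * F <= R * (4 * m + 2) * H.
  rewrite /lam invf_div mulrC mulrA ler_pdivrMr//.
  apply: (@le_trans _ _ ((2 * (m + 1) * b + M * s) * H * R)).
    by rewrite ler_wpM2r ?(ltW R0)// gradsq_int_le.
  have Ms : M * s <= m ^+ 2 by apply: le_trans mM; rewrite ler_wpM2l.
  have hh : 2 * (m + 1) * b + M * s <= (4 * m + 2) * (b + m).
    rewrite -subr_ge0 (_ : _ - _ = 2 * m * (b + m / 2) + (m ^+ 2 - M * s) + 2 * m ^+ 2 + 2 * m).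
      have m0 : 0 <= m by lra.
      have b0 : 0 <= b + m / 2 by rewrite -[m / 2]opprK subr_ge0.
            have q0 : 0 <= m ^+ 2 - M * s by rewrite subr_ge0.
      apply: addr_ge0; last by rewrite mulr_ge0.
      apply: addr_ge0; last by rewrite mulr_ge0// sqr_ge0.
      by apply: addr_ge0 => //; rewrite !mulr_ge0.
    by field.
  have -> : R * (4 * m + 2) * H * (b + m) = (4 * m + 2) * (b + m) * H * R by ring.
  by rewrite ler_wpM2r ?(ltW R0)// ler_wpM2r ?(ltW H0).
rewrite mulrDr; apply: lerD.
  rewrite -mulrA [s * _]mulrCA; apply: ler_wpM2l; first by rewrite ler0n.
  apply: (@le_trans _ _ (lam * (s * J1))); first by rewrite ler_wpM2l// ltW.
  by rewrite [lam * _]mulrCA ler_wpM2l// ltW.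
apply: (@le_trans _ _ (lam^-1 * (s * F))).
  by rewrite ler_wpM2l// invr_ge0 ltW.
by rewrite [lam^-1 * _]mulrCA ler_wpM2l// ltW.
Qed.

Let D := wint0 k.+1 s (fun x => E1 x ^+ 2 + E2 x ^+ 2).
Let I := wint0 k.+2 s (fun x => g2 x + A x * nu x).
Let S1 := wint0 k.+2 s (fun x => (A x + 2^-1 * (\sum_i x ord0 i * a i x)) * nu x).
Let P := wint0 k.+3 s (fun x => Z x * V2 x * nu x).
Let J2 := wint0 k.+3 s nu.
Let S2' := wint0 k.+2 s (fun x => (V1 x - A x) * (uE x - b * nu x) + V2 x * Kc x).

(** The number b is the coefficient of the orthogonal projection of E u on u. *)
Lemma deviation_expand : DY = D - b * B.
Proof.
have e : DY = D - 2 * b * B + b ^+ 2 * H.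
  rewrite /D /B /H -!(wint0Z sR) -?(wint0N sR) -?(wint0D sR); [|by solve_cont_ball..].
  by apply: eq_wint0 => x _; rewrite /Yq /radial /normsq; ring.
by rewrite e -bH; ring.
Qed.

Lemma energy_radial : I = 2 * (m + 1) * B - wint0 k.+2 s (fun x => (V1 x - A x) * nu x).
Proof.
have := energy sR k.+1 ud1 ud2 dh1 dh2 cu1 cu2 cd1 cd2 ch1 ch2 lap1 lap2.
rewrite -/B mk3 => ->; rewrite -(wint0N sR) -?(wint0D sR); [|by solve_cont_ball..].
by apply: eq_wint0 => x _; ring.
Qed.

(** The terms proportional to b recombine so that E u appears through Y only;
    the twist is unchanged when E u is replaced by Y. *)
Lemma frequency_expand :
  s * ((m + 1) * wint0 k.+1 s (fun x => g2 x + A x * nu x)) * H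
  - I * ((m + n%:R / 2) * H + B) = H * (2 * (m + 1) * DY + S1 - S2').
Proof.
have := energy_scaling sR k.+1 ud1 ud2 dh1 dh2 Aa sym1 sym2 cu1 cu2 cd1 cd2 ch1 ch2 cA ca cV1 cV2 lap1 lap2.
rewrite mk3 => ->; rewrite -/I -/D -/S1 -/m.
have -> : wint0 k.+2 s (fun x => (V1 x - A x) * uE x + V2 x * Kc x) =
   S2' + b * wint0 k.+2 s (fun x => (V1 x - A x) * nu x).
  rewrite /S2' -(wint0Z sR) -?(wint0D sR); [|by solve_cont_ball..].
  by apply: eq_wint0 => x _; ring.
rewrite deviation_expand energy_radial -bH; ring.
Qed.

(** The square is taken with c = 2 m: of the leading term 2 (m + 1) DY it
    leaves 2 DY, which pays for the term in DY of gradient_cross_ge. *)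
Lemma square_bound : wint0 k.+2 s (fun x => Z x * Kc x) - P / (2 * m) - dd * J2 / (8 * m)
  <= 2 * m * DY - S2'.
Proof.
have hm := m2.
rewrite [P / _]mulrC [dd * _ / _]mulrAC /P /J2 /S2' /DY.
rewrite ![wint0 k.+3 _ _]wint0_rho -!(wint0Z sR) -?(wint0N sR) ; [|by solve_cont_ball..].
rewrite -?(wint0D sR); [|by solve_cont_ball..].
rewrite ![wint0 k.+2 _ _]wint0_rho -?(wint0D sR); [|by solve_cont_ball..].
apply: (le_wint0 sR); [by solve_cont_ball..|] => x /inB xR.
have := @pointwise_square K (2 * m) b (s - sqnorm x) (E1 x) (E2 x) (u1 x) (u2 x)
  (V1 x - A x) (V2 x - Z x) (Z x) dd (nu x) (Kc x) _ (W_le xR) erefl erefl.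
have -> : Z x + (V2 x - Z x) = V2 x by ring.
have m0 : 0 < 2 * m by lra.
move=> /(_ m0) h; apply: le_trans (le_trans h _).
  by rewrite le_eqVlt; apply/orP; left; apply/eqP; field; rewrite gt_eqF//; lra.
by rewrite le_eqVlt; apply/orP; left; apply/eqP; rewrite /Yq /radial; ring.
Qed.

Lemma real_potential_ge : - ((M + n%:R * R * L / 2) * (s * H)) <= S1.
Proof.
apply: (@le_trans _ _ (- ((M + n%:R * R * L / 2) * J1))).
  rewrite lerN2 ler_wpM2l ?normsq_succ_le// addr_ge0// divr_ge0// !mulr_ge0//; exact: ltW.
rewrite -mulNr -(wint0Z sR)//; apply: (le_wint0 sR); [by solve_cont_ball..|] => x /inB xR.
apply: ler_wpM2r => //; rewrite opprD; apply: lerD.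
  by rewrite lerNl (le_trans (ler_norm _))// normrN A_le.
have : `|\sum_i x ord0 i * a i x| <= n%:R * R * L.
  apply: (le_trans (ler_norm_sum _ _ _)).
  have -> : n%:R * R * L = \sum_(i < n) R * L.
    by rewrite sumr_const card_ord -[(R * L) *+ n]mulr_natl mulrA.
  apply: ler_sum => i _; rewrite normrM ler_pM//; [exact: coord_le (ltW R0) (ltW xR)|exact: a_le].
rewrite ler_norml => /andP[h _]; move: h; move: (\sum_i _) (n%:R * R * L) => p q; lra.
Qed.

Lemma normsq_succ2_le : J2 <= s * (R ^+ 2 * H).
Proof.
apply: (le_trans (wint0_succ_le _ _ _)) => //; rewrite ler_wpM2l ?(ltW s0)//.
by apply: (le_trans normsq_succ_le); rewrite ler_wpM2r// ltW.
Qed.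

Lemma imaginary_potential_le : P <= M ^+ 2 * J2.
Proof.
rewrite -(wint0Z sR)//; apply: (le_wint0 sR); [by solve_cont_ball..|] => x /inB xR.
rewrite ler_wpM2r// expr2 (le_trans (ler_norm _))// normrM ler_pM//.
  exact: Z_le.
exact: V2_le.
Qed.

(** The right side is s (I / H)' H^2, and the lower bound is integrable with
    respect to ds / s down to 0, which keeps the constants independent of the
    radii. *)
Theorem frequency_inequality :
  - (5 * m ^+ 2 * (s / R ^+ 2) * H ^+ 2) <=
  s * ((m + 1) * wint0 k.+1 s (fun x => g2 x + A x * nu x)) * H
  - I * ((m + n%:R / 2) * H + B).
Proof.
rewrite frequency_expand.
have hm := m2; have hn := nK1.
have m0 : 0 < m by lra.
pose h := s / R ^+ 2 * H.
have -> : - (5 * m ^+ 2 * (s / R ^+ 2) * H ^+ 2) = H * - (5 * (m ^+ 2 * h)).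
  by rewrite /h; ring.
rewrite ler_wpM2l ?(ltW H0)//.
have R20 : 0 < R ^+ 2 by rewrite exprn_gt0.
have h0 : 0 <= h by rewrite mulr_ge0 ?divr_ge0 ?(ltW s0) ?(ltW H0) ?(ltW R20).
have sH : s * H = R ^+ 2 * h.
  by rewrite /h; field; rewrite gt_eqF.
have mh : 0 <= m ^+ 2 * h by rewrite mulr_ge0// sqr_ge0.
have T : 2 * (m + 2) * wint0 k.+2 s (fun x => Z x * Kc x) = G + P.
  have := twist_ibp sR k.+2 ud1 ud2 dh1 dh2 Zz cu1 cu2 cd1 cd2 ch1 ch2 cZ cz lap1 lap2.
  rewrite mk4 => ->; rewrite (wint0D sR)//; by solve_cont_ball.
have T' : wint0 k.+2 s (fun x => Z x * Kc x) = G / (2 * (m + 2)) + P / (2 * (m + 2)).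
  apply: (@mulfI _ (2 * (m + 2))); first by rewrite gt_eqF//; lra.
  by rewrite T; field; rewrite gt_eqF//; lra.
have sq := square_bound; rewrite T' in sq.
have MR : M ^+ 2 * (R ^+ 2 * R ^+ 2) <= m ^+ 4.
  rewrite -expr2 -exprMn (_ : m ^+ 4 = (m ^+ 2) ^+ 2); last by rewrite -exprM.
  by rewrite ler_sqr ?nnegrE// mulr_ge0// ltW.
have bP : - (m ^+ 2 * h) <= P / (2 * (m + 2)) - P / (2 * m).
  have -> : P / (2 * (m + 2)) - P / (2 * m) = - (P / (m * (m + 2))).
    by field; rewrite !gt_eqF//; lra.
  rewrite lerN2 ler_pdivrMr; last by rewrite mulr_gt0//; lra.
  apply: (le_trans imaginary_potential_le); apply: (@le_trans _ _ (M ^+ 2 * (s * (R ^+ 2 * H)))).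
    by rewrite ler_wpM2l ?sqr_ge0// normsq_succ2_le.
  have -> : M ^+ 2 * (s * (R ^+ 2 * H)) = M ^+ 2 * (R ^+ 2 * R ^+ 2) * h.
    by transitivity (M ^+ 2 * R ^+ 2 * (s * H)); [ring|rewrite sH; ring].
  apply: (@le_trans _ _ (m ^+ 4 * h)); first by rewrite ler_wpM2r.
  have -> : m ^+ 2 * h * (m * (m + 2)) = m ^+ 4 * h + 2 * m ^+ 3 * h by ring.
  rewrite lerDl; apply: mulr_ge0 => //; apply: mulr_ge0 => //.
  by apply: exprn_ge0; exact: ltW.
have bd : dd * J2 / (8 * m) <= m ^+ 2 * h / 8.
  rewrite ler_pdivrMr; last by lra.
  apply: (@le_trans _ _ (dd * (s * (R ^+ 2 * H)))); first by rewrite ler_wpM2l// normsq_succ2_le.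
  have -> : dd * (s * (R ^+ 2 * H)) = dd * R ^+ 4 * h.
    by transitivity (dd * R ^+ 2 * (s * H)); [ring|rewrite sH; ring].
  have -> : m ^+ 2 * h / 8 * (8 * m) = m ^+ 3 * h by field.
  by rewrite ler_wpM2r.
have bS : - (3 / 2 * m ^+ 2 * h) <= S1.
  apply: le_trans real_potential_ge; rewrite lerN2 sH mulrA ler_wpM2r//.
  have -> : (M + n%:R * R * L / 2) * R ^+ 2 = M * R ^+ 2 + n%:R * L * R ^+ 3 / 2 by ring.
  move: mM mL; move: (M * R ^+ 2) (n%:R * L * R ^+ 3) (m ^+ 2) => p q r; lra.
have m20 : 0 < 2 * (m + 2) by lra.
have bG : - (3 / 2 * m ^+ 2 * h + DY) <= G / (2 * (m + 2)).
  rewrite ler_pdivlMr//; apply: le_trans gradient_cross_ge.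
  rewrite mulNr lerN2.
  have -> : L * s * R / 2 * ((n%:R + 2) * (2 * m + 1) * H + n%:R * DY / (2 * m))
    = L * R * (s * H) / 2 * ((n%:R + 2) * (2 * m + 1)) + n%:R * L * R * s * DY / (4 * m).
    by field; rewrite gt_eqF.
  rewrite sH [(_ + DY) * _]mulrDl; apply: lerD.
    have -> : L * R * (R ^+ 2 * h) / 2 * ((n%:R + 2) * (2 * m + 1)) =
        (L * R ^+ 3 * (n%:R + 2)) * ((2 * m + 1) * h / 2) by ring.
    apply: (@le_trans _ _ (3 * m ^+ 2 * ((2 * m + 1) * h / 2))).
      rewrite ler_wpM2r//; first by rewrite divr_ge0// mulr_ge0//; lra.
      apply: (@le_trans _ _ (3 * (n%:R * L * R ^+ 3))); last by rewrite ler_wpM2l.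
      have LR : 0 <= L * R ^+ 3 by rewrite mulr_ge0// exprn_ge0// ltW.
      rewrite -subr_ge0 (_ : _ - _ = L * R ^+ 3 * (2 * (n%:R - 1))); last by ring.
      by rewrite mulr_ge0// mulr_ge0// subr_ge0.
    have -> : 3 / 2 * m ^+ 2 * h * (2 * (m + 2)) =
      3 * m ^+ 2 * ((2 * m + 1) * h / 2) + 9 / 2 * (m ^+ 2 * h) by field.
    by rewrite lerDl mulr_ge0// divr_ge0.
  have -> : n%:R * L * R * s * DY / (4 * m) = (n%:R * L * R * s / (4 * m)) * DY by ring.
  rewrite mulrC ler_wpM2l// ler_pdivrMr; last lra.
  apply: (@le_trans _ _ (n%:R * L * R ^+ 3)).
    have -> : n%:R * L * R ^+ 3 = n%:R * L * R * R ^+ 2 by ring.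
    by rewrite ler_wpM2l// !mulr_ge0// ltW.
  apply: (le_trans mL); rewrite -subr_ge0.
  rewrite (_ : _ - _ = 7 * (m * m) + 16 * m); last by ring.
  by rewrite addr_ge0// !mulr_ge0// ltW.
move: sq bP bd bS bG DY0.
have -> : 2 * (m + 1) * DY = 2 * m * DY + 2 * DY by ring.
rewrite -[3 / 2 * m ^+ 2 * h]mulrA.
move: (2 * m * DY) mh.
move: DY S1 S2' (G / _) (P / (2 * m)) (P / _) (dd * J2 / _) (m ^+ 2 * h).
move=> dy p1 p2 p3 p4 p5 p6 mh q ? ? ? ? ? ? ?; lra.
Qed.

End frequency.

(** * Log-convexity up to a linear error *)

Section log_convexity.
Context (K : realType).

Lemma derive_ndecr (f f' : K -> K) (a b : K) : a <= b ->
  (forall x, a <= x <= b -> is_derive x (1:K) f (f' x)) ->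
  (forall x, a <= x <= b -> 0 <= f' x) -> f a <= f b.
Proof.
move=> ab df f'0; apply: (@ger0_derive1_ndecr K f a b) => //.
- move=> x; rewrite in_itv/= => /andP[/ltW ax /ltW xb].
  by have [] := df x; rewrite ?ax ?xb.
- move=> x; rewrite in_itv/= => /andP[/ltW ax /ltW xb].
  have axb : a <= x <= b by rewrite ax xb.
  by rewrite derive1E; have [_ ->] := df x axb; exact: f'0.
- apply: derivable_within_continuous => x; rewrite in_itv/= => axb.
  by have [] := df x axb.
Qed.

Lemma derive_nincr (f f' : K -> K) (a b : K) : a <= b ->
  (forall x, a <= x <= b -> is_derive x (1:K) f (f' x)) ->
  (forall x, a <= x <= b -> f' x <= 0) -> f b <= f a.
Proof.
move=> ab df f'0; rewrite -lerN2.
apply: (@derive_ndecr (fun x => - f x) (fun x => - f' x)) => // x axb.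
  by apply: isdN; exact: df.
by rewrite oppr_ge0; exact: f'0.
Qed.

Lemma isd_ln (x : K) : 0 < x -> is_derive x (1:K) (@ln K) x^-1.
Proof. exact: is_derive1_ln. Qed.

Context (H H' Q Q' : K -> K) (S A c e : K).
Hypothesis dH : forall s, 0 < s < S -> is_derive s (1:K) H (H' s).
Hypothesis H_ge0 : forall s, 0 < s < S -> 0 <= H s.
Hypothesis H_mono : forall s s', 0 < s -> s <= s' -> s' < S -> H s <= H s'.
Hypothesis dQ : forall s, 0 < s < S -> 0 < H s -> is_derive s (1:K) Q (Q' s).
Hypothesis Q'_ge0 : forall s, 0 < s < S -> 0 < H s -> 0 <= Q' s.
Hypothesis e0 : 0 <= e.
Hypothesis A0 : 0 <= A.
Hypothesis HQ : forall s, 0 < s < S -> 0 < H s ->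
  `|s * H' s - (c + e * Q s) * H s| <= A * s * H s.

(** With k2 the slope at s2, monotonicity of Q makes ln H - k2 ln s - A s
    nonincreasing before s2 and ln H - k2 ln s + A s nondecreasing after it. *)
Lemma log_three_point (s1 s2 s3 th : K) : 0 < s1 -> s1 < s2 -> s2 < s3 -> s3 < S ->
  0 < H s1 -> th = ln (s3 / s2) / ln (s3 / s1) ->
  ln (H s2) <= th * ln (H s1) + (1 - th) * ln (H s3) + A * s3.
Proof.
move=> s10 s12 s23 s3S Hs1 thE.
have s20 : 0 < s2 by exact: lt_trans s12.
have s30 : 0 < s3 by exact: lt_trans s23.
have Hs s : s1 <= s -> s <= s3 -> 0 < s < S /\ 0 < H s.
  move=> h1 h3; have ss : s < S by exact: le_lt_trans s3S.
  rewrite (lt_le_trans s10 h1) ss; split => //.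
  by apply: lt_le_trans Hs1 _; exact: H_mono.
have Qmono s s' : s1 <= s -> s <= s' -> s' <= s3 -> Q s <= Q s'.
  move=> h1 ss h3; apply: (@derive_ndecr Q Q') => // x /andP[h h'].
    by have [] := Hs x (le_trans h1 h) (le_trans h' h3); exact: dQ.
  by have [] := Hs x (le_trans h1 h) (le_trans h' h3); exact: Q'_ge0.
pose k2 := c + e * Q s2.
have dphi s t : s1 <= s -> s <= s3 -> is_derive s (1:K)
   (fun s => ln (H s) - k2 * ln s - t * s) (H' s / H s - k2 / s - t).
  move=> h1 h3; have [sS Hsp] := Hs s h1 h3; have [sp _] := andP sS.
  have d1 := isd_comp1 (dH sS) (isd_ln Hsp).
  have d2 := isdB (isdB d1 (isdZ k2 (isd_ln sp))) (isdZ t (isd_id s)).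
  by apply: (is_derive_eq d2); rewrite mulr1 mulrC.
have key s : s1 <= s -> s <= s3 ->
    (c + e * Q s) / s - A <= H' s / H s <= (c + e * Q s) / s + A.
  move=> h1 h3; have [sS Hsp] := Hs s h1 h3; have [sp _] := andP sS.
  have := HQ sS Hsp; rewrite ler_norml => /andP[p1 p2].
  have sH : 0 < s * H s by rewrite mulr_gt0.
  have sn0 : s != 0 by rewrite gt_eqF.
  have Hn0 : H s != 0 by rewrite gt_eqF.
  apply/andP; split; rewrite -subr_ge0.
    have -> : H' s / H s - ((c + e * Q s) / s - A) =
      (s * H' s - (c + e * Q s) * H s - - (A * s * H s)) / (s * H s).
      by field; apply/andP.
    by rewrite divr_ge0 ?subr_ge0// ltW.
  have -> : (c + e * Q s) / s + A - H' s / H s =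
      (A * s * H s - (s * H' s - (c + e * Q s) * H s)) / (s * H s).
    by field; apply/andP.
  by rewrite divr_ge0 ?subr_ge0// ltW.
have up : ln (H s2) - ln (H s1) <= k2 * (ln s2 - ln s1) + A * (s2 - s1).
  have := @derive_nincr _ _ s1 s2 (ltW s12) (fun s h => dphi s A (proj1 (andP h))
    (le_trans (proj2 (andP h)) (ltW s23))).
  have h s : s1 <= s <= s2 -> H' s / H s - k2 / s - A <= 0.
    move=> /andP[h1 h2]; have h3 := le_trans h2 (ltW s23).
    have sp : 0 < s by exact: lt_le_trans h1.
    have /andP[_ p] := key s h1 h3.
    have : (c + e * Q s) / s <= k2 / s.
      rewrite ler_wpM2r ?invr_ge0 ?(ltW sp)// /k2 lerD2l ler_wpM2l//.
      by apply: Qmono => //; exact: ltW.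
    move: p; move: (_ / H s) (_ / s) (k2 / s) => *; lra.
  by move=> /(_ h); lra.
have dn : k2 * (ln s3 - ln s2) - A * (s3 - s2) <= ln (H s3) - ln (H s2).
  have := @derive_ndecr _ _ s2 s3 (ltW s23) (fun s h => dphi s (- A)
    (le_trans (ltW s12) (proj1 (andP h))) (proj2 (andP h))).
  have h s : s2 <= s <= s3 -> 0 <= H' s / H s - k2 / s - - A.
    move=> /andP[h1 h2]; have h3 := le_trans (ltW s12) h1.
    have sp : 0 < s by exact: lt_le_trans h1.
    have /andP[p _] := key s h3 h2.
    have : k2 / s <= (c + e * Q s) / s.
      rewrite ler_wpM2r ?invr_ge0 ?(ltW sp)// /k2 lerD2l ler_wpM2l//.
      by apply: Qmono => //; exact: ltW.
    move: p; move: (_ / H s) (k2 / s) (_ / s) => *; lra.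
  by move=> /(_ h); lra.
have l12 : 0 < ln s2 - ln s1 by rewrite subr_gt0 ltr_ln ?posrE.
have l23 : 0 < ln s3 - ln s2 by rewrite subr_gt0 ltr_ln ?posrE.
rewrite thE !ln_div ?posrE// -subr_ge0.
set p := ln s2 - ln s1 in up l12; set q := ln s3 - ln s2 in dn l23 *.
have -> : ln s3 - ln s1 = p + q by rewrite /p /q; ring.
have pq : 0 < p + q by rewrite addr_gt0.
have -> : q / (p + q) * ln (H s1) + (1 - q / (p + q)) * ln (H s3) + A * s3 - ln (H s2)
  = (p * (ln (H s3) - ln (H s2)) - q * (ln (H s2) - ln (H s1)) + A * s3 * (p + q)) / (p + q).
  by field; rewrite gt_eqF.
apply: divr_ge0; last exact: ltW.
have u1 := ler_wpM2l (ltW l23) up.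
have u2 := ler_wpM2l (ltW l12) dn.
have v1 : 0 <= A * s1 * q by rewrite !mulr_ge0// ltW.
have v2 : 0 <= A * s2 * p by rewrite !mulr_ge0// ltW.
have v3 : 0 <= A * (s3 - s2) * q.
  apply: mulr_ge0; last exact: ltW.
  by apply: mulr_ge0 => //; rewrite subr_ge0 ltW.
move: (ln (H s1)) (ln (H s2)) (ln (H s3)) u1 u2 => x y z u1 u2.
nra.
Qed.

(** At every point where H is positive the previous inequality bounds H from
    below by a fixed positive constant; by the intermediate value theorem H
    cannot then descend to 0. *)
Lemma log_three_point_zero (s1 s2 s3 : K) : 0 < s1 -> s1 < s2 -> s2 < s3 -> s3 < S ->
  H s1 = 0 -> H s2 = 0.
Proof.
move=> s10 s12 s23 s3S Hs1; apply/eqP; apply: contraT => Hs2n.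
have s20 : 0 < s2 by exact: lt_trans s12.
have s30 : 0 < s3 by exact: lt_trans s23.
have s2S : s2 < S by exact: lt_trans s3S.
have Hs2 : 0 < H s2 by rewrite lt_neqAle eq_sym Hs2n H_ge0// s20.
have Hs3 : 0 < H s3 by apply: lt_le_trans Hs2 _; apply: H_mono => //; exact: ltW.
(* the exponent decreases with the first point, so th0 works for all of them *)
pose th0 := ln (s3 / s2) / ln (s3 / s1).
have l23 : 0 < ln (s3 / s2) by rewrite ln_gt0// ltr_pdivlMr// mul1r.
have l13 : 0 < ln (s3 / s1) by rewrite ln_gt0// ltr_pdivlMr// mul1r (lt_trans s12).
have th00 : 0 < th0 by rewrite divr_gt0.
pose eps := expR (ln (H s3) - (ln (H s3) - ln (H s2) + A * s3) / th0).
have low s : s1 <= s <= s2 -> 0 < H s -> eps <= H s.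
  move=> /andP[h1 h2] Hsp.
  have sp : 0 < s by exact: lt_le_trans h1.
  have Hss3 : H s <= H s3 by apply: H_mono => //; exact: le_trans (ltW s23).
  have lss3 : ln (H s) <= ln (H s3) by rewrite ler_ln ?posrE.
  rewrite -[H s]lnK ?posrE// ler_expR.
  have es3 : 0 <= A * s3 by rewrite mulr_ge0// ltW.
  have ls23 : ln (H s2) <= ln (H s3).
    by rewrite ler_ln ?posrE//; apply: H_mono => //; exact: ltW.
  move: h2; rewrite le_eqVlt => /predU1P[->|ss2].
    have : ln (H s3) - ln (H s2) <= (ln (H s3) - ln (H s2) + A * s3) / th0.
      rewrite ler_pdivlMr//.
      apply: (@le_trans _ _ ((ln (H s3) - ln (H s2)) * 1)); last by rewrite mulr1 lerDl.
      rewrite ler_wpM2l ?subr_ge0// /th0 ler_pdivrMr// mul1r ler_ln ?posrE ?divr_gt0//.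
      by rewrite ler_wpM2l ?(ltW s30)// lef_pV2 ?posrE// ltW.
    by move: (_ / th0) => *; lra.
  pose th := ln (s3 / s2) / ln (s3 / s).
  have h := log_three_point sp ss2 s23 s3S Hsp (erefl th).
  have thth : th0 <= th.
    rewrite /th0 /th ler_wpM2l ?(ltW l23)// lef_pV2 ?posrE//; last first.
      by rewrite ln_gt0// ltr_pdivlMr// mul1r (lt_trans ss2).
    rewrite ler_ln ?posrE ?divr_gt0//.
    by rewrite ler_wpM2l ?(ltW s30)// lef_pV2 ?posrE.
  have : ln (H s3) - ln (H s) <= (ln (H s3) - ln (H s2) + A * s3) / th0.
    rewrite ler_pdivlMr// mulrC.
    apply: (@le_trans _ _ (th * (ln (H s3) - ln (H s)))); last by lra.
    by rewrite ler_wpM2r// subr_ge0.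
  by move: (_ / th0) => *; lra.
have eps0 : 0 < eps by exact: expR_gt0.
have eH2 : eps <= H s2 by apply: low => //; rewrite lexx (ltW s12).
have cH : {within `[s1, s2], continuous H}.
  apply: derivable_within_continuous => x; rewrite in_itv/= => /andP[h1 h2].
  by have [] := dH (s := x); rewrite ?(lt_le_trans s10 h1) ?(le_lt_trans h2 s2S).
have [] := @IVT K H s1 s2 (eps / 2) (ltW s12) cH.
  rewrite Hs1 ge_min le_max; apply/andP; split.
    by rewrite ltW ?orbT ?divr_gt0.
  apply/orP; right; apply: le_trans eH2; rewrite ler_pdivrMr//; lra.
move=> x; rewrite in_itv/= => h Hx.
have := low x h; rewrite Hx divr_gt0// => /(_ isT).
by rewrite ler_pdivlMr//; lra.
Qed.

End log_convexity.

(** * Three-point inequality for the weighted mass *)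

Section weighted_three_balls.
Context (K : realType) (n : nat) (R : K) (k : nat).
Let R2 := R ^+ 2.
Hypothesis (n0 : (0 < n)%N) (R0 : 0 < R).
Context (u1 u2 V1 V2 A Z : 'rV[K]_n -> K) (d1 d2 a z : 'I_n -> 'rV[K]_n -> K)
  (h1 h2 : 'I_n -> 'I_n -> 'rV[K]_n -> K).
Hypothesis ud1 : forall i, partial_ball R2 i u1 (d1 i).
Hypothesis ud2 : forall i, partial_ball R2 i u2 (d2 i).
Hypothesis dh1 : forall i j, partial_ball R2 i (d1 j) (h1 i j).
Hypothesis dh2 : forall i j, partial_ball R2 i (d2 j) (h2 i j).
Hypothesis Aa : forall i, partial_ball R2 i A (a i).
Hypothesis Zz : forall i, partial_ball R2 i Z (z i).
Hypothesis sym1 : forall i j x, sqnorm x < R2 -> h1 i j x = h1 j i x.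
Hypothesis sym2 : forall i j x, sqnorm x < R2 -> h2 i j x = h2 j i x.
Hypothesis (cu1 : cont_ball R2 u1) (cu2 : cont_ball R2 u2) (cd1 : forall i, cont_ball R2 (d1 i))
  (cd2 : forall i, cont_ball R2 (d2 i)) (ch1 : forall i j, cont_ball R2 (h1 i j))
  (ch2 : forall i j, cont_ball R2 (h2 i j)) (cA : cont_ball R2 A) (cZ : cont_ball R2 Z)
  (ca : forall i, cont_ball R2 (a i)) (cz : forall i, cont_ball R2 (z i))
  (cV1 : cont_ball R2 V1) (cV2 : cont_ball R2 V2).
Hypothesis lap1 : forall x, sqnorm x < R2 ->
  \sum_i h1 i i x = V1 x * u1 x - V2 x * u2 x.
Hypothesis lap2 : forall x, sqnorm x < R2 ->
  \sum_i h2 i i x = V2 x * u1 x + V1 x * u2 x.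
Context (M L dd : K).
Hypothesis (M0 : 0 <= M) (L0 : 0 <= L) (dd0 : 0 <= dd).
Hypothesis A_le : forall x, sqnorm x < R2 -> `|A x| <= M.
Hypothesis Z_le : forall x, sqnorm x < R2 -> `|Z x| <= M.
Hypothesis V1_le : forall x, sqnorm x < R2 -> `|V1 x| <= M.
Hypothesis V2_le : forall x, sqnorm x < R2 -> `|V2 x| <= M.
Hypothesis W_le : forall x, sqnorm x < R2 ->
  (V1 x - A x) ^+ 2 + (V2 x - Z x) ^+ 2 <= dd.
Hypothesis a_le : forall i x, sqnorm x < R2 -> `|a i x| <= L.
Hypothesis z_le : forall i x, sqnorm x < R2 -> `|z i x| <= L.
Let m : K := k.+2%:R.
Hypothesis mM : M * R ^+ 2 <= m ^+ 2.
Hypothesis mL : n%:R * L * R ^+ 3 <= m ^+ 2.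
Hypothesis md : dd * R ^+ 4 <= m ^+ 3.


Local Notation nu := (normsq u1 u2).
Local Notation g2 := (gradsq d1 d2).
Local Notation uE := (radial u1 u2 d1 d2).
Let cnu : cont_ball R2 nu. Proof. exact: cont_ball_normsq. Qed.
Let cg2 : cont_ball R2 g2. Proof. exact: cont_ball_gradsq. Qed.
Let cuE : cont_ball R2 uE. Proof. exact: cont_ball_radial. Qed.
Let nu0 x : 0 <= nu x. Proof. by rewrite addr_ge0 ?sqr_ge0. Qed.
Let m2 : 2 <= m. Proof. by rewrite /m ler_nat. Qed.
Let mk3 : (k.+3%:R : K) = m + 1. Proof. by rewrite /m -[k.+3]addn1 natrD. Qed.
Let R20 : 0 < R2. Proof. by rewrite exprn_gt0. Qed.

Definition wmass (s : K) := wint0 k.+1 s nu.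
Let H := wmass.
Let H' s := m * wint0 k s nu.
Let I s := wint0 k.+2 s (fun x => g2 x + A x * nu x).
Let I' s := (m + 1) * wint0 k.+1 s (fun x => g2 x + A x * nu x).
Let B s := wint0 k.+1 s uE.
Let Q s := I s / H s + 5 * m ^+ 2 / R ^+ 2 * s.
Let Q' s := (I' s * H s - I s * H' s) / H s ^+ 2 + 5 * m ^+ 2 / R ^+ 2.

Let dH s : 0 < s < R2 -> is_derive s (1:K) H (H' s).
Proof. by move=> /andP[_ sR]; exact: (wint0_derive sR k cnu). Qed.

Let H_ge0 s : 0 < s < R2 -> 0 <= H s.
Proof. by move=> /andP[_ sR]; apply: (wint0_ge0 sR). Qed.

Let H_mono s s' : 0 < s -> s <= s' -> s' < R2 -> H s <= H s'.
Proof.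
move=> s0 ss sR.
apply: (@derive_ndecr K H H') => // x /andP[h h'].
  by apply: dH; rewrite (lt_le_trans s0 h) (le_lt_trans h' sR).
rewrite /H' mulr_ge0//; have xR : x < R2 by exact: le_lt_trans sR.
exact: (wint0_ge0 xR).
Qed.

Let cI : cont_ball R2 (fun x => g2 x + A x * nu x). Proof. by solve_cont_ball. Qed.

Let dQ s : 0 < s < R2 -> 0 < H s -> is_derive s (1:K) Q (Q' s).
Proof.
move=> sR Hs; have /andP[_ sR'] := sR.
have dI : is_derive s (1:K) I (I' s).
  by rewrite /I' -mk3; exact: (wint0_derive sR' k.+1 cI).
have Hn : H s != 0 by rewrite gt_eqF.
have dV : is_derive s (1:K) (fun s => (H s)^-1) (- (H s) ^- 2 * H' s).
  have [dh1' dh2'] := dH sR; split; first exact: derivableV.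
  by rewrite deriveV// dh2'.
have dq := isdD (isdM dI dV) (isdZ (5 * m ^+ 2 / R ^+ 2) (isd_id s)).
by apply: (is_derive_eq dq); rewrite /Q'; field; rewrite Hn gt_eqF.
Qed.

Let Hscale s : 0 < s < R2 -> s * H' s = (m + n%:R / 2) * H s + B s.
Proof.
by move=> /andP[_ sR]; exact: (normsq_scaling sR k ud1 ud2 cu1 cu2 cd1 cd2).
Qed.

Let Q'_ge0 s : 0 < s < R2 -> 0 < H s -> 0 <= Q' s.
Proof.
move=> sR Hs; have /andP[s0 sR'] := sR.
have := @frequency_inequality K n R s k n0 R0 s0 sR' u1 u2 V1 V2 A Z d1 d2 a z h1 h2
  ud1 ud2 dh1 dh2 Aa Zz sym1 sym2 cu1 cu2 cd1 cd2 ch1 ch2 cA cZ ca cz cV1 cV2 lap1 lap2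
  M L dd M0 L0 dd0 A_le Z_le V1_le V2_le W_le a_le z_le mM mL md Hs.
rewrite -/(H s) -/(I s) -/(I' s) -/(B s) -Hscale// => h.
have sH2 : 0 < s * H s ^+ 2 by rewrite mulr_gt0 ?exprn_gt0.
have -> : Q' s = (s * I' s * H s - I s * (s * H' s)
    - - (5 * m ^+ 2 * (s / R ^+ 2) * H s ^+ 2)) / (s * H s ^+ 2).
  by rewrite /Q'; field; rewrite !gt_eqF.
by apply: divr_ge0; [rewrite subr_ge0|exact: ltW].
Qed.

Let HQ s : 0 < s < R2 -> 0 < H s ->
  `|s * H' s - (m + n%:R / 2 + (2 * (m + 1))^-1 * Q s) * H s| <= 3 * m / R ^+ 2 * s * H s.
Proof.
move=> sR Hs; have /andP[s0 sR'] := sR; have hm := m2.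
have m0 : 0 < m by lra.
pose w := wint0 k.+2 s (fun x => (V1 x - A x) * nu x).
pose t := m ^+ 2 / R ^+ 2.
have cW : cont_ball R2 (fun x => (V1 x - A x) * nu x) by solve_cont_ball.
have t0 : 0 <= t by rewrite divr_ge0 ?sqr_ge0.
have e : 2 * (m + 1) * B s = I s + w.
  have := energy sR' k.+1 ud1 ud2 dh1 dh2 cu1 cu2 cd1 cd2 ch1 ch2 lap1 lap2.
  rewrite mk3 => ->; rewrite -(wint0D sR'); [|by solve_cont_ball..].
  by apply: eq_wint0 => x _; ring.
have W1 (x : 'rV[K]_n) : sqnorm x < R2 -> `|V1 x - A x| <= t.
  move=> xR; rewrite -ler_sqr ?nnegrE// real_normK ?num_real//.
  apply: (@le_trans _ _ dd).
    by apply: le_trans (W_le xR); rewrite lerDl sqr_ge0.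
  rewrite /t expr_div_n -!exprM ler_pdivlMr ?exprn_gt0//.
  apply: (le_trans md); rewrite [m ^+ (2 * 2)]exprS -[X in X <= _]mul1r.
  by rewrite ler_wpM2r// ?exprn_ge0//; lra.
have J1le : wint0 k.+2 s nu <= s * H s.
  by apply: (normsq_succ_le (R:=R)).
have wle : `|w| <= t * (s * H s).
  rewrite ler_norml; apply/andP; split.
    apply: (@le_trans _ _ (- t * wint0 k.+2 s nu)).
      by rewrite mulNr lerN2 ler_wpM2l.
    rewrite -(wint0Z sR')//; apply: (le_wint0 sR'); [by solve_cont_ball..|] => x xs.
    rewrite ler_wpM2r// lerNl (le_trans (ler_norm _))// normrN W1//.
    exact: lt_trans sR'.
  apply: (@le_trans _ _ (t * wint0 k.+2 s nu)); last by rewrite ler_wpM2l.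
  rewrite -(wint0Z sR')//; apply: (le_wint0 sR'); [by solve_cont_ball..|] => x xs.
  rewrite ler_wpM2r// (le_trans (ler_norm _))// W1//.
  exact: lt_trans sR'.
rewrite Hscale//.
have m1 : 0 < 2 * (m + 1) by lra.
have -> : (m + n%:R / 2) * H s + B s - (m + n%:R / 2 + (2 * (m + 1))^-1 * Q s) * H s
   = (w - 5 * t * (s * H s)) / (2 * (m + 1)).
  have -> : B s = (I s + w) / (2 * (m + 1)).
    by rewrite -e; field; rewrite gt_eqF//; lra.
  by rewrite /Q /t; field; rewrite !gt_eqF//; lra.
rewrite normrM normfV (gtr0_norm m1) ler_pdivrMr//.
apply: (le_trans (ler_normB _ _)).
have tsH : 0 <= t * (s * H s) by rewrite mulr_ge0// mulr_ge0// ltW.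
have -> : `|5 * t * (s * H s)| = 5 * (t * (s * H s)).
  by rewrite -mulrA ger0_norm// mulr_ge0.
have -> : 3 * m / R ^+ 2 * s * H s * (2 * (m + 1)) =
   6 * (t * (s * H s)) + 6 * m / R ^+ 2 * (s * H s).
  by rewrite /t; field; rewrite gt_eqF.
have p0 : 0 <= 6 * m / R ^+ 2 * (s * H s).
  by rewrite mulr_ge0 ?divr_ge0 ?mulr_ge0// ltW.
move: wle p0; move: (`|w|) (t * _) (6 * m / R ^+ 2 * _) => *; lra.
Qed.

Let e0 : 0 <= (2 * (m + 1))^-1.
Proof. by rewrite invr_ge0; have := m2; lra. Qed.
Let A0 : 0 <= 3 * m / R ^+ 2.
Proof. by rewrite divr_ge0 ?sqr_ge0//; have := m2; lra. Qed.

Theorem wmass_three_point s1 s2 s3 th : 0 < s1 -> s1 < s2 -> s2 < s3 -> s3 < R2 ->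
  0 < wmass s1 -> th = ln (s3 / s2) / ln (s3 / s1) ->
  ln (wmass s2) <= th * ln (wmass s1) + (1 - th) * ln (wmass s3) + 3 * m.
Proof.
move=> s10 s12 s23 s3R Hs1 thE.
apply: (le_trans (log_three_point dH H_mono dQ Q'_ge0 e0 A0 HQ s10 s12 s23 s3R Hs1 thE)).
rewrite lerD2l -mulrA [_^-1 * _]mulrC mulrA ler_pdivrMr ?exprn_gt0//.
by rewrite ler_wpM2l ?(ltW s3R)//; have := m2; lra.
Qed.

Theorem wmass_vanish s1 s2 s3 : 0 < s1 -> s1 < s2 -> s2 < s3 -> s3 < R2 ->
  wmass s1 = 0 -> wmass s2 = 0.
Proof. exact: (log_three_point_zero dH H_ge0 H_mono dQ Q'_ge0 e0 A0 HQ). Qed.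

End weighted_three_balls.

(** * Equality of mixed partial derivatives *)

Section schwarz.
Context (K : realType) (V : normedModType K).
Implicit Types (f g h : V -> K) (x y v w : V).

Lemma mvt_line f (f' : V -> K) x v (t : K) : 0 < t ->
  (forall s, 0 <= s <= t -> is_derive (s *: v + x) v f (f' (s *: v + x))) ->
  exists2 s, 0 <= s <= t & f (t *: v + x) - f x = t * f' (s *: v + x).
Proof.
move=> t0 df.
have dl (s : K) : 0 <= s <= t ->
    is_derive s (1:K) (fun s => f (s *: v + x)) (f' (s *: v + x)).
  move=> st; have h := df s st.
  have h' : is_derive ((s - 0) *: v + x) v f (f' (s *: v + x)) by rewrite subr0.
  by have := is_derive_line h'; under eq_fun do rewrite subr0.
have [] := @MVT K (fun s => f (s *: v + x)) (fun s => f' (s *: v + x)) 0 t t0.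
- move=> s; rewrite in_itv/= => /andP[/ltW h1 /ltW h2]; apply: dl; by rewrite h1 h2.
- apply: derivable_within_continuous => s; rewrite in_itv/= => st.
  by have [] := dl s st.
move=> s; rewrite in_itv/= => /andP[/ltW h1 /ltW h2] E; exists s; first by rewrite h1 h2.
by rewrite scale0r add0r in E; rewrite E subr0 mulrC.
Qed.

(** The mean value theorem in direction v for the increment in direction w,
    then in direction w. *)
Lemma mixed_difference f (fv h : V -> K) x v w (r t : K) : 0 < t -> 2 * t < r ->
  `|v| <= 1 -> `|w| <= 1 ->
  (forall y, `|y - x| < r -> is_derive y v f (fv y)) ->
  (forall y, `|y - x| < r -> is_derive y w fv (h y)) ->
  exists2 y, `|y - x| <= 2 * t &
   f (t *: v + (t *: w + x)) - f (t *: v + x) - (f (t *: w + x) - f x)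
    = t ^+ 2 * h y.
Proof.
move=> t0 tr v1 w1 dv dw.
have near s s' : 0 <= s <= t -> 0 <= s' <= t -> `|s' *: w + (s *: v + x) - x| <= 2 * t.
  move=> /andP[s0 st] /andP[s0' st'].
  rewrite addrA addrK mulr_natl mulr2n; apply: (le_trans (ler_normD _ _)).
  rewrite !normrZ !ger0_norm//; apply: lerD.
    by rewrite -[t]mulr1 ler_pM.
  by rewrite -[t]mulr1 ler_pM.
have t00 : 0 <= (0 : K) <= t by rewrite lexx ltW.
have tt : 0 <= t <= t by rewrite lexx ltW.
pose g y := f (t *: w + y) - f y.
have dg s : 0 <= s <= t -> is_derive (s *: v + x) v g
    (fv (t *: w + (s *: v + x)) - fv (s *: v + x)).
  move=> st; apply: isdB; last first.
    apply: dv; apply: le_lt_trans tr; have := near s 0 st t00.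
    by rewrite scale0r add0r.
  have h1 : is_derive (t *: w + (s *: v + x)) v f (fv (t *: w + (s *: v + x))).
    by apply: dv; exact: le_lt_trans (near s t st tt) tr.
  move/is_deriveP: h1 => h1; apply/is_deriveP; move: h1.
  by under eq_fun do rewrite addrCA.
have [s st E] := mvt_line (f' := fun y => fv (t *: w + y) - fv y) t0 dg.
have dfv s' : 0 <= s' <= t -> is_derive (s' *: w + (s *: v + x)) w fv
    (h (s' *: w + (s *: v + x))).
  by move=> st'; apply: dw; exact: le_lt_trans (near s s' st st') tr.
have [s' st' E'] := mvt_line t0 dfv.
exists (s' *: w + (s *: v + x)); first exact: near.
by rewrite expr2 -mulrA -E' -E /g [t *: w + (t *: v + x)]addrCA; ring.
Qed.

Theorem mixed_partials f (fv fw hvw hwv : V -> K) x v w (r : K) : 0 < r ->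
  `|v| <= 1 -> `|w| <= 1 ->
  (forall y, `|y - x| < r -> is_derive y v f (fv y)) ->
  (forall y, `|y - x| < r -> is_derive y w f (fw y)) ->
  (forall y, `|y - x| < r -> is_derive y w fv (hwv y)) ->
  (forall y, `|y - x| < r -> is_derive y v fw (hvw y)) ->
  {for x, continuous hwv} -> {for x, continuous hvw} ->
  hvw x = hwv x.
Proof.
move=> r0 v1 w1 dv dw dwv dvw c1 c2.
apply/eqP; rewrite -subr_eq0 -normr_le0; apply/ler_addgt0Pr => e e0.
rewrite add0r.
have e20 : 0 < e / 2 by rewrite divr_gt0.
have /cvgrPdist_lt/(_ _ e20)/nbhs_ballP[r1 /= r10 h1] := c1.
have /cvgrPdist_lt/(_ _ e20)/nbhs_ballP[r2 /= r20 h2] := c2.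
(* the factor 3 keeps both points, at distance at most 2 t, in all three balls *)
pose t := Num.min r (Num.min r1 r2) / 3.
have mr : 0 < Num.min r (Num.min r1 r2) by rewrite !lt_min r0 r10 r20.
have t0 : 0 < t by rewrite divr_gt0.
have t2 : 2 * t < Num.min r (Num.min r1 r2).
  by rewrite /t; move: mr; move: (Num.min _ _) => q q0; lra.
have := t2; rewrite !lt_min => /and3P[tr tr1 tr2].
have [y yx E1] := mixed_difference t0 tr v1 w1 dv dwv.
have [z zx E2] := mixed_difference t0 tr w1 v1 dw dvw.
have hyz : hwv y = hvw z.
  apply: (@mulfI _ (t ^+ 2)); first by rewrite expf_neq0// gt_eqF.
  by rewrite -E1 -E2 [t *: w + (t *: v + x)]addrCA; ring.
have n1 : `|hwv x - hwv y| < e / 2.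
  by apply: h1; rewrite -ball_normE/= distrC (le_lt_trans yx).
have n2 : `|hvw x - hvw z| < e / 2.
  by apply: h2; rewrite -ball_normE/= distrC (le_lt_trans zx).
have -> : hvw x - hwv x = (hvw x - hvw z) - (hwv x - hwv y) by rewrite hyz; ring.
apply: (le_trans (ler_normB _ _)); lra.
Qed.

End schwarz.

(** * Mollification of a function of small oscillation *)

Section positivity.
Context (K : realType) (n : nat).

Lemma lebesgue_cube_gt0 (c : 'rV[K]_n) (d : K) : 0 < d ->
  exists B : set (n.-tuple (measurableTypeR K)), measurable B /\
   (forall t, B t -> forall i, `|(rowt t - c) ord0 i| <= d) /\
   (0 < lebesgue_tuple K n B < +oo)%E.
Proof.
move=> d0.
pose A (i : 'I_n) : set (measurableTypeR K) := `[c ord0 i - d, c ord0 i + d]%classic.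
exists [set t | forall i, A i (tnth t i)]; split.
  rewrite (_ : [set t | _] = \bigcap_(i in [set: 'I_n]) ((fun t => tnth t i) @^-1` A i)).
    apply: fin_bigcap_measurable => // i _.
    rewrite -[X in measurable X]setTI; apply: measurable_tnth => //.
    exact: measurable_itv.
  by apply/seteqP; split => t /= h i => [_|]; apply: h.
split.
  move=> t /= h i; have := h i; rewrite /A /= in_itv/= => /andP[h1 h2].
  by rewrite !mxE ler_distl h1 h2.
rewrite lebesgue_tuple_box; last by move=> i; exact: measurable_itv.
rewrite (eq_bigr (fun=> (d + d)%:E)).
  by rewrite prodEFin ltry andbT lte_fin prodr_gt0// => i _; rewrite addr_gt0.
move=> i _; rewrite /A lebesgue_measure_itv/= lte_fin ltrD2l gtrN//.
by rewrite -EFinD; congr EFin; ring.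
Qed.

Lemma Int_gt0 (f : 'rV[K]_n -> K) (c : 'rV[K]_n) (d e : K) : 0 < d -> 0 < e ->
  tame f -> (forall x, 0 <= f x) ->
  (forall x, (forall i, `|(x - c) ord0 i| <= d) -> e <= f x) -> 0 < Int f.
Proof.
move=> d0 e0 tf f0 fe.
have [B [mB [Bd /andP[B0 Boo]]]] := lebesgue_cube_gt0 c d0.
have fB : lebesgue_tuple K n B \is a fin_num by rewrite ge0_fin_numE.
have h : (\int[lebesgue_tuple K n]_(t in B) e%:E
    <= \int[lebesgue_tuple K n]_t (f (rowt t))%:E)%E.
  apply: (@le_trans _ _ (\int[lebesgue_tuple K n]_(t in B) (f (rowt t))%:E)%E).
    apply: ge0_le_integral => //.
    - by move=> t _; rewrite lee_fin ltW.
    - by apply: measurable_funTS; apply/measurable_EFinP; exact: tf.1.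
    - by move=> t Bt; rewrite lee_fin; apply: fe => i; exact: Bd.
  apply: ge0_subset_integral => //.
    by apply/measurable_EFinP; exact: tf.1.
  by move=> t _; rewrite lee_fin.
rewrite /Int /Rintegral fine_gt0//; apply/andP; split.
  by apply: lt_le_trans h; rewrite integral_cst// mule_gt0.
have := integrable_fin_num measurableT (tame_integrable tf).
have p0 : (0 <= \int[lebesgue_tuple K n]_t (f (rowt t))%:E)%E.
  by apply: integral_ge0 => t _; rewrite lee_fin.
rewrite /comp ge0_fin_numE//.
Qed.

Lemma wint_gt0 (c : 'rV[K]_n) k s : 0 < s -> 0 < wint c k s (fun=> 1).
Proof.
move=> s0; pose d := Num.min 1 (s / (2 * n.+1%:R)).
have d0 : 0 < d by rewrite lt_min ltr01/= divr_gt0// mulr_gt0.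
have e0 : 0 < (s / 2) ^+ k.+1 by rewrite exprn_gt0// divr_gt0.
apply: (@Int_gt0 _ c d _ d0 e0).
- by apply: rhoM_tame => x _; exact: cont_cst.
- by move=> x; rewrite mul1r exprn_ge0// rho_ge0.
move=> x xd; rewrite mul1r.
have d1 : d <= 1 by rewrite ge_min lexx.
have q : sqnorm (x - c) <= s / 2.
  apply: (@le_trans _ _ (\sum_(i < n) d)).
    apply: ler_sum => i _; rewrite -real_normK ?num_real// expr2.
    by apply: (le_trans (ler_pM _ _ (xd i) (xd i))) => //; rewrite -[leRHS]mulr1 ler_wpM2l// ltW.
  rewrite sumr_const card_ord -[d *+ n]mulr_natl.
  apply: (@le_trans _ _ (n%:R * (s / (2 * n.+1%:R)))).
    by rewrite ler_wpM2l// ge_min lexx orbT.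
  have -> : n%:R * (s / (2 * n.+1%:R)) = s / 2 * (n%:R / n.+1%:R) :> K.
    have : (n.+1%:R : K) != 0 by rewrite pnatr_eq0.
    by move: (n.+1%:R : K) => N N0; field.
  rewrite -[leRHS]mulr1 ler_wpM2l ?divr_ge0 ?(ltW s0)//.
  by rewrite ler_pdivrMr ?ltr0Sn// mul1r ler_nat.
have h : s / 2 <= rho c s x.
  rewrite rho_in; last by apply: (le_trans q); rewrite ler_pdivrMr//; lra.
  by move: q; move: (sqnorm _) => p; lra.
by rewrite lerXn2r ?nnegrE ?rho_ge0// ltW// divr_gt0.
Qed.

(** Split s = rho + |x - c|^2 and integrate the second part by parts. This is
    the only size estimate on the mollifying kernel that is needed. *)
Lemma ball_mass_ratio (c : 'rV[K]_n) s :
  s * wint c 0 s (fun=> 1) = (1 + n%:R / 4) * wint c 1 s (fun=> 1).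
Proof.
have cc i : cont_cball c s (fun x => (x - c) ord0 i).
  by move=> x _; exact: coordB_cont.
have c1 : cont_cball c s (fun=> 1) by move=> x _; exact: cont_cst.
have cq : cont_cball c s (fun x => sqnorm (x - c)) by move=> x _; exact: sqnormB_cont.
have e1 i : wint c 1 s (fun=> 1) = 4 * wint c 0 s (fun x => (x - c) ord0 i ^+ 2).
  have hd x : sqnorm (x - c) <= s ->
      is_derive x (evec K i) (fun y => (y - c) ord0 i) ((fun=> 1 : K) x).
    by move=> _; apply: (is_derive_eq (coordB_isd x c i i)); rewrite eqxx.
  rewrite (wint_ibp 0 hd (cc i) c1) (_ : 2 * 2 = 4 :> K); last by ring.
  by congr (_ * wint _ _ _ _); apply/funext => x; rewrite expr2.
have e2 : wint c 0 s (fun x => sqnorm (x - c)) = n%:R / 4 * wint c 1 s (fun=> 1).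
  rewrite [LHS]wint_sum; last by move=> i x _; apply: contX; exact: coordB_cont.
  rewrite (eq_bigr (fun=> 4^-1 * wint c 1 s (fun=> 1))).
    by rewrite sumr_const card_ord -[_ *+ n]mulr_natl mulrA.
  by move=> i _; rewrite (e1 i) mulrA mulVf ?mul1r// pnatr_eq0.
have e3 : wint c 1 s (fun=> 1) = s * wint c 0 s (fun=> 1) - wint c 0 s (fun x => sqnorm (x - c)).
  rewrite -wintZ// -mulN1r -wintZ// -wintD; last 2 first.
  - by move=> x _; exact: cont_cst.
  - by move=> x xs; apply: contM; [exact: cont_cst|exact: cq].
  by rewrite wint_rho; congr wint; apply/funext => x; ring.
by rewrite mulrDl mul1r -e2 {1}e3 subrK.
Qed.

End positivity.

Section int_parameter.
Context (K : realType) (n : nat).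

Lemma le_norm_Int (f g : 'rV[K]_n -> K) : tame f -> tame g ->
  (forall x, `|f x| <= g x) -> `|Int f| <= Int g.
Proof.
move=> tf tg fg; rewrite ler_norml -mulN1r -IntZ//; apply/andP; split.
  apply: le_Int => //; first exact: tameZ.
  by move=> x; rewrite mulN1r lerNl (le_trans (ler_norm _))// normrN.
by apply: le_Int => // x; rewrite (le_trans (ler_norm _)).
Qed.

Lemma Int_lip_cont (F : 'rV[K]_n -> 'rV[K]_n -> K) (g : 'rV[K]_n -> K) x :
  (\forall c \near x, tame (F c) /\ forall y, `|F c y - F x y| <= `|c - x| * g y) ->
  tame g -> {for x, continuous (fun c => Int (F c))}.
Proof.
move=> hF tg.
have tx := (nbhs_singleton hF).1.
apply: (@lip_cont _ _ _ (`|Int g|)); apply: filterS hF => c [tc hc].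
have -> : Int (F c) - Int (F x) = Int (fun y => F c y + -1 * F x y).
  by rewrite IntD ?IntZ//; [ring|exact: tameZ].
apply: (@le_trans _ _ (Int (fun y => `|c - x| * g y))).
  apply: le_norm_Int; [by apply: tameD => //; exact: tameZ|exact: tameZ|].
  by move=> y; rewrite mulN1r.
by rewrite IntZ// ler_wpM2l// ler_norm.
Qed.

End int_parameter.

Section kernel_parameter.
Context (K : realType) (n : nat) (V : 'rV[K]_n -> K) (Ro Ri eps Mv : K).
Hypothesis (Ri0 : 0 < Ri) (eps0 : 0 < eps) (RiRo : Ri + eps <= Ro).
Let s := eps ^+ 2.
Hypothesis cV : cont_ball (Ro ^+ 2) V.
Hypothesis V_le : forall y, sqnorm y < Ro ^+ 2 -> `|V y| <= Mv.

Let Ro0 : 0 < Ro. Proof. by apply: lt_le_trans RiRo; rewrite addr_gt0. Qed.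
Let s0 : 0 < s. Proof. by rewrite exprn_gt0. Qed.

Lemma sqnormC (x y : 'rV[K]_n) : sqnorm (x - y) = sqnorm (y - x).
Proof. by apply: eq_bigr => i _; rewrite -sqrrN !mxE opprB. Qed.

Lemma rho_sym (c y : 'rV[K]_n) t : rho c t y = rho y t c.
Proof. by rewrite /rho sqnormC. Qed.

(** Young's inequality with ratio eps / Ri, sharp for aligned vectors of these
    two lengths. *)
Lemma inner_ball (c y : 'rV[K]_n) : sqnorm c < Ri ^+ 2 -> sqnorm (y - c) <= s ->
  sqnorm y < Ro ^+ 2.
Proof.
move=> cR yc; apply: (@lt_le_trans _ _ ((Ri + eps) ^+ 2)); last first.
  by rewrite ler_sqr ?nnegrE// ltW// addr_gt0.
have h : sqnorm y <= (1 + eps / Ri) * sqnorm c + (1 + Ri / eps) * sqnorm (y - c).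
  rewrite /sqnorm !mulr_sumr -big_split/=; apply: ler_sum => i _; rewrite !mxE.
  move: (y ord0 i) (c ord0 i) => p q; rewrite -subr_ge0.
  have -> : (1 + eps / Ri) * q ^+ 2 + (1 + Ri / eps) * (p - q) ^+ 2 - p ^+ 2
    = (eps * q - Ri * (p - q)) ^+ 2 / (Ri * eps).
    by field; rewrite !gt_eqF.
  by rewrite divr_ge0 ?sqr_ge0// mulr_ge0// ltW.
apply: (le_lt_trans h).
have -> : (Ri + eps) ^+ 2 = (1 + eps / Ri) * Ri ^+ 2 + (1 + Ri / eps) * s.
  by rewrite /s; field; rewrite !gt_eqF.
apply: ltr_leD.
  by rewrite ltr_pM2l// addr_gt0// divr_gt0.
by rewrite ler_wpM2l// addr_ge0// divr_ge0// ltW.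
Qed.

Lemma V_cball c : sqnorm c < Ri ^+ 2 -> cont_cball c s V.
Proof. by move=> cR y yc; apply: cV; exact: inner_ball yc. Qed.

Let bump (y : 'rV[K]_n) : K := 1 * rho 0 (Ro ^+ 2 + 1) y ^+ 1.

Lemma bump_tame : tame bump.
Proof. by apply: (@rhoM_tame K n 0 (Ro ^+ 2 + 1) (fun=> 1) 0) => x _; exact: cont_cst. Qed.

Lemma bump_ge0 y : 0 <= bump y.
Proof. by rewrite /bump mul1r exprn_ge0// rho_ge0. Qed.

Lemma bump_ge1 y : sqnorm y < Ro ^+ 2 -> 1 <= bump y.
Proof.
move=> yR; rewrite /bump mul1r expr1 rho_in ?subr0; last first.
  by rewrite (le_trans (ltW yR))// lerDl.
by move: yR; move: (sqnorm y) (Ro ^+ 2) => p q; lra.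
Qed.

Lemma rho_le_s (c y : 'rV[K]_n) : rho c s y <= s.
Proof. by rewrite /rho ge_max ltW//= gerBl sqnorm_ge0. Qed.

(** The convolution of V with the square of the weight, before normalization. *)
Definition smooth_mass c : K := wint c 1 s V.
Definition smooth_mass' i c : K := 4 * wint c 0 s (fun y => V y * (y - c) ord0 i).

Lemma inner_near (c : 'rV[K]_n) : sqnorm c < Ri ^+ 2 -> \forall x \near c, sqnorm x < Ri ^+ 2.
Proof.
move=> cR; have h : (fun y => sqnorm (y - 0)) @ c --> sqnorm (c - 0) := @sqnormB_cont K n c 0.
have hh : sqnorm (c - 0) < Ri ^+ 2 by rewrite subr0.
near=> x; rewrite -[x]subr0; near: x; exact: (h _ (lt_nbhsl hh)).
Unshelve. all: by end_near. Qed.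

Lemma line_isd (f : 'rV[K]_n -> K) x v (d : K) :
  is_derive (0:K) (1:K) (fun h => f (h *: v + x)) d -> is_derive x v f d.
Proof.
move/is_deriveP => /= h; apply/is_deriveP; move: h.
under eq_fun do rewrite addr0 scale0r add0r.
by under eq_fun do rewrite [_ *: 1]mulr1.
Qed.

Lemma Mv_ge0 (c : 'rV[K]_n) : sqnorm c < Ri ^+ 2 -> 0 <= Mv.
Proof.
move=> cR; apply: le_trans (V_le (lt_le_trans cR _)) => //.
by rewrite ler_sqr ?nnegrE ?ltW// (lt_le_trans _ RiRo)// ltrDl.
Qed.

(** The derivative falls on the kernel, as V is only continuous. *)
Lemma smooth_mass_isd i : partial_ball (Ri ^+ 2) i smooth_mass (smooth_mass' i).
Proof.
move=> c cR; apply: line_isd.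
have [dlt dlt0 hd] : exists2 dl : K, 0 < dl & forall h : K, `|h| < dl ->
    sqnorm (h *: evec K i + c) < Ri ^+ 2.
  have hl : (fun h : K => h *: evec K i + c) @ (0:K) --> c.
    have : (fun h : K => h *: evec K i + c) @ (0:K) --> (0 : K) *: evec K i + c.
      by apply: cvgD; [apply: cvgZr_tmp; exact: cvg_id|exact: cvg_cst].
    by rewrite scale0r add0r.
  have /nbhs_ballP[d /= d0 h] := hl _ (inner_near cR).
  by exists d => // t td; apply: h; rewrite -ball_normE/= sub0r normrN.
pose cl (h : K) := h *: evec K i + c.
pose F (h : K) (t : n.-tuple (measurableTypeR K)) : K :=
  V (rowt t) * rho (cl h) s (rowt t) ^+ 2.
pose F' (h : K) (y : 'rV[K]_n) : K := 4 * (V y * (y - cl h) ord0 i * rho (cl h) s y ^+ 1).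
have dF (h : K) (t : n.-tuple (measurableTypeR K)) : is_derive h (1:K) (F^~ t) (F' h (rowt t)).
  set y := rowt t.
  have h1 : is_derive ((h - 0) *: evec K i + c) (evec K i) (fun z => rho y s z ^+ 2)
     (- (2 * 2) * ((cl h - y) ord0 i * rho y s (cl h) ^+ 1)).
    by rewrite subr0; exact: rho_isd.
  have h2 := is_derive_line h1.
  have h3 := isdZ (V y) h2.
  rewrite (_ : F^~ t = (fun h0 : K => V y * rho y s ((h0 - 0) *: evec K i + c) ^+ 2)); last first.
    by apply/funext => h0; rewrite /F /cl subr0 [in LHS]rho_sym.
  apply: (is_derive_eq h3); rewrite /F' [rho (cl h) s y]rho_sym !mxE.
  by ring.
pose C := 4 * Mv * eps * s.
pose G (t : n.-tuple (measurableTypeR K)) : K := C * bump (rowt t).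
have Mv0 := Mv_ge0 cR.
have C0 : 0 <= C by rewrite !mulr_ge0// ltW.
have iG : (lebesgue_tuple K n).-integrable setT (EFin \o G).
  exact: (tame_integrable (tameZ C bump_tame)).
have Icl (h : K) : `]- dlt, dlt[%classic h -> sqnorm (cl h) < Ri ^+ 2.
  by rewrite /= in_itv/= -ltr_norml => /hd.
have iF h : `]- dlt, dlt[%classic h -> (lebesgue_tuple K n).-integrable setT (EFin \o F h).
  move=> /Icl hR; exact: (tame_integrable (rhoM_tame 1 (V_cball hR))).
have I0 : `]- dlt, dlt[%classic (0:K) by rewrite /= in_itv/= oppr_lt0 dlt0.
have dF1 (h : K) (t : n.-tuple (measurableTypeR K)) :
    `]- dlt, dlt[%classic h -> setT t -> derivable (F^~ t) h 1.
  by move=> _ _; have [] := dF h t.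
have G0 (t : n.-tuple (measurableTypeR K)) : 0 <= G t by rewrite mulr_ge0// bump_ge0.
have Gub (h : K) (t : n.-tuple (measurableTypeR K)) :
    `]- dlt, dlt[%classic h -> setT t -> `|partial1of2 F h t| <= G t.
  move=> /Icl hR _; have [_ E] := dF h t; rewrite /partial1of2 derive1E E.
  set y := rowt t.
  have [yc|yc] := leP (sqnorm (y - cl h)) s; last first.
    by rewrite /F' rho_out; [rewrite expr1 !mulr0 normr0; exact: G0|exact: ltW].
  have yR := inner_ball hR yc.
  rewrite /F' !normrM (ger0_norm (ler0n _ 4)) expr1 (ger0_norm (rho_ge0 _ _ _)).
  rewrite /G /C -!mulrA ler_wpM2l//.
  rewrite ler_pM ?mulr_ge0 ?rho_ge0 ?V_le//.
  rewrite ler_pM ?rho_ge0//; first by apply: coord_le => //; exact: ltW.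
  rewrite mulrA -expr2 -/s.
  by rewrite -[leLHS]mulr1 ler_pM ?rho_ge0 ?rho_le_s ?bump_ge1.
have D := @derivable_under_integral K _ _ (lebesgue_tuple K n) F setT measurableT
  0 (- dlt) dlt I0 iF dF1 G G0 iG Gub.
have E := @differentiation_under_integral K _ _ (lebesgue_tuple K n) F setT measurableT
  0 (- dlt) dlt I0 iF dF1 G G0 iG Gub.
split; first exact: D.
rewrite -derive1E [LHS]E /smooth_mass' /wint -IntZ; last first.
  apply: rhoM_tame => y yc; apply: contM; last exact: coordB_cont.
  exact: (V_cball cR yc).
congr (Rintegral _ _ _); apply/funext => t; have [_ h] := dF 0 t.
by rewrite /partial1of2 derive1E h /F' /cl scale0r add0r.
Qed.

Let kap := n%:R * (4 * Ro).

Lemma rho_lip (c x y : 'rV[K]_n) : sqnorm c < Ri ^+ 2 -> sqnorm x < Ri ^+ 2 -> sqnorm y < Ro ^+ 2 ->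
  `|rho c s y - rho x s y| <= `|c - x| * kap.
Proof.
have RR : Ri <= Ro by apply: le_trans RiRo; rewrite lerDl ltW.
move=> cR xR yR.
have hc i : `|c ord0 i| <= Ro by apply: (le_trans (coord_le i (ltW Ri0) (ltW cR))).
have hx i : `|x ord0 i| <= Ro by apply: (le_trans (coord_le i (ltW Ri0) (ltW xR))).
have hy i : `|y ord0 i| <= Ro by apply: coord_le; exact: ltW.
have max_lip (a b : K) : `|Num.max 0 a - Num.max 0 b| <= `|a - b|.
  have [a0|a0] := leP 0 a; have [b0|b0] := leP 0 b => //.
  - rewrite subr0 !ger0_norm ?subr_ge0//; last by apply: le_trans a0; exact: ltW.
    by rewrite lerDl oppr_ge0 ltW.
  - rewrite sub0r normrN ger0_norm// distrC ger0_norm; last first.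
      by rewrite subr_ge0 (le_trans _ b0)// ltW.
    by rewrite lerDl oppr_ge0 ltW.
  - by rewrite subrr normr0.
apply: (le_trans (max_lip _ _)).
have -> : s - sqnorm (y - c) - (s - sqnorm (y - x)) =
    \sum_i (c - x) ord0 i * (2 * y ord0 i - c ord0 i - x ord0 i).
  transitivity (sqnorm (y - x) - sqnorm (y - c)); first by ring.
  by rewrite /sqnorm -sumrB; apply: eq_bigr => i _; rewrite !mxE; ring.
apply: (le_trans (ler_norm_sum _ _ _)).
rewrite /kap mulrCA.
have -> : n%:R * (`|c - x| * (4 * Ro)) = \sum_(i < n) `|c - x| * (4 * Ro).
  by rewrite sumr_const card_ord -[(`|c - x| * (4 * Ro)) *+ n]mulr_natl.
apply: ler_sum => i _; rewrite normrM ler_pM//; first exact: mx_norm_coord.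
have := hy i; have := hc i; have := hx i; rewrite !ler_norml => /andP[? ?] /andP[? ?] /andP[? ?].
by apply/andP; split; lra.
Qed.

Lemma smooth_mass_cont : cont_ball (Ri ^+ 2) smooth_mass.
Proof.
move=> x xR.
have Mv0 := Mv_ge0 xR.
apply: (@Int_lip_cont K n (fun c y => V y * rho c s y ^+ 2)
  (fun y => (Mv * (2 * s * kap)) * bump y)); last exact: tameZ bump_tame.
have := inner_near xR; apply: filterS => c cR; split.
  exact: (rhoM_tame 1 (V_cball cR)).
move=> y.
have kap0 : 0 <= kap by rewrite !mulr_ge0// ltW.
have [yR|yR] := ltP (sqnorm y) (Ro ^+ 2); last first.
  have out z : sqnorm z < Ri ^+ 2 -> rho z s y = 0.
    move=> zR; rewrite rho_out//; apply: contraTT yR; rewrite -!ltNge => /ltW.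
    exact: inner_ball.
  rewrite !out// expr2 !mulr0 subrr normr0 mulr_ge0// mulr_ge0 ?bump_ge0//.
  by rewrite !mulr_ge0// ltW.
rewrite -mulrBr subr_sqr normrM normrM.
apply: (@le_trans _ _ (Mv * (`|c - x| * kap * (2 * s)))).
  rewrite ler_pM ?V_le ?mulr_ge0// ler_pM ?rho_lip//.
  rewrite ger0_norm ?addr_ge0 ?rho_ge0// [2 * s]mulr_natl mulr2n lerD ?rho_le_s//.
have -> : Mv * (`|c - x| * kap * (2 * s)) = `|c - x| * (Mv * (2 * s * kap) * 1) by ring.
rewrite ler_wpM2l// ler_wpM2l ?bump_ge1//.
by rewrite !mulr_ge0// ltW.
Qed.

Lemma smooth_mass'_cont i : cont_ball (Ri ^+ 2) (smooth_mass' i).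
Proof.
move=> x xR; apply: contM; first exact: cont_cst.
have Mv0 := Mv_ge0 xR.
have RR : Ri <= Ro by apply: le_trans RiRo; rewrite lerDl ltW.
apply: (@Int_lip_cont K n (fun c y => V y * (y - c) ord0 i * rho c s y ^+ 1)
  (fun y => (Mv * (s + 2 * Ro * kap)) * bump y)); last exact: tameZ bump_tame.
have := inner_near xR; apply: filterS => c cR; split.
  apply: rhoM_tame => y yc; apply: contM; last exact: coordB_cont.
  exact: (V_cball cR yc).
move=> y.
have kap0 : 0 <= kap by rewrite !mulr_ge0// ltW.
have C0 : 0 <= Mv * (s + 2 * Ro * kap).
  by rewrite mulr_ge0// addr_ge0 ?mulr_ge0// ltW.
have [yR|yR] := ltP (sqnorm y) (Ro ^+ 2); last first.
  have out z : sqnorm z < Ri ^+ 2 -> rho z s y = 0.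
    move=> zR; rewrite rho_out//; apply: contraTT yR; rewrite -!ltNge => /ltW.
    exact: inner_ball.
  by rewrite !out// expr1 !mulr0 subrr normr0 mulr_ge0// mulr_ge0 ?bump_ge0.
rewrite !expr1.
have -> : V y * (y - c) ord0 i * rho c s y - V y * (y - x) ord0 i * rho x s y =
  V y * (- (c - x) ord0 i * rho c s y + (y - x) ord0 i * (rho c s y - rho x s y)).
  by rewrite !mxE; ring.
have e1 : `|- (c - x) ord0 i * rho c s y| <= `|c - x| * s.
  rewrite normrM normrN ler_pM ?mx_norm_coord//.
  by rewrite ger0_norm ?rho_ge0 ?rho_le_s.
have e2 : `|(y - x) ord0 i * (rho c s y - rho x s y)| <= 2 * Ro * (`|c - x| * kap).
  rewrite normrM ler_pM ?rho_lip// !mxE.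
  apply: (le_trans (ler_normB _ _)); rewrite [2 * Ro]mulr_natl mulr2n lerD//.
    by apply: coord_le; exact: ltW.
  by apply: (le_trans (coord_le i (ltW Ri0) (ltW xR))).
rewrite normrM.
apply: (@le_trans _ _ (Mv * (`|c - x| * s + 2 * Ro * (`|c - x| * kap)))).
  by rewrite ler_pM ?V_le// (le_trans (ler_normD _ _))// lerD.
have -> : Mv * (`|c - x| * s + 2 * Ro * (`|c - x| * kap)) =
   `|c - x| * (Mv * (s + 2 * Ro * kap) * 1) by ring.
by rewrite ler_wpM2l// ler_wpM2l ?bump_ge1.
Qed.

End kernel_parameter.

Section mollify.
Context (K : realType) (n : nat) (V : 'rV[K]_n -> K) (Ro Ri eps Mv om : K).
Hypothesis (Ri0 : 0 < Ri) (eps0 : 0 < eps) (RiRo : Ri + eps <= Ro).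
Hypothesis cV : cont_ball (Ro ^+ 2) V.
Hypothesis V_le : forall y, sqnorm y < Ro ^+ 2 -> `|V y| <= Mv.
Hypothesis osc : forall x y, sqnorm x < Ro ^+ 2 -> sqnorm y < Ro ^+ 2 ->
  sqnorm (y - x) <= eps ^+ 2 -> `|V y - V x| <= om.
Let s := eps ^+ 2.
Let s0 : 0 < s. Proof. by rewrite exprn_gt0. Qed.
Let RR : Ri ^+ 2 <= Ro ^+ 2.
Proof.
have h : Ri <= Ro by apply: le_trans RiRo; rewrite lerDl ltW.
by rewrite ler_sqr ?nnegrE ?(ltW Ri0)// (le_trans (ltW Ri0)).
Qed.
Let Psi (c : 'rV[K]_n) := wint c 1 s (fun=> 1).
Let Psi0 c : 0 < Psi c. Proof. exact: wint_gt0. Qed.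

Lemma le_norm_wint (c : 'rV[K]_n) k f C : cont_cball c s f ->
  (forall y, sqnorm (y - c) < s -> `|f y| <= C) -> `|wint c k s f| <= C * wint c k s (fun=> 1).
Proof.
move=> cf fC.
have cC a : cont_cball c s (fun=> a) by move=> y _; exact: cont_cst.
rewrite ler_norml -mulNr -!wintZ//; apply/andP; split; apply: le_wint => // y yc;
  rewrite mulr1; have := fC y yc; rewrite ler_norml => /andP[]//.
Qed.

(** The mass of the kernel does not move with its centre; by the divergence
    theorem its derivative is an integral of a derivative. *)
Lemma kernel_mass_isd i : partial_ball (Ri ^+ 2) i Psi (fun=> 0).
Proof.
have c1 : cont_ball (Ro ^+ 2) (fun _ : 'rV[K]_n => 1) by exact: cont_ball_cst.
have h1 (y : 'rV[K]_n) : sqnorm y < Ro ^+ 2 -> `|1 : K| <= 1 by rewrite normr1.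
move=> c cR.
have hd : is_derive c (evec K i) Psi (smooth_mass' (fun=> 1) eps i c).
  exact: (smooth_mass_isd Ri0 eps0 RiRo c1 h1).
apply: (is_derive_eq hd).
rewrite /smooth_mass'.
have cc1 : cont_cball c s (fun=> 1) by move=> y _; exact: cont_cst.
have cc0 : cont_cball c s (fun=> 0) by move=> y _; exact: cont_cst.
have d1 y : sqnorm (y - c) <= s -> is_derive y (evec K i) (fun=> 1 : K) ((fun=> 0 : K) y).
  by move=> _; exact: isd_cst.
have := wint_ibp 0 d1 cc1 cc0; rewrite wint_fun0 => /esym e.
rewrite (_ : (fun y => _) = (fun y => (y - c) ord0 i * 1)); last first.
  by apply/funext => y; rewrite mulrC.
by rewrite -e; ring.
Qed.

Lemma kernel_mass_cont : cont_ball (Ri ^+ 2) Psi.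
Proof.
have c1 : cont_ball (Ro ^+ 2) (fun _ : 'rV[K]_n => 1) by exact: cont_ball_cst.
have h1 (y : 'rV[K]_n) : sqnorm y < Ro ^+ 2 -> `|1 : K| <= 1 by rewrite normr1.
exact: (smooth_mass_cont Ri0 eps0 RiRo c1 h1).
Qed.

Let Phi := smooth_mass V eps.
Let Phi' := smooth_mass' V eps.

(** The average of V with the squared weight. Since the mass of the kernel has
    zero derivative, V may be replaced by V - V x in the derivative, which is
    then bounded by the oscillation om divided by eps. *)
Lemma mollify : exists (A : 'rV[K]_n -> K) (a : 'I_n -> 'rV[K]_n -> K),
  [/\ forall i, partial_ball (Ri ^+ 2) i A (a i), cont_ball (Ri ^+ 2) A & forall i, cont_ball (Ri ^+ 2) (a i)] /\
  [/\ forall x, sqnorm x < Ri ^+ 2 -> `|A x| <= Mv,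
      forall x, sqnorm x < Ri ^+ 2 -> `|A x - V x| <= om &
      forall i x, sqnorm x < Ri ^+ 2 -> `|a i x| <= (n%:R + 4) * om / eps].
Proof.
have cinv : cont_ball (Ri ^+ 2) (fun x => (Psi x)^-1).
  move=> x xR; apply: contV; first by rewrite gt_eqF.
  exact: kernel_mass_cont.
exists (fun x => Phi x * (Psi x)^-1), (fun i x => Phi' i x * (Psi x)^-1).
have cVc c : sqnorm c < Ri ^+ 2 -> cont_cball c s V.
  by move=> cR; exact: (V_cball Ri0 eps0 RiRo cV cR).
have inV c y : sqnorm c < Ri ^+ 2 -> sqnorm (y - c) < s -> sqnorm y < Ro ^+ 2.
  by move=> cR yc; exact: (inner_ball Ri0 eps0 RiRo cR (ltW yc)).
have cBV (c : 'rV[K]_n) (a : K) : sqnorm c < Ri ^+ 2 -> cont_cball c s (fun y => V y - a).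
  by move=> cR y yc; apply: contB; [exact: (cVc c cR y yc)|exact: cont_cst].
split; split.
- move=> i x xR.
  have dP := kernel_mass_isd i xR.
  have dV : is_derive x (evec K i) (fun y => (Psi y)^-1) 0.
    have [dP1 dP2] := dP; split; first by apply: derivableV => //; rewrite gt_eqF.
    by rewrite deriveV ?dP2 ?scaler0// gt_eqF.
  have dPhi : is_derive x (evec K i) Phi (Phi' i x).
    exact: (smooth_mass_isd Ri0 eps0 RiRo cV V_le).
  by apply: (is_derive_eq (isdM dPhi dV)); rewrite mulr0 addr0.
- apply: cont_ballM; last exact: cinv.
  exact: (smooth_mass_cont Ri0 eps0 RiRo cV V_le).
- move=> i; apply: cont_ballM; last exact: cinv.
  exact: (smooth_mass'_cont Ri0 eps0 RiRo cV V_le).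
- move=> x xR; rewrite normrM normfV (gtr0_norm (Psi0 x)) ler_pdivrMr//.
  apply: le_norm_wint; first exact: cVc.
  by move=> y yx; apply: V_le; exact: inV yx.
- move=> x xR.
  have -> : Phi x * (Psi x)^-1 - V x = wint x 1 s (fun y => V y - V x) / Psi x.
    rewrite (_ : (fun y => V y - V x) = (fun y => V y + - V x * 1)); last first.
      by apply/funext => y; rewrite mulr1.
    rewrite wintD ?wintZ//; last 3 first.
    + by move=> y _; exact: cont_cst.
    + exact: cVc.
    + by move=> y _; apply: contM; exact: cont_cst.
    rewrite -/(Psi x) /Phi /smooth_mass; have := Psi0 x; move: (Psi x) => p p0.
    by field; rewrite gt_eqF.
  rewrite normrM normfV (gtr0_norm (Psi0 x)) ler_pdivrMr//.
  apply: le_norm_wint; first exact: cBV.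
  move=> y yx; apply: osc; [exact: lt_le_trans RR|exact: inV yx|exact: ltW].
- move=> i x xR.
  rewrite normrM normfV (gtr0_norm (Psi0 x)) ler_pdivrMr//.
  have cx : cont_cball x s (fun y => (y - x) ord0 i).
    by move=> y _; exact: coordB_cont.
  have e1 : wint x 0 s (fun y => (y - x) ord0 i) = 0.
    have [_ h1] := kernel_mass_isd i xR.
    have c1 : cont_ball (Ro ^+ 2) (fun _ : 'rV[K]_n => 1) by exact: cont_ball_cst.
    have hn (y : 'rV[K]_n) : sqnorm y < Ro ^+ 2 -> `|1 : K| <= 1 by rewrite normr1.
    have hd : is_derive x (evec K i) Psi (smooth_mass' (fun=> 1) eps i x).
      exact: (smooth_mass_isd Ri0 eps0 RiRo c1 hn).
    have [_] := hd; rewrite h1 /smooth_mass' => /esym/eqP.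
    rewrite mulf_eq0 pnatr_eq0/= => /eqP e; rewrite -[RHS]e.
    by congr wint; apply/funext => y; rewrite mul1r.
  have -> : Phi' i x = 4 * wint x 0 s (fun y => (V y - V x) * (y - x) ord0 i).
    rewrite /Phi' /smooth_mass'; congr (_ * _).
    rewrite -[LHS]addr0 -[X in _ + X](mulr0 (- V x)) -e1 -wintZ// -wintD.
    + by congr wint; apply/funext => y; ring.
    + by move=> y yc; apply: contM; [exact: (cVc x xR y yc)|exact: coordB_cont].
    + by move=> y yc; apply: contM; [exact: cont_cst|exact: coordB_cont].
  have b1 : `|wint x 0 s (fun y => (V y - V x) * (y - x) ord0 i)|
      <= om * eps * wint x 0 s (fun=> 1).
    apply: le_norm_wint.
      by move=> y yc; apply: contM; [exact: (cBV x (V x) xR y yc)|exact: coordB_cont].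
    move=> y yx; rewrite normrM ler_pM//.
      by apply: osc; [exact: lt_le_trans RR|exact: inV yx|exact: ltW].
    by apply: coord_le; exact: ltW.
  have r := ball_mass_ratio x s.
  have -> : (n%:R + 4) * om / eps * Psi x = 4 * (om * eps * wint x 0 s (fun=> 1)).
    have -> : wint x 0 s (fun=> 1) = (1 + n%:R / 4) * Psi x / s.
      by rewrite /Psi -r; field; rewrite gt_eqF.
    by rewrite /s; field; rewrite gt_eqF.
  by rewrite normrM (ger0_norm (ler0n _ 4)) ler_wpM2l.
Qed.

End mollify.

(** * Lebesgue norms and Hoelder norms *)

Section bridge.
Context (K : realType) (n : nat).
Implicit Types (x y : 'rV[K]_n) (u V : 'rV[K]_n -> K[i]).

Lemma eballE (r : K) x : 0 < r -> eball n r x <-> sqnorm x < r ^+ 2.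
Proof.
move=> r0; have -> : eball n r x = (Num.sqrt (sqnorm x) < r) by [].
by rewrite -{1}(ger0_norm (ltW r0)) -sqrtr_sqr ltr_sqrt// exprn_gt0.
Qed.

Lemma cabs_sqr (z : K[i]) : cabs z ^+ 2 = complex.Re z ^+ 2 + complex.Im z ^+ 2.
Proof. by case: z => a b; rewrite /cabs /= sqr_sqrtr// addr_ge0 ?sqr_ge0. Qed.

Lemma cabs_ge0 (z : K[i]) : 0 <= cabs z.
Proof. by case: z => a b; rewrite /cabs /= sqrtr_ge0. Qed.

Lemma Re_le_cabs (z : K[i]) : `|complex.Re z| <= cabs z.
Proof.
by rewrite -ler_sqr ?nnegrE ?cabs_ge0// real_normK ?num_real// cabs_sqr lerDl sqr_ge0.
Qed.

Lemma Im_le_cabs (z : K[i]) : `|complex.Im z| <= cabs z.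
Proof.
by rewrite -ler_sqr ?nnegrE ?cabs_ge0// real_normK ?num_real// cabs_sqr lerDr sqr_ge0.
Qed.

(** Cubes have positive measure. *)
Lemma ae_open (P : 'rV[K]_n -> Prop) x0 :
  {ae lebesgue_tuple K n, forall t, P (rowt t)} -> ~ (\forall x \near x0, ~ P x).
Proof.
move=> [N [mN N0 PN]] /nbhs_ballP[r /= r0 h].
have d0 : 0 < r / 2 by rewrite divr_gt0.
have [B [mB [Bd /andP[B0 _]]]] := lebesgue_cube_gt0 x0 d0.
have BN : B `<=` N.
  move=> t Bt; apply: PN => /= Pt; apply: (h (rowt t)) Pt.
  rewrite -ball_normE/= distrC; apply: (@le_lt_trans _ _ (r / 2)); last first.
    by rewrite ltr_pdivrMr//; lra.
  by apply: mx_norm_le; [exact: ltW | exact: Bd].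
suff : (lebesgue_tuple K n B <= 0)%E by rewrite leNgt B0.
rewrite -N0; exact: (le_measure (lebesgue_tuple K n) (mem_set mB) (mem_set mN) BN).
Qed.

Lemma lebesgue_tupleT_gt0 : (0 < lebesgue_tuple K n setT)%E.
Proof.
have [B [mB [_ /andP[B0 _]]]] := @lebesgue_cube_gt0 K n 0 1 ltr01.
apply: lt_le_trans B0 _.
by apply: le_measure; rewrite ?inE//; exact: measurableT.
Qed.

Lemma Lnorm_pinfty_pointwise (R M : K) V x : 0 < R ->
  (Lp_norm_on +oo%E (eball n R) V <= M%:E)%E ->
  (\forall y \near x, eball n R y /\ M < cabs (V y)) -> False.
Proof.
move=> R0; rewrite /Lp_norm_on unlock /= lebesgue_tupleT_gt0 => /ess_supP h nx.
apply: (@ae_open (fun y => eball n R y -> cabs (V y) <= M) x).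
  apply: filterS h => t /=; rewrite -/(rowt t) patchE => h Ut.
  by move: h; rewrite mem_set//= lee_fin ger0_norm// cabs_ge0.
by apply: filterS nx => y [Uy My] /(_ Uy); rewrite leNgt My.
Qed.

Lemma holder_osc (b R M eps : K) V x y : 0 < b -> 0 <= M -> 0 <= eps ->
  (holder_seminorm b (eball n R) V <= M%:E)%E ->
  eball n R x -> eball n R y -> sqnorm (y - x) <= eps ^+ 2 ->
  cabs (V y - V x) <= M * eps `^ b.
Proof.
move=> b0 M0 e0 hV Ux Uy yx.
have [->|xy] := eqVneq y x.
  have -> : V x - V x = 0 by rewrite subrr.
  have -> : cabs (0 : K[i]) = 0 by rewrite /cabs /= expr0n/= addr0 sqrtr0.
  by rewrite mulr_ge0// powR_ge0.
have yx0 : 0 < enorm (y - x).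
  rewrite /enorm sqrtr_gt0 lt_neqAle sqnorm_ge0 andbT eq_sym.
  apply: contra xy; rewrite psumr_eq0; last by move=> i _; exact: sqr_ge0.
  move=> /allP h; rewrite -subr_eq0; apply/eqP/rowP => i; rewrite [RHS]mxE.
  by have := h i (mem_index_enum _); rewrite sqrf_eq0 => /eqP.
have : ((cabs (V y - V x) / enorm (y - x) `^ b)%:E <= M%:E)%E.
  apply: le_trans hV; apply: ereal_sup_ubound; exists y, x; split => //.
rewrite lee_fin ler_pdivrMr ?powR_gt0// => /le_trans; apply.
rewrite ler_wpM2l// ge0_ler_powR ?nnegrE ?(ltW b0) ?(ltW yx0)//.
by rewrite /enorm -[leRHS](ger0_norm e0) -sqrtr_sqr ler_wsqrtr.
Qed.

Section mass.
Context (R : K) (f : 'rV[K]_n -> K).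
Hypothesis cf : cont_ball (R ^+ 2) f.

Definition indB (r : K) x : K := ((sqnorm x < r ^+ 2)%R)%:R.
Definition mass (r : K) := Int (fun x => f x * indB r x).

(** Nothing is known on f outside the large ball, so the truncation is written
    as a bounded measurable function times the compactly supported continuous
    function f rho. *)
Lemma mass_tame r : 0 < r -> r < R -> tame (fun x => f x * indB r x).
Proof.
move=> r0 rR; have rR2 : r ^+ 2 < R ^+ 2.
  by rewrite ltr_sqr ?nnegrE// ltW// (lt_trans r0).
pose s := (r ^+ 2 + R ^+ 2) / 2.
have rs : r ^+ 2 < s by rewrite midf_lt.
have sR : s < R ^+ 2 by rewrite midf_lt.
pose q x := (Num.max 0 (r ^+ 2 - sqnorm (x - 0)) + (s - r ^+ 2))^-1.
have q0 x : 0 < Num.max 0 (r ^+ 2 - sqnorm (x - 0)) + (s - r ^+ 2).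
  by rewrite ltr_wpDl ?subr_gt0// le_max lexx.
have cq : continuous q.
  move=> x; apply: (contV (f := fun x => Num.max 0 (r ^+ 2 - sqnorm (x - 0)) + (s - r ^+ 2))).
    by rewrite gt_eqF.
  apply: contD; last exact: cont_cst.
  by apply: cont_max0; apply: contB; [exact: cont_cst|exact: sqnormB_cont].
have oU : open [set x : 'rV[K]_n | sqnorm x < r ^+ 2].
  rewrite (_ : [set x | _] = (fun x => sqnorm (x - 0)) @^-1` [set y | y < r ^+ 2]); last first.
    by apply/funext => x; rewrite /= subr0.
  apply: open_comp; last exact: open_lt.
  by move=> x _; exact: sqnormB_cont.
have mI : measurable_fun setT (indB r \o @rowt K n : _ -> measurableTypeR K).
  rewrite (_ : _ \o _ = \1_(@rowt K n @^-1` [set x | sqnorm x < r ^+ 2])).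
    by apply: measurable_indic; exact: measurable_rowt_open.
  apply/funext => t; rewrite /= /indB indicE.
  case: ltP => h; first by rewrite mem_set.
  by rewrite memNset//= => h'; move: (lt_le_trans h' h); rewrite ltxx.
have -> : (fun x => f x * indB r x) =
    (fun x => (indB r x * q x) * (f x * rho 0 s x ^+ 1)).
  apply/funext => x; rewrite /indB; have [h|h] := ltP (sqnorm x) (r ^+ 2); last first.
    by rewrite mulr0 !mul0r.
  rewrite /q subr0 max_r ?subr_ge0 ?(ltW h)// expr1 rho_in subr0; last first.
    by rewrite ltW// (lt_trans h).
  rewrite mul1r mulr1; field; rewrite gt_eqF// [X in _ < X](_ : _ = s - sqnorm x).
    by rewrite subr_gt0 (lt_trans h).
  by ring.
apply: tameM.
- apply: (measurable_funM mI); exact: measurable_rowt.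
- exists (s - r ^+ 2)^-1 => x; rewrite normrM.
  rewrite -[leRHS]mul1r ler_pM//; first by rewrite /indB; case: ltP; rewrite ?normr1// normr0.
  rewrite ger0_norm ?invr_ge0 ?(ltW (q0 x))// lef_pV2 ?posrE ?subr_gt0//.
  by rewrite lerDr le_max lexx.
- exact: (rhoM_tame 0 (cont_ball_closed sR cf)).
Qed.

End mass.

Lemma Lp2_mass (R r : K) u : 0 < r -> r < R ->
  cont_ball (R ^+ 2) (fun x => cabs (u x) ^+ 2) ->
  (Lp_norm_on 2%:E (eball n r) u = (Num.sqrt (mass (fun x => cabs (u x) ^+ 2) r))%:E)%E
  /\ 0 <= mass (fun x => cabs (u x) ^+ 2) r.
Proof.
move=> r0 rR cu; set f := fun x => cabs (u x) ^+ 2.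
have tf := mass_tame cu r0 rR.
have m0 : 0 <= mass f r.
  apply: Rintegral_ge0 => t _; by rewrite mulr_ge0 ?sqr_ge0// /indB ler0n.
split => //.
rewrite /Lp_norm_on unlock /=.
have -> : (\int[lebesgue_tuple K n]_t
   `|((EFin \o @cabs K \o u) \_ (eball n r)) (\row_i tnth t i)| `^ 2 = (mass f r)%:E)%E.
  rewrite /mass /Int /Rintegral fineK; last exact: (integrable_fin_num measurableT (tame_integrable tf)).
  apply: eq_integral => t _; rewrite -/(rowt t) patchE.
  have [Ut|Ut] := pselect (eball n r (rowt t)).
    rewrite mem_set//= ger0_norm ?cabs_ge0// (@powR_mulrn _ _ 2) ?cabs_ge0//.
    by rewrite /indB (eballE _ r0).1// mulr1.
  rewrite memNset//= normr0 powR0 ?pnatr_eq0// /indB.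
  by case: ltP => h; [exfalso; apply: Ut; exact/eballE|rewrite mulr0].
by rewrite poweR_EFin powR12_sqrt.
Qed.

End bridge.

(** * Data of a classical solution *)

Section data.
Context (K : realType) (n : nat).

Lemma cont_ball_le (R2 S2 : K) (f : 'rV[K]_n -> K) : S2 <= R2 -> cont_ball R2 f -> cont_ball S2 f.
Proof. by move=> SR cf x xS; apply: cf; exact: lt_le_trans SR. Qed.

Lemma partial_ball_le (R2 S2 : K) i (f f' : 'rV[K]_n -> K) : S2 <= R2 -> partial_ball R2 i f f' -> partial_ball S2 i f f'.
Proof. by move=> SR cf x xS; apply: cf; exact: lt_le_trans SR. Qed.

Lemma evec_norm i : `|evec K (n:=n) i| <= 1.
Proof.
by apply: mx_norm_le => // j; rewrite mxE; case: (_ && _); rewrite ?normr1// normr0.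
Qed.

Lemma C1_data (R : K) (f : 'rV[K]_n -> K) : 0 < R -> C1_on (eball n R) f ->
  [/\ cont_ball (R ^+ 2) f, forall i, cont_ball (R ^+ 2) (partial i f) &
      forall i, partial_ball (R ^+ 2) i f (partial i f)].
Proof.
move=> R0 h; split=> [x|i x|i x] /(eballE _ R0).2 /h [c d]; first by [].
  by have [] := d i.
by apply: derivableP; have [] := d i.
Qed.

Lemma C2_data (R : K) (f : 'rV[K]_n -> K) : 0 < R -> C2_on (eball n R) f ->
  [/\ cont_ball (R ^+ 2) f, forall i, cont_ball (R ^+ 2) (partial i f) &
      forall i, partial_ball (R ^+ 2) i f (partial i f)] /\
  [/\ forall i j, cont_ball (R ^+ 2) (partial i (partial j f)),
      forall i j, partial_ball (R ^+ 2) i (partial j f) (partial i (partial j f)) &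
      forall i j x, sqnorm x < R ^+ 2 ->
        partial i (partial j f) x = partial j (partial i f) x].
Proof.
move=> R0 [f1 f2]; have [cf cdf df] := C1_data R0 f1.
have cdd i j : cont_ball (R ^+ 2) (partial i (partial j f)).
  by have [] := C1_data R0 (f2 j).
have ddd i j : partial_ball (R ^+ 2) i (partial j f) (partial i (partial j f)).
  by have [] := C1_data R0 (f2 j).
split; first by apply: And3; [exact cf|exact cdf|exact df].
apply: And3; [exact cdd|exact ddd|] => i j x xR.
have /nbhs_ballP[r /= r0 h] := inner_near xR.
have inr y : `|y - x| < r -> sqnorm y < R ^+ 2.
  by move=> yx; apply: h; rewrite -ball_normE/= distrC.
apply: (@mixed_partials K _ f (partial i f) (partial j f) (partial i (partial j f))
  (partial j (partial i f)) x (evec K i) (evec K j) r r0 (evec_norm i) (evec_norm j)).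
- by move=> y /inr yR; exact: df.
- by move=> y /inr yR; exact: df.
- by move=> y /inr yR; exact: ddd.
- by move=> y /inr yR; exact: ddd.
- exact: cdd.
- exact: cdd.
Qed.

Lemma complex_eq0 (z : K[i]) : z = 0 -> complex.Re z = 0 /\ complex.Im z = 0.
Proof. by move=> ->. Qed.

Lemma solution_data (R : K) (V u : 'rV[K]_n -> K[i]) x : 0 < R ->
  classical_solution (eball n R) V u -> sqnorm x < R ^+ 2 ->
  (\sum_i partial i (partial i (re_part u)) x
     = re_part V x * re_part u x - im_part V x * im_part u x) /\
  (\sum_i partial i (partial i (im_part u)) x
     = im_part V x * re_part u x + re_part V x * im_part u x).
Proof.
move=> R0 [_ _ h] /(eballE _ R0).2 /h /complex_eq0.
rewrite /claplacian /re_part /im_part; case: (V x) => a b; case: (u x) => c d /=.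
rewrite /laplacian => -[e1 e2]; split.
  by apply/eqP; rewrite eq_sym -subr_eq0 -[X in _ == X]e1; apply/eqP; ring.
by apply/eqP; rewrite eq_sym -subr_eq0 -[X in _ == X]e2; apply/eqP; ring.
Qed.

Section potential.
Context (R M b : K) (V : 'rV[K]_n -> K[i]).
Hypothesis (R0 : 0 < R) (M0 : 0 < M) (b0 : 0 < b).
Hypothesis hV : (holder_norm b (eball n R) V <= M%:E)%E.

Lemma part_osc (eps : K) x y : 0 <= eps -> sqnorm x < R ^+ 2 -> sqnorm y < R ^+ 2 ->
  sqnorm (y - x) <= eps ^+ 2 ->
  `|re_part V y - re_part V x| <= M * eps `^ b /\
  `|im_part V y - im_part V x| <= M * eps `^ b.
Proof.
move=> e0 /(eballE _ R0).2 xR /(eballE _ R0).2 yR yx.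
have hs : (holder_seminorm b (eball n R) V <= M%:E)%E.
  by apply: le_trans hV; rewrite /holder_norm le_max lexx orbT.
have h := holder_osc b0 (ltW M0) e0 hs xR yR yx.
split; apply: le_trans h.
  by apply: le_trans (Re_le_cabs _); rewrite /re_part raddfB.
by apply: le_trans (Im_le_cabs _); rewrite /im_part raddfB.
Qed.

Lemma cont_of_osc (f : 'rV[K]_n -> K) : (forall (eps : K) x y, 0 <= eps -> sqnorm x < R ^+ 2 -> sqnorm y < R ^+ 2 ->
  sqnorm (y - x) <= eps ^+ 2 -> `|f y - f x| <= M * eps `^ b) -> cont_ball (R ^+ 2) f.
Proof.
move=> h x xR; apply: cont_epsP => e e0.
pose d := (e / M) `^ b^-1.
have d0 : 0 < d by rewrite powR_gt0// divr_gt0.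
have dE : M * d `^ b = e.
  rewrite /d -powRrM mulVf ?gt_eqF// powRr1 ?divr_ge0 ?ltW//.
  by rewrite mulrC divfK// gt_eqF.
have hc : (fun y => sqnorm (y - x)) @ x --> sqnorm (x - x) := @sqnormB_cont K n x x.
have hx : sqnorm (x - x) < d ^+ 2.
  by rewrite subrr /sqnorm big1 ?exprn_gt0// => i _; rewrite mxE expr0n.
near=> y.
rewrite -dE; apply: h => //; first exact: ltW.
  by near: y; exact: inner_near.
apply: ltW; near: y; exact: (hc _ (lt_nbhsl hx)).
Unshelve. all: by end_near. Qed.

Lemma part_cont : cont_ball (R ^+ 2) (re_part V) /\ cont_ball (R ^+ 2) (im_part V).
Proof.
split; apply: cont_of_osc => e x y e0 xR yR yx; by have [] := part_osc e0 xR yR yx.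
Qed.

Lemma part_le x : sqnorm x < R ^+ 2 -> `|re_part V x| <= M /\ `|im_part V x| <= M.
Proof.
have hl : (Lp_norm_on +oo%E (eball n R) V <= M%:E)%E.
  by apply: le_trans hV; rewrite /holder_norm le_max lexx.
have [c1 c2] := part_cont.
have key (f : 'rV[K]_n -> K) : cont_ball (R ^+ 2) f -> (forall y, `|f y| <= cabs (V y)) ->
    sqnorm x < R ^+ 2 -> `|f x| <= M.
  move=> cf fV xR; rewrite leNgt; apply/negP => Mf.
  apply: (Lnorm_pinfty_pointwise R0 hl (x := x)).
  have cn : (fun y => `|f y|) @ x --> `|f x| by apply: norm_cont; exact: cf.
  near=> y; split.
    by apply/(eballE _ R0); near: y; exact: inner_near.
  apply: lt_le_trans (fV y); near: y; exact: (cn _ (lt_nbhsr Mf)).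
move=> xR; split; apply: key => // y; [exact: Re_le_cabs|exact: Im_le_cabs].
Unshelve. all: by end_near. Qed.

End potential.

Section mass_bounds.
Context (R : K) (f : 'rV[K]_n -> K) (k : nat).
Hypothesis (cf : cont_ball (R ^+ 2) f) (f0 : forall x, 0 <= f x).

Lemma wint0_tame s : s < R ^+ 2 -> tame (fun x => f x * rho 0 s x ^+ k.+1).
Proof. by move=> sR; exact: (rhoM_tame k (cont_ball_closed sR cf)). Qed.

Lemma wint0_le_mass (r : K) : 0 < r -> r < R -> wint0 k (r ^+ 2) f <= (r ^+ 2) ^+ k.+1 * mass f r.
Proof.
move=> r0 rR; have rR2 : r ^+ 2 < R ^+ 2.
  by rewrite ltr_sqr ?nnegrE// ltW// (lt_trans r0).
have tm := mass_tame cf r0 rR.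
rewrite /mass -IntZ//; apply: le_Int; [exact: wint0_tame|exact: tameZ|] => x.
rewrite mulrCA ler_wpM2l// /indB; have [h|h] := ltP (sqnorm x) (r ^+ 2); last first.
  by rewrite mulr0 rho_out ?subr0// expr0n.
rewrite mulr1 lerXn2r ?nnegrE ?rho_ge0 ?sqr_ge0//.
by rewrite /rho ge_max sqr_ge0 gerBl sqnorm_ge0.
Qed.

(** On the ball of radius r the weight of the ball of radius 2 r is at least
    4 r^2 - r^2. *)
Lemma mass_le_wint0 (r : K) : 0 < r -> 2 * r < R ->
  (3 * r ^+ 2) ^+ k.+1 * mass f r <= wint0 k ((2 * r) ^+ 2) f.
Proof.
move=> r0 rR; have rR2 : (2 * r) ^+ 2 < R ^+ 2.
  by rewrite ltr_sqr ?nnegrE// ltW ?mulr_gt0// (lt_trans _ rR)// mulr_gt0.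
have tm : tame (fun x => f x * indB r x).
  by apply: (mass_tame cf r0); apply: lt_trans rR; rewrite -{1}[r]mul1r ltr_pM2r// ltr1n.
rewrite /mass -IntZ//; apply: le_Int; [exact: tameZ|exact: wint0_tame|] => x.
rewrite mulrCA ler_wpM2l// /indB; have [h|h] := ltP (sqnorm x) (r ^+ 2); last first.
  by rewrite mulr0 exprn_ge0// rho_ge0.
rewrite mulr1 lerXn2r ?nnegrE ?rho_ge0 ?mulr_ge0 ?(ltW r0)//.
rewrite rho_in subr0 exprMn.
  by move: h; move: (sqnorm x) (r ^+ 2) => p q pq; rewrite expr2; lra.
by have := sqr_ge0 r; move: h; move: (sqnorm x) (r ^+ 2) => p q pq q0; rewrite expr2; lra.
Qed.

End mass_bounds.

End data.

(** * Balancing the parameters *)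

Lemma powR_ge1 (K : realType) (a x : K) : 1 <= a -> 0 <= x -> 1 <= a `^ x.
Proof. by move=> a1 x0; rewrite -[leLHS](powRr0 a) ler_powR. Qed.

Section exponents.
Context (K : realType) (R M b : K).
Hypothesis (R1 : 1 <= R) (M1 : 1 <= M) (b0 : 0 < b).

Let R0 : 0 < R. Proof. exact: lt_le_trans R1. Qed.
Let M0 : 0 < M. Proof. exact: lt_le_trans M1. Qed.
Let X : K := M * R `^ (2 + b).
Let b3 : 0 < b + 3. Proof. by rewrite addr_gt0. Qed.

Definition freq_scale : K := M `^ (2 / (b + 3)) * R `^ ((4 + 2 * b) / (b + 3)).
(** The square root of the exponent, in the form whose power b + 3 is
    M R^(2+b). *)
Definition root_scale : K := X `^ (b + 3)^-1.

Let X1 : 1 <= X.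
Proof. by rewrite /X mulr_ege1// powR_ge1// addr_ge0// ltW. Qed.
Let X0 : 0 < X. Proof. exact: lt_le_trans X1. Qed.

Lemma root_scale_ge1 : 1 <= root_scale.
Proof. by rewrite powR_ge1// invr_ge0 ltW. Qed.

Lemma root_scale_gt0 : 0 < root_scale.
Proof. exact: lt_le_trans root_scale_ge1. Qed.

Lemma root_scale_powR : root_scale `^ (b + 3) = X.
Proof. by rewrite /root_scale -powRrM mulVf ?gt_eqF// powRr1// ltW. Qed.

Lemma root_scale_sqr : root_scale ^+ 2 = freq_scale.
Proof.
rewrite -powR_mulrn; last exact: ltW root_scale_gt0.
rewrite /root_scale -powRrM /X powRM ?powR_ge0 ?(ltW M0)// -powRrM /freq_scale.
by congr (_ `^ _ * _ `^ _); field; rewrite gt_eqF.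
Qed.

Lemma freq_scale_ge1 : 1 <= freq_scale.
Proof. by rewrite -root_scale_sqr exprn_ege1// root_scale_ge1. Qed.

Let R2X : M * R ^+ 2 <= X.
Proof.
rewrite /X ler_wpM2l ?(ltW M0)// -powR_mulrn ?(ltW R0)//.
by rewrite ler_powR// lerDl ltW.
Qed.

Lemma M_scale : b < 1 -> M * R ^+ 2 <= freq_scale ^+ 2.
Proof.
move=> b1; apply: (le_trans R2X).
rewrite -root_scale_powR -root_scale_sqr -exprM -powR_mulrn ?(ltW root_scale_gt0)//.
by rewrite ler_powR ?root_scale_ge1//; lra.
Qed.

Lemma osc_scale : M * (R / root_scale) `^ b * R ^+ 2 <= root_scale ^+ 3.
Proof.
have w0 := root_scale_gt0.
rewrite powRM ?invr_ge0 ?(ltW R0) ?(ltW w0)//.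
have -> : root_scale^-1 `^ b = (root_scale `^ b)^-1.
  by rewrite -powR_inv1 ?ltW// -powRrM mulN1r powRN.
have wb : 0 < root_scale `^ b by rewrite powR_gt0.
have -> : M * (R `^ b / root_scale `^ b) * R ^+ 2 = X / root_scale `^ b.
  rewrite /X powRD; last by rewrite (gt_eqF R0) implybT.
  by rewrite powR_mulrn ?(ltW R0)//; ring.
rewrite ler_pdivrMr// -root_scale_powR powRD; last by rewrite (gt_eqF w0) implybT.
by rewrite mulrC powR_mulrn// ltW.
Qed.

End exponents.

(** The powers of the radii interpolate exactly, except that 3 rh replaces
    4 rh; the loss ln (4 / 3) per unit of p is absorbed in the constant 5. *)
Lemma log_combine (K : realType) (p : nat) (th s1 s3 rh m1 m2 m3 H1 H2 H3 : K) :
  0 < s1 -> 0 < s3 -> 0 < rh -> 0 < m2 -> 0 < H1 -> 0 < H2 -> 0 < H3 ->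
  0 <= th -> th <= 1 ->
  ln (4 * rh) = th * ln s1 + (1 - th) * ln s3 ->
  H1 <= s1 ^+ p * m1 -> (3 * rh) ^+ p * m2 <= H2 -> H3 <= s3 ^+ p * m3 ->
  ln H2 <= th * ln H1 + (1 - th) * ln H3 + 3 * p%:R ->
  [/\ 0 < m1, 0 < m3 & ln m2 <= th * ln m1 + (1 - th) * ln m3 + 5 * p%:R].
Proof.
move=> s10 s30 rh0 m20 H10 H20 H30 th0 th1 s2E h1 h2 h3 hH.
have s1p : 0 < s1 ^+ p by rewrite exprn_gt0.
have s3p : 0 < s3 ^+ p by rewrite exprn_gt0.
have rh3 : 0 < 3 * rh by rewrite mulr_gt0.
have rp : 0 < (3 * rh) ^+ p by rewrite exprn_gt0.
have m10 : 0 < m1 by rewrite -(pmulr_rgt0 _ s1p) (lt_le_trans H10).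
have m30 : 0 < m3 by rewrite -(pmulr_rgt0 _ s3p) (lt_le_trans H30).
split => //.
have l1 : ln H1 <= p%:R * ln s1 + ln m1.
  rewrite mulr_natl -lnXn// -lnM ?posrE//.
  by rewrite ler_ln ?posrE// mulr_gt0.
have l3 : ln H3 <= p%:R * ln s3 + ln m3.
  rewrite mulr_natl -lnXn// -lnM ?posrE//.
  by rewrite ler_ln ?posrE// mulr_gt0.
have l2 : p%:R * ln (3 * rh) + ln m2 <= ln H2.
  rewrite mulr_natl -lnXn// -lnM ?posrE//.
  by rewrite ler_ln ?posrE// mulr_gt0.
have l43 : ln (4 * rh) - ln (3 * rh) <= 2.
  rewrite -ln_div ?posrE ?mulr_gt0//.
  have -> : 4 * rh / (3 * rh) = 4 / 3 by field; rewrite gt_eqF.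
  have h : (0 : K) < 4 / 3 by rewrite divr_gt0.
  by have := ln_sublinear h; lra.
have p0 : (0 : K) <= p%:R by [].
have a1 := ler_wpM2l th0 l1.
have th1' : 0 <= 1 - th by rewrite subr_ge0.
have a3 := ler_wpM2l th1' l3.
have a2 := ler_wpM2l p0 l43.
have e : p%:R * ln (4 * rh) = p%:R * (th * ln s1 + (1 - th) * ln s3) by rewrite s2E.
move: (ln H1) (ln H2) (ln H3) (ln m1) (ln m2) (ln m3) (ln s1) (ln s3) (ln (3 * rh)) (ln (4 * rh))
  (p%:R : K) l2 hH a1 a2 a3 e => x1 x2 x3 y1 y2 y3 z1 z3 w3 w4 P l2 hH a1 a2 a3 e.
lra.
Qed.

Lemma sqrt_exp_ln (K : realType) (m : K) : 0 < m -> Num.sqrt m = expR (ln m / 2).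
Proof.
move=> m0; rewrite -powR12_sqrt ?ltW//.
have E : m = expR (ln m) by rewrite lnK// posrE.
by rewrite {1}E -expRM.
Qed.

Lemma theta_bounds (K : realType) (r1 r2 r3 : K) : 0 < r1 -> r1 < r2 -> 2 * r2 < r3 ->
  0 < ln (r3 / (2 * r2)) / ln (r3 / r1) < 1.
Proof.
move=> r10 r12 r23.
have r20 : 0 < r2 by exact: lt_trans r12.
have r2' : 0 < 2 * r2 by rewrite mulr_gt0.
have r30 : 0 < r3 by exact: lt_trans r23.
have h12 : r1 < 2 * r2 by lra.
have l1 : 0 < ln (r3 / (2 * r2)) by rewrite ln_gt0// ltr_pdivlMr// mul1r.
have l2 : ln (r3 / (2 * r2)) < ln (r3 / r1).
  rewrite ltr_ln ?posrE ?divr_gt0//.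
  by rewrite ltr_pM2l// ltf_pV2 ?posrE.
have l3 := lt_trans l1 l2.
by rewrite divr_gt0//= ltr_pdivrMr// mul1r.
Qed.

Lemma interpolate (K : realType) (th x y z : K) : th * (x - y) = x - z ->
  2 * z = th * (2 * y) + (1 - th) * (2 * x).
Proof. by move=> e; lra. Qed.

Section mass_three_ball.
Context (K : realType) (n : nat) (b R M : K) (V u : 'rV[K]_n -> K[i]).
Hypothesis (n0 : (0 < n)%N) (b0 : 0 < b) (b1 : b < 1) (R1 : 1 <= R) (M1 : 1 <= M).
Hypothesis sol : classical_solution (eball n R) V u.
Hypothesis hV : (holder_norm b (eball n R) V <= M%:E)%E.

Let al := freq_scale R M b.
Let w := root_scale R M b.
Let Rw := R / 2.
Let eps := Rw / w.
Let om := M * eps `^ b.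
Let L := (n%:R + 4) * om / eps.
Let dd := 2 * om ^+ 2.
Context (k : nat).
Let m : K := k.+2%:R.
Let R0 : 0 < R. Proof. exact: lt_le_trans R1. Qed.
Let M0 : 0 < M. Proof. exact: lt_le_trans M1. Qed.
Let Rw0 : 0 < Rw. Proof. by rewrite divr_gt0. Qed.
Let w1 : 1 <= w. Proof. exact: root_scale_ge1. Qed.
Let w0 : 0 < w. Proof. exact: root_scale_gt0. Qed.
Let wal : w ^+ 2 = al. Proof. exact: root_scale_sqr. Qed.
Let al1 : 1 <= al. Proof. exact: freq_scale_ge1. Qed.
Let eps0 : 0 < eps. Proof. by rewrite divr_gt0. Qed.
Let om0 : 0 <= om. Proof. by rewrite mulr_ge0 ?(ltW M0)// powR_ge0. Qed.
Let Rwe : Rw + eps <= R.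
Proof.
have -> : R = Rw + Rw by rewrite /Rw -splitr.
by rewrite lerD2l /eps ler_pdivrMr// ler_peMr// ltW.
Qed.
Let RwR : Rw <= R. Proof. by rewrite /Rw ler_pdivrMr// ler_peMr ?(ltW R0)// ler1n. Qed.
Let nK1 : (1 : K) <= n%:R. Proof. by rewrite ler1n. Qed.

Hypothesis m_ge : (n%:R + 4) * al <= m.

Lemma oscillation_scale : om * Rw ^+ 2 <= w ^+ 3.
Proof.
apply: le_trans (osc_scale R1 M1 b0); rewrite -/w /om.
apply: ler_pM; rewrite ?mulr_ge0 ?powR_ge0 ?exprn_ge0 ?(ltW M0) ?(ltW Rw0) ?(ltW R0)//.
  rewrite ler_wpM2l ?(ltW M0)// ge0_ler_powR ?nnegrE ?(ltW b0) ?(ltW eps0)//.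
    by rewrite divr_ge0// ltW.
  by rewrite /eps ler_pM2r ?invr_gt0.
by rewrite lerXn2r ?nnegrE ?(ltW R0) ?(ltW Rw0).
Qed.

Let al_m : al <= m.
Proof.
apply: le_trans m_ge; rewrite ler_peMl//; first by rewrite (le_trans _ al1).
by have := nK1; lra.
Qed.

Lemma exponent_ge_size : M * Rw ^+ 2 <= m ^+ 2.
Proof.
apply: (@le_trans _ _ (al ^+ 2)); last first.
  by rewrite lerXn2r ?nnegrE// (le_trans _ al1).
apply: le_trans (M_scale R1 M1 b0 b1).
by rewrite ler_wpM2l ?(ltW M0)// lerXn2r ?nnegrE ?(ltW R0) ?(ltW Rw0).
Qed.

Lemma exponent_ge_gradient : n%:R * L * Rw ^+ 3 <= m ^+ 2.
Proof.
have -> : n%:R * L * Rw ^+ 3 = n%:R * (n%:R + 4) * (om * Rw ^+ 2 * w).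
  by rewrite /L /eps; field; rewrite !gt_eqF.
apply: (@le_trans _ _ (n%:R * (n%:R + 4) * al ^+ 2)).
  rewrite ler_wpM2l ?mulr_ge0 ?addr_ge0//.
  have -> : al ^+ 2 = w ^+ 3 * w by rewrite -wal; ring.
  by rewrite ler_wpM2r ?(ltW w0)// oscillation_scale.
apply: (@le_trans _ _ (((n%:R + 4) * al) ^+ 2)).
  rewrite [in X in _ <= X]exprMn_comm; last exact: mulrC.
  rewrite ler_wpM2r ?sqr_ge0// expr2 ler_wpM2r ?addr_ge0//.
  by rewrite lerDl.
have al0 : 0 <= al by rewrite (le_trans _ al1).
by rewrite lerXn2r ?nnegrE ?m_ge// mulr_ge0// addr_ge0.
Qed.

Lemma exponent_ge_remainder : dd * Rw ^+ 4 <= m ^+ 3.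
Proof.
have al0 : 0 <= al by rewrite (le_trans _ al1).
have -> : dd * Rw ^+ 4 = 2 * (om * Rw ^+ 2) ^+ 2 by rewrite /dd; ring.
apply: (@le_trans _ _ (2 * al ^+ 3)).
  rewrite ler_wpM2l//.
  have -> : al ^+ 3 = (w ^+ 3) ^+ 2 by rewrite -wal; ring.
  rewrite lerXn2r ?nnegrE ?oscillation_scale//; first by rewrite mulr_ge0// sqr_ge0.
  by rewrite exprn_ge0// ltW.
have h2 : 2 * al <= m.
  by apply: le_trans m_ge; rewrite ler_wpM2r//; have := nK1; lra.
apply: (@le_trans _ _ ((2 * al) ^+ 3)).
  rewrite [in X in _ <= X]exprMn_comm; last exact: mulrC.
  by rewrite ler_wpM2r ?exprn_ge0//; lra.
by rewrite lerXn2r ?nnegrE// mulr_ge0.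
Qed.

Let Rw2 : Rw ^+ 2 <= R ^+ 2.
Proof. by rewrite lerXn2r ?nnegrE ?(ltW R0) ?(ltW Rw0). Qed.

Lemma wmass_three_points (s1 s2 s3 th : K) : 0 < s1 -> s1 < s2 -> s2 < s3 -> s3 < Rw ^+ 2 ->
  th = ln (s3 / s2) / ln (s3 / s1) ->
  (0 < wmass k (re_part u) (im_part u) s1 ->
   ln (wmass k (re_part u) (im_part u) s2) <=
     th * ln (wmass k (re_part u) (im_part u) s1)
     + (1 - th) * ln (wmass k (re_part u) (im_part u) s3) + 3 * m) /\
  (wmass k (re_part u) (im_part u) s1 = 0 -> wmass k (re_part u) (im_part u) s2 = 0).
Proof.
move=> s10 s12 s23 s3R thE.
have [re2 im2 _] := sol.
have [[cu1 cd1 ud1] [ch1 dh1 sym1]] := C2_data R0 re2.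
have [[cu2 cd2 ud2] [ch2 dh2 sym2]] := C2_data R0 im2.
have [cV1 cV2] := part_cont R0 M0 b0 hV.
have V1le y : sqnorm y < R ^+ 2 -> `|re_part V y| <= M.
  by move=> yR; have [] := part_le R0 M0 b0 hV yR.
have V2le y : sqnorm y < R ^+ 2 -> `|im_part V y| <= M.
  by move=> yR; have [] := part_le R0 M0 b0 hV yR.
have o1 x y : sqnorm x < R ^+ 2 -> sqnorm y < R ^+ 2 -> sqnorm (y - x) <= eps ^+ 2 ->
    `|re_part V y - re_part V x| <= om.
  by move=> xR yR yx; have [] := part_osc R0 M0 b0 hV (ltW eps0) xR yR yx.
have o2 x y : sqnorm x < R ^+ 2 -> sqnorm y < R ^+ 2 -> sqnorm (y - x) <= eps ^+ 2 ->
    `|im_part V y - im_part V x| <= om.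
  by move=> xR yR yx; have [] := part_osc R0 M0 b0 hV (ltW eps0) xR yR yx.
have [A [a [[Aa cA ca] [Ale Aom ale]]]] := mollify Rw0 eps0 Rwe cV1 V1le o1.
have [Z [z [[Zz cZ cz] [Zle Zom zle]]]] := mollify Rw0 eps0 Rwe cV2 V2le o2.
have inR (x : 'rV[K]_n) : sqnorm x < Rw ^+ 2 -> sqnorm x < R ^+ 2.
  by move=> xR; exact: lt_le_trans Rw2.
have L0 : 0 <= L.
  apply: divr_ge0; last exact: ltW.
  by apply: mulr_ge0 => //; exact: addr_ge0.
have dd0 : 0 <= dd by rewrite mulr_ge0 ?sqr_ge0.
have Wle x : sqnorm x < Rw ^+ 2 ->
    (re_part V x - A x) ^+ 2 + (im_part V x - Z x) ^+ 2 <= dd.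
  move=> xR; rewrite /dd mulr_natl mulr2n; apply: lerD.
    by rewrite -real_normK ?num_real// distrC lerXn2r ?nnegrE// Aom.
  by rewrite -real_normK ?num_real// distrC lerXn2r ?nnegrE// Zom.
have r2 := Rw2.
pose A1 := fun i => partial_ball_le r2 (ud1 i).
pose A2 := fun i => partial_ball_le r2 (ud2 i).
pose A3 := fun i j => partial_ball_le r2 (dh1 i j).
pose A4 := fun i j => partial_ball_le r2 (dh2 i j).
pose S1 := fun i j x xR => sym1 i j x (inR x xR).
pose S2 := fun i j x xR => sym2 i j x (inR x xR).
pose C1 := cont_ball_le r2 cu1. pose C2 := cont_ball_le r2 cu2.
pose C3 := fun i => cont_ball_le r2 (cd1 i). pose C4 := fun i => cont_ball_le r2 (cd2 i).
pose C5 := fun i j => cont_ball_le r2 (ch1 i j). pose C6 := fun i j => cont_ball_le r2 (ch2 i j).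
pose C7 := cont_ball_le r2 cV1. pose C8 := cont_ball_le r2 cV2.
pose l1 := fun x xR => (solution_data R0 sol (inR x xR)).1.
pose l2 := fun x xR => (solution_data R0 sol (inR x xR)).2.
pose v1 := fun x xR => V1le x (inR x xR). pose v2 := fun x xR => V2le x (inR x xR).
split.
  move=> Hs1.
  exact: (wmass_three_point n0 Rw0 A1 A2 A3 A4 Aa Zz S1 S2 C1 C2 C3 C4 C5 C6 cA cZ ca cz
    C7 C8 l1 l2 (ltW M0) L0 dd0 Ale Zle v1 v2 Wle ale zle exponent_ge_size exponent_ge_gradient exponent_ge_remainder s10 s12 s23 s3R Hs1 thE).
exact: (wmass_vanish n0 Rw0 A1 A2 A3 A4 Aa Zz S1 S2 C1 C2 C3 C4 C5 C6 cA cZ ca cz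
    C7 C8 l1 l2 (ltW M0) L0 dd0 Ale Zle v1 v2 Wle ale zle exponent_ge_size exponent_ge_gradient exponent_ge_remainder s10 s12 s23 s3R).
Qed.

Let f (x : 'rV[K]_n) : K := cabs (u x) ^+ 2.

Lemma normsq_cabs : normsq (re_part u) (im_part u) = f.
Proof. by apply/funext => x; rewrite /f cabs_sqr. Qed.

Lemma cont_ball_cabs : cont_ball (R ^+ 2) f.
Proof.
have [re2 im2 _] := sol.
have [[cu1 _ _] _] := C2_data R0 re2.
have [[cu2 _ _] _] := C2_data R0 im2.
by rewrite -normsq_cabs; apply: cont_ball_normsq.
Qed.

Lemma mass_three_ball (r1 r2 r3 : K) : 0 < r1 -> r1 < r2 -> 2 * r2 < r3 -> r3 < R / 2 ->
  let th := ln (r3 / (2 * r2)) / ln (r3 / r1) in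
  (0 < mass f r2 -> [/\ 0 < mass f r1, 0 < mass f r3 &
    ln (mass f r2) <= th * ln (mass f r1) + (1 - th) * ln (mass f r3) + 5 * m])%R.
Proof.
move=> r10 r12 r23 r3R /=.
have /andP[th0 th1] := theta_bounds r10 r12 r23.
set th := _ / _ in th0 th1 *.
have r20 : 0 < r2 by exact: lt_trans r12.
have r30 : 0 < r3 by apply: lt_trans r23; rewrite mulr_gt0.
move=> m20.
have f0 x : 0 <= f x by rewrite sqr_ge0.
have cf := cont_ball_le Rw2 cont_ball_cabs.
have sqlt (x y : K) : 0 < x -> x < y -> x ^+ 2 < y ^+ 2.
  by move=> x0 xy; rewrite ltr_sqr ?nnegrE// ltW// (lt_trans x0).
have s12 : r1 ^+ 2 < (2 * r2) ^+ 2 by apply: sqlt => //; lra.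
have s23 : (2 * r2) ^+ 2 < r3 ^+ 2 by apply: sqlt => //; lra.
have s3R : r3 ^+ 2 < Rw ^+ 2 by apply: sqlt.
have s10 : 0 < r1 ^+ 2 by rewrite exprn_gt0.
have s30 : 0 < r3 ^+ 2 by rewrite exprn_gt0.
have lnsq (x : K) : 0 < x -> ln (x ^+ 2) = 2 * ln x.
  by move=> x0; rewrite lnXn// mulr_natl.
have l13 : 0 < ln (r3 / r1).
  by rewrite ln_gt0// ltr_pdivlMr// mul1r; lra.
have thE : th = ln (r3 ^+ 2 / (2 * r2) ^+ 2) / ln (r3 ^+ 2 / r1 ^+ 2).
  rewrite -!expr_div_n !lnsq ?divr_gt0 ?mulr_gt0//.
  by rewrite /th; field; rewrite gt_eqF.
have [hpos hzero] := wmass_three_points s10 s12 s23 s3R thE.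
have b2 : (3 * r2 ^+ 2) ^+ k.+2 * mass f r2 <= wmass k (re_part u) (im_part u) ((2 * r2) ^+ 2).
  rewrite /wmass normsq_cabs; apply: (mass_le_wint0 k.+1 cf f0) => //.
  by apply: lt_trans r3R.
have H2 : 0 < wmass k (re_part u) (im_part u) ((2 * r2) ^+ 2).
  by apply: lt_le_trans b2; rewrite mulr_gt0// exprn_gt0// mulr_gt0// exprn_gt0.
have H1 : 0 < wmass k (re_part u) (im_part u) (r1 ^+ 2).
  rewrite lt_neqAle eq_sym; apply/andP; split.
    by apply/negP => /eqP /hzero e; rewrite e ltxx in H2.
  rewrite /wmass normsq_cabs; apply: (wint0_ge0 (R2 := Rw ^+ 2)) => //.
  by apply: lt_trans s3R; apply: lt_trans s23.
have H3 : 0 < wmass k (re_part u) (im_part u) (r3 ^+ 2).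
  apply: lt_le_trans H2 _; rewrite /wmass normsq_cabs; apply: le_Int.
  - by apply: (wint0_tame k.+1 cf); exact: lt_trans s3R.
  - exact: (wint0_tame k.+1 cf).
  move=> x; rewrite ler_wpM2l//.
  by rewrite lerXn2r ?nnegrE ?rho_ge0// rho_le// ltW.
apply: (@log_combine K k.+2 th (r1 ^+ 2) (r3 ^+ 2) (r2 ^+ 2) _ _ _ _ _ _
  s10 s30 _ m20 H1 H2 H3 (ltW th0) (ltW th1) _ _ b2 _ (hpos H1)).
- by rewrite exprn_gt0.
- have -> : 4 * r2 ^+ 2 = (2 * r2) ^+ 2 by ring.
  rewrite !lnsq ?mulr_gt0//.
  apply: interpolate.
    rewrite /th !ln_div ?posrE ?mulr_gt0// divfK//.
    by rewrite gt_eqF// -ln_div ?posrE.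
- rewrite /wmass normsq_cabs; apply: (wint0_le_mass k.+1 cf f0 r10).
  by rewrite (lt_trans r12)// (lt_trans _ r3R)// (lt_trans _ r23)// ltr_pMl// ltr1n.
- by rewrite /wmass normsq_cabs; exact: (wint0_le_mass k.+1 cf f0 r30 r3R).
Qed.

End mass_three_ball.

(** * The three-ball inequality *)

Lemma truncn_bounds (K : realType) (N al : K) : 0 <= N -> 1 <= al ->
  exists k : nat, N * al <= k.+2%:R <= (N + 2) * al.
Proof.
move=> N0 al1; exists (Num.truncn (N * al)); apply/andP; split.
  by apply: ltW; apply: (lt_le_trans (truncnS_gt _)); rewrite ler_nat.
have h : (Num.truncn (N * al))%:R <= N * al.
  by rewrite Num.Theory.truncn_le mulr_ge0// (le_trans _ al1).
rewrite -addn2 natrD mulrDl lerD//.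
by rewrite ler_peMr.
Qed.

Lemma sqrt_interpolation (K : realType) (E th m1 m2 m3 : K) :
  0 < m1 -> 0 < m2 -> 0 < m3 ->
  ln m2 <= th * ln m1 + (1 - th) * ln m3 + E ->
  Num.sqrt m2 <= expR (E / 2) * Num.sqrt m1 `^ th * Num.sqrt m3 `^ (1 - th).
Proof.
move=> m10 m20 m30 h.
rewrite !sqrt_exp_ln// -!expRM -!expRD ler_expR.
move: h; move: (ln m1) (ln m2) (ln m3) => x y z h; nra.
Qed.

Theorem theorem1 (K : realType) (n : nat) (n_gt0 : (0 < n)%N) (beta : K)
    (beta_gt0 : 0 < beta) (beta_lt1 : beta < 1) :
  exists C : K, 0 < C /\
  forall (R M r1 r2 r3 : K) (V u : 'rV[K]_n -> K[i]),
    1 <= R -> 1 <= M ->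
    classical_solution (eball n R) V u ->
    (holder_norm beta (eball n R) V <= M%:E)%E ->
    0 < r1 -> r1 < r2 -> 2 * r2 < r3 -> r3 < R / 2 ->
    let theta := ln (r3 / (2 * r2)) / ln (r3 / r1) in
    0 < theta < 1 /\
    (Lp_norm_on 2%:E (eball n r2) u <=
       (expR (C * M `^ (2 / (beta + 3))
                * R `^ ((4 + 2 * beta) / (beta + 3))))%:E
       * poweR (Lp_norm_on 2%:E (eball n r1) u) theta
       * poweR (Lp_norm_on 2%:E (eball n r3) u) (1 - theta))%E.
Proof.
exists (5 / 2 * (n%:R + 4 + 2)); split.
  by rewrite mulr_gt0 ?divr_gt0// ltr_wpDl// addr_ge0.
move=> R M r1 r2 r3 V u R1 M1 sol hV r10 r12 r23 r3R theta.
split; first exact: theta_bounds.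
have R0 : 0 < R by exact: lt_le_trans R1.
have r20 : 0 < r2 by exact: lt_trans r12.
have r30 : 0 < r3 by apply: lt_trans r23; rewrite mulr_gt0.
have R2R : R / 2 < R by rewrite ltr_pdivrMr// ltr_pMr// ltr1n.
have r3R' : r3 < R by exact: lt_trans R2R.
have r2R : r2 < R.
  by apply: lt_trans r3R'; apply: lt_trans r23; rewrite ltr_pMl// ltr1n.
have r1R : r1 < R by exact: lt_trans r2R.
have cu := cont_ball_cabs R1 sol.
have [N1 p1] := Lp2_mass r10 r1R cu.
have [N2 p2] := Lp2_mass r20 r2R cu.
have [N3 p3] := Lp2_mass r30 r3R' cu.
rewrite N1 N2 N3 !poweR_EFin -!EFinM lee_fin.
set m1 := mass _ r1 in p1 *; set m2 := mass _ r2 in p2 *; set m3 := mass _ r3 in p3 *.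
have [m20|m20] := eqVneq m2 0.
  by rewrite m20 sqrtr0 mulr_ge0 ?powR_ge0// mulr_ge0 ?powR_ge0// expR_ge0.
have m2p : 0 < m2 by rewrite lt_neqAle eq_sym m20.
have n4 : (0 : K) <= n%:R + 4 by rewrite addr_ge0.
have [k /andP[kl ku]] := truncn_bounds n4 (freq_scale_ge1 R1 M1 beta_gt0).
have [m1p m3p h] := mass_three_ball n_gt0 beta_gt0 beta_lt1 R1 M1 sol hV kl
  r10 r12 r23 r3R m2p.
apply: le_trans (sqrt_interpolation m1p m2p m3p h) _.
rewrite ler_wpM2r ?powR_ge0// ler_wpM2r ?powR_ge0// ler_expR.
rewrite mulrAC [leRHS](_ : _ = 5 / 2 * ((n%:R + 4 + 2) * freq_scale R M beta)).
  by rewrite ler_wpM2l ?divr_ge0.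
by rewrite /freq_scale; ring.
Qed.
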